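(* With notation as in the context, for every $u\in\mathbb R^2_{<,+}$, $$d\big(e_1,\tfrac14(u,0)\big)^2=\phi\big((e_1,\tfrac14(u,0));(\Lambda^{-1}(u),0)\big).$$
   Context: $N_{3,2}$ is $\mathbb R^3\times\mathbb R^3$ with law $(x,t)\cdot(x',t')=(x+x',t+t'+\frac12\langle\mathbb Ux,x'\rangle)$, $\langle\mathbb Ux,x'\rangle=(\langle U^{(j)}x,x'\rangle)_{j=1}^3$, $\sum_j\tau_jU^{(j)}=\begin{pmatrix}0&\tau_3&-\tau_2\\-\tau_3&0&\tau_1\\\tau_2&-\tau_1&0\end{pmatrix}$, identity $o$; $d(g)$ is the Carnot–Carathéodory distance from $o$ (infimum of $\int_0^1|x'|$ over absolutely continuous curves from $o$ to $g$ with $t'=\frac12\langle\mathbb Ux,x'\rangle$); $e_1=(1,0,0)$. $\psi(s)=(1-s\cot s)/s^2$; $\phi((x,t);\tau)=|x|^2|\tau|\cot|\tau|+\psi(|\tau|)\langle\tau,x\rangle^2+4t\cdot\tau$ for $|\tau|\notin\pi\mathbb Z\setminus\{0\}$. $\vartheta_1$ is the unique solution of $\tan s=s$ in $(\pi,\frac32\pi)$. For $v=(v_1,v_2)$, $r=|v|$: $\Lambda(v)=v_2\big[\frac{\psi'(r)}{r}v_2v+2\psi(r)(0,1)\big]$, $\Omega_{-,4}=\{v:v_2<0,\ \pi<v_1<r<\vartheta_1,\ 2\psi(r)+\frac{\psi'(r)}{r}v_2^2<0\}$, $\mathbb R^2_{<,+}=\{(u_1,u_2):u_1>0,\ 0<u_2<\frac2{\sqrt\pi}\sqrt{u_1}\}$;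 $\Lambda$ is a diffeomorphism from $\Omega_{-,4}$ onto $\mathbb R^2_{<,+}$ and $\Lambda^{-1}$ denotes its inverse. *)

(* Defs.v *)
From HB Require Import structures.
From mathcomp Require Import all_boot all_order all_algebra.
From mathcomp Require Import all_classical all_reals.
From mathcomp Require Import topology normedtype derive trigo measure
  lebesgue_measure lebesgue_integral.
Set Implicit Arguments. Unset Strict Implicit. Unset Printing Implicit Defensive.
Import Order.TTheory GRing.Theory Num.Theory.
Local Open Scope classical_set_scope.
Local Open Scope ring_scope.

Section N32.
Variable R : realType.

Definition vec3 (a b c : R) : 'rV[R]_3 :=
  \row_(i < 3) (if i == 0 :> nat then a else if i == 1 :> nat then b else c).

Definition dot3 (x y : 'rV[R]_3) : R := \sum_(i < 3) x 0 i * y 0 i.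
Definition norm3 (x : 'rV[R]_3) : R := Num.sqrt (dot3 x x).

Definition Utau (tau : 'rV[R]_3) : 'M[R]_3 :=
  \matrix_(i < 3, k < 3)
    (let t1 := tau 0 0 in let t2 := tau 0 1 in let t3 := tau 0 2 in
     match nat_of_ord i, nat_of_ord k with
     | 0, 1 => t3 | 0, 2 => - t2
     | 1, 0 => - t3 | 1, 2 => t1
     | 2, 0 => t2 | 2, 1 => - t1
     | _, _ => 0 end).

Definition Umat (j : 'I_3) : 'M[R]_3 := Utau (delta_mx 0 j).

(* <U^(j) x, x'> (x, x' seen as column vectors) *)
Definition Uform (j : 'I_3) (x x' : 'rV[R]_3) : R :=
  dot3 (x *m (Umat j)^T) x'.

Definition Uvec (x x' : 'rV[R]_3) : 'rV[R]_3 := \row_(j < 3) Uform j x x'.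

Definition N32 := ('rV[R]_3 * 'rV[R]_3)%type.
Definition N32_mul (g g' : N32) : N32 :=
  (g.1 + g'.1, g.2 + g'.2 + 2^-1 *: Uvec g.1 g'.1).
Definition N32_id : N32 := (0, 0).

Definition leb := (@lebesgue_measure R).

(* An absolutely continuous curve [0,1] -> R^3 starting at 0 is the same as
   x(s) = int_0^s h for some h in L^1([0,1];R^3) (and then x' = h a.e.).
   A horizontal curve gamma = (x,t) from o has t(s) = int_0^s 1/2 <U x, x'>. *)
Definition curve_x (h : 'I_3 -> R -> R) (s : R) : 'rV[R]_3 :=
  \row_(i < 3) (\int[leb]_(r in `[0, s]) h i r).
Definition curve_t (h : 'I_3 -> R -> R) (s : R) : 'rV[R]_3 :=
  \row_(j < 3) (\int[leb]_(r in `[0, s]) (2^-1 * Uform j (curve_x h r) (\row_(i < 3) h i r))).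
Definition curve_length (h : 'I_3 -> R -> R) : R :=
  \int[leb]_(r in `[0, 1]) norm3 (\row_(i < 3) h i r).

Definition ccdist (g : N32) : R :=
  inf [set L | exists h : 'I_3 -> R -> R,
         (forall i, leb.-integrable `[0, 1] (fun r => (h i r)%:E)) /\
         curve_x h 1 = g.1 /\ curve_t h 1 = g.2 /\ L = curve_length h].

Definition cot (s : R) : R := cos s / sin s.
Definition psi (s : R) : R := (1 - s * cot s) / s ^+ 2.

Definition phi (g : N32) (tau : 'rV[R]_3) : R :=
  let x := g.1 in let t := g.2 in let nt := norm3 tau in
  norm3 x ^+ 2 * nt * cot nt + psi nt * (dot3 tau x) ^+ 2 + 4 * dot3 t tau.

(* vartheta_1 : the unique solution of tan s = s in (pi, 3pi/2) *)
Definition theta1 : R :=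
  xget 0 [set s | pi < s < 3 / 2 * pi /\ tan s = s].

Definition e1 : 'rV[R]_3 := vec3 1 0 0.

Definition norm2 (v : R * R) : R := Num.sqrt (v.1 ^+ 2 + v.2 ^+ 2).

Definition Lambda (v : R * R) : R * R :=
  let r := norm2 v in
  (v.2 * ((derive1 psi r) / r * v.2 * v.1 + 2 * psi r * 0),
   v.2 * ((derive1 psi r) / r * v.2 * v.2 + 2 * psi r * 1)).

Definition Omega_m4 : set (R * R) :=
  [set v | v.2 < 0 /\ pi < v.1 < norm2 v /\ norm2 v < theta1 /\
           2 * psi (norm2 v) + (derive1 psi (norm2 v)) / norm2 v * v.2 ^+ 2 < 0].

Definition R2_lt_plus : set (R * R) :=
  [set u | 0 < u.1 /\ 0 < u.2 < 2 / Num.sqrt pi * Num.sqrt u.1].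

(* Lambda^{-1} : the (unique) preimage in Omega_{-,4} *)
Definition Lambda_inv (u : R * R) : R * R :=
  xget (0, 0) [set v | Omega_m4 v /\ Lambda v = u].

End N32.

(* Main.v *)
(** Write [m r = r cot r - 1], so that [psi r = - m r / r ^+ 2], and let [v = Lambda_inv u],
    [rs = |v|], [rho = - v.2].

    Upper bound: the helix with axis [v] and angular velocity [2 rs] ends at the required point,
    and its squared length is [phi (_; v)].

    Lower bound: for [pi < r <= theta1] the quadratic functional [|x'|^2 - 4 r (n, t)] is not
    bounded below on curves with fixed endpoints, but its negative directions are only the
    rotations of period one about the axis [n].  For a given competitor and a given [r] there is
    an axis [n] for which the competitor and the critical helix have the same Fourier coefficient
    on that mode, and then [length ^ 2 >= phi (_; r n)].  As [r] decreases to [pi] the axis [n]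
    tends to [e1]; by the intermediate value theorem some [r n] lies either at distance [rho]
    from the line [R e1], or on the sphere of radius [theta1] at distance at most [rho] from it.
    On this barrier [phi] is at least [phi (_; v)]: [v] is a saddle point of [phi], minimal along
    the line parallel to [e1], because [psi' r / r * v.1] decreases along it, and [psi] vanishes at
    [theta1].  All this is carried out for polygons with [N] vertices at equal arc length, where
    the Fourier analysis is a finite sum; the errors vanish as [N] grows.

    Surjectivity of [Lambda]: with [q = rho / r], the second equation determines [r] from [q]
    because [m r / r] is decreasing, and the first one is solved by the intermediate value
    theorem in [q]; the condition [u.2 < 2 / sqrt pi * sqrt u.1] is its sign as [q] tends to [0]. *)
Require Import Defs.
From HB Require Import structures.
From mathcomp Require Import all_boot all_order all_algebra.
From mathcomp Require Import all_classical all_reals.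
From mathcomp Require Import topology normedtype derive trigo measure
  lebesgue_measure lebesgue_integral.
From mathcomp Require Import measurable_realfun realfun ftc.
From mathcomp Require Import ring lra.
Import Order.TTheory GRing.Theory Num.Theory.
Import numFieldNormedType.Exports.
Local Open Scope classical_set_scope.
Local Open Scope ring_scope.
Set Implicit Arguments. Unset Strict Implicit. Unset Printing Implicit Defensive.

(** * Pointwise continuity and derivatives *)

Section PointwiseContinuity.
Context {R : realType}.
Implicit Types (f g : R -> R) (x : R).

Definition cont_at f x := {for x, continuous f}.

Lemma contD f g x : cont_at f x -> cont_at g x -> cont_at (fun y => f y + g y) x.
Proof. by move=> cf cg; apply: cvgD. Qed.

Lemma contN f x : cont_at f x -> cont_at (fun y => - f y) x.
Proof. by move=> cf; apply: cvgN. Qed.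

Lemma contM f g x : cont_at f x -> cont_at g x -> cont_at (fun y => f y * g y) x.
Proof. by move=> cf cg; apply: cvgM. Qed.

Lemma cont_cst (c : R) x : cont_at (fun=> c) x.
Proof. exact: cst_continuous. Qed.

Lemma cont_id x : cont_at (fun y : R => y) x.
Proof. by []. Qed.

Lemma contX n f x : cont_at f x -> cont_at (fun y => f y ^+ n) x.
Proof.
move=> cf; elim: n => [|n IH]; first exact: cont_cst.
have -> : (fun y => f y ^+ n.+1) = (fun y => f y * f y ^+ n) by apply/funext => y; rewrite exprS.
exact: contM.
Qed.

Lemma contV f x : f x != 0 -> cont_at f x -> cont_at (fun y => (f y)^-1) x.
Proof. by move=> f0 cf; apply: cvgV. Qed.

Lemma cont_comp g f x : cont_at g (f x) -> cont_at f x -> cont_at (fun y => g (f y)) x.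
Proof. by move=> cg cf; exact: (continuous_comp cf cg). Qed.

Lemma cont_sqrt f x : cont_at f x -> cont_at (fun y => Num.sqrt (f y)) x.
Proof. by apply: cont_comp; exact: sqrt_continuous. Qed.

Lemma cont_sin f x : cont_at f x -> cont_at (fun y => sin (f y)) x.
Proof. by apply: cont_comp; exact: continuous_sin. Qed.

Lemma cont_cos f x : cont_at f x -> cont_at (fun y => cos (f y)) x.
Proof. by apply: cont_comp; exact: continuous_cos. Qed.

Lemma zero_between f (a b : R) : a <= b ->
  (forall x, a <= x <= b -> cont_at f x) -> f a <= 0 <= f b ->
  exists2 c, a <= c <= b & f c = 0.
Proof.
move=> ab cf /andP[fa fb]; have [||c] := @IVT R f a b 0 ab.
- by apply: continuous_in_subspaceT => x; rewrite inE /= in_itv /=; exact: cf.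
- by rewrite ge_min fa le_max fb orbT.
by rewrite in_itv /=; exists c.
Qed.

End PointwiseContinuity.

(** Recursion on the head operation of the function. The goals left over are the nonvanishing
    conditions of the inverses; functions without a rule are looked up in the context. *)
Ltac continuity :=
  lazymatch goal with
  | |- cont_at (fun y => y) _ => exact: cont_id
  | |- cont_at (fun _ => ?c) _ => exact: cont_cst
  | |- cont_at (fun y => GRing.add (@?f y) (@?g y)) _ =>
      refine (@contD _ f g _ _ _); continuity
  | |- cont_at (fun y => GRing.opp (@?f y)) _ => refine (@contN _ f _ _); continuity
  | |- cont_at (fun y => GRing.mul (@?f y) (@?g y)) _ =>
      refine (@contM _ f g _ _ _); continuity
  | |- cont_at (fun y => GRing.exp (@?f y) ?n) _ => refine (@contX _ n f _ _); continuity
  | |- cont_at (fun y => GRing.inv (@?f y)) _ => refine (@contV _ f _ _ _); [ | continuity]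
  | |- cont_at (fun y => Num.sqrt (@?f y)) _ => refine (@cont_sqrt _ f _ _); continuity
  | |- cont_at (fun y => sin (@?f y)) _ => refine (@cont_sin _ f _ _); continuity
  | |- cont_at (fun y => cos (@?f y)) _ => refine (@cont_cos _ f _ _); continuity
  | |- _ => try assumption
  end.

Section PointwiseDerivative.
Context {R : realType}.
Implicit Types (f g : R -> R) (x d e : R).

Definition der_at f d x := is_derive x (1 : R) f d.

Lemma der_eq f d e x : der_at f d x -> d = e -> der_at f e x.
Proof. by move=> ? <-. Qed.

Lemma derD f g d e x : der_at f d x -> der_at g e x -> der_at (fun y => f y + g y) (d + e) x.
Proof. by move=> df dg; exact: is_deriveD. Qed.

Lemma derN f d x : der_at f d x -> der_at (fun y => - f y) (- d) x.
Proof. by move=> df; exact: is_deriveN. Qed.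

Lemma derM f g d e x : der_at f d x -> der_at g e x ->
  der_at (fun y => f y * g y) (f x * e + g x * d) x.
Proof. by move=> df dg; exact: is_deriveM. Qed.

Lemma derX n f d x : der_at f d x -> der_at (fun y => f y ^+ n) (n%:R * f x ^+ n.-1 * d) x.
Proof.
move=> df; have := @is_deriveX _ _ f n x 1 d df.
by have -> : f ^+ n = (fun y => f y ^+ n) by apply/funext => y; rewrite fctE.
Qed.

Lemma derV f d x : f x != 0 -> der_at f d x -> der_at (fun y => (f y)^-1) (- (d / f x ^+ 2)) x.
Proof.
move=> f0 df; have := @is_deriveV _ f x d 1 f0 df.
by move=> h; apply: (der_eq h); rewrite /GRing.scale /= mulNr mulrC.
Qed.

Lemma der_comp g f d e x : der_at g e (f x) -> der_at f d x -> der_at (fun y => g (f y)) (e * d) x.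
Proof. by move=> dg df; exact: is_derive1_comp. Qed.

Lemma der_sin f d x : der_at f d x -> der_at (fun y => sin (f y)) (cos (f x) * d) x.
Proof. by move=> df; apply: der_comp df; exact: is_derive_sin. Qed.

Lemma der_cos f d x : der_at f d x -> der_at (fun y => cos (f y)) (- sin (f x) * d) x.
Proof. by move=> df; apply: der_comp df; exact: is_derive_cos. Qed.

Lemma der_cst (c : R) x : der_at (fun=> c) 0 x.
Proof. exact: is_derive_cst. Qed.

Lemma der_id x : der_at (fun y => y) 1 x.
Proof. exact: is_derive_id. Qed.

Lemma der_cont f d x : der_at f d x -> cont_at f x.
Proof.
move=> df; apply: differentiable_continuous; apply/derivable1_diffP.
exact: (@ex_derive _ _ _ _ _ _ _ df).
Qed.

Lemma der_sqrt f d x : 0 < f x -> der_at f d x ->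
  der_at (fun y => Num.sqrt (f y)) ((2 * Num.sqrt (f x))^-1 * d) x.
Proof. by move=> f0 df; apply: der_comp df; exact: is_derive1_sqrt. Qed.

Lemma der_nonincreasing f (df : R -> R) (a b : R) : a <= b ->
  (forall x, a <= x <= b -> der_at f (df x) x) -> (forall x, a <= x <= b -> df x <= 0) -> f b <= f a.
Proof.
rewrite le_eqVlt => /predU1P[-> //|ab] hd hn; have [||c] := @MVT R f df a b ab.
- by move=> x; rewrite in_itv /= => /andP[ax xb]; apply: hd; rewrite !ltW.
- apply: continuous_in_subspaceT => x; rewrite inE /= in_itv /= => h.
  exact: der_cont (hd _ h).
rewrite in_itv /= => /andP[ac cb] E.
by rewrite -subr_le0 E mulr_le0_ge0 ?subr_ge0 ?(ltW ab) // hn // !ltW.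
Qed.

Lemma der_decreasing f (df : R -> R) (a b : R) : a < b ->
  (forall x, a <= x <= b -> der_at f (df x) x) -> (forall x, a <= x <= b -> df x < 0) -> f b < f a.
Proof.
move=> ab hd hn; have [||c] := @MVT R f df a b ab.
- by move=> x; rewrite in_itv /= => /andP[ax xb]; apply: hd; rewrite !ltW.
- apply: continuous_in_subspaceT => x; rewrite inE /= in_itv /= => h.
  exact: der_cont (hd _ h).
rewrite in_itv /= => /andP[ac cb] E.
by rewrite -subr_lt0 E nmulr_rlt0 ?subr_gt0 // hn // !ltW.
Qed.

End PointwiseDerivative.

Ltac derive_at :=
  lazymatch goal with
  | |- der_at (fun y => y) _ _ => exact: der_id
  | |- der_at (fun _ => ?c) _ _ => exact: der_cst
  | |- der_at (fun y => GRing.add (@?f y) (@?g y)) _ _ =>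
      refine (@derD _ f g _ _ _ _ _); derive_at
  | |- der_at (fun y => GRing.opp (@?f y)) _ _ => refine (@derN _ f _ _ _); derive_at
  | |- der_at (fun y => GRing.mul (@?f y) (@?g y)) _ _ =>
      refine (@derM _ f g _ _ _ _ _); derive_at
  | |- der_at (fun y => GRing.exp (@?f y) ?n) _ _ => refine (@derX _ n f _ _ _); derive_at
  | |- der_at (fun y => GRing.inv (@?f y)) _ _ => refine (@derV _ f _ _ _ _); [ | derive_at]
  | |- der_at (fun y => sin (@?f y)) _ _ => refine (@der_sin _ f _ _ _); derive_at
  | |- der_at (fun y => cos (@?f y)) _ _ => refine (@der_cos _ f _ _ _); derive_at
  | |- _ => try eassumption
  end.

(** * The area of a polygon *)

Section Fourier.
Context {R : realType}.
Implicit Types (a b : nat -> R) (r t x : R).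

Lemma sin_period x m : sin (x + m%:R * (2 * pi)) = sin x.
Proof.
have -> : m%:R * (2 * pi) = (pi *+ 2) *+ m :> R by rewrite -[RHS]mulr_natl mulr2n; lra.
exact: (periodicn (@sinD2pi R)).
Qed.

Lemma cos_period x m : cos (x + m%:R * (2 * pi)) = cos x.
Proof.
have -> : m%:R * (2 * pi) = (pi *+ 2) *+ m :> R by rewrite -[RHS]mulr_natl mulr2n; lra.
exact: (periodicn (@cosD2pi R)).
Qed.

(** Multiplication by [2 * sin (x / 2)] makes both sums telescope. The undivided form holds for
    every [x], including the multiples of [2 * pi]. *)
Lemma sum_cos_sin_arith x N :
  (2 * sin (x / 2) * \sum_(j < N) cos (j%:R * x) =
    sin (N%:R * x - x / 2) + sin (x / 2)) *
  (2 * sin (x / 2) * \sum_(j < N) sin (j%:R * x) =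
    cos (x / 2) - cos (N%:R * x - x / 2)).
Proof.
elim: N => [|N [IHc IHs]].
  by rewrite !big_ord0 !mulr0 mul0r sub0r sinN cosN addNr subrr.
have eC : N.+1%:R * x - x / 2 = N%:R * x + x / 2 by rewrite -natr1; field.
split; rewrite big_ord_recr /= mulrDr ?IHc ?IHs eC !(sinD, cosD) ?(sinN, cosN); ring.
Qed.

(** With [x = m om], the right-hand sides of the closed forms vanish because [N x] is a multiple of
    [2 * pi], while [x / 2] lies strictly between [0] and [pi]. *)
Lemma root_sums_vanish N m (om := 2 * pi / N%:R : R) : (0 < m < N)%N ->
  (\sum_(j < N) cos (j%:R * (m%:R * om)) = 0) * (\sum_(j < N) sin (j%:R * (m%:R * om)) = 0).
Proof.
move=> /andP[m0 mN]; set x := m%:R * om.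
have N0 : 0 < N%:R :> R by rewrite ltr0n (leq_ltn_trans _ mN).
have xE : x = m%:R / N%:R * (2 * pi) by rewrite /x /om; field; rewrite gt_eqF.
have Nx : N%:R * x = m%:R * (2 * pi) by rewrite xE; field; rewrite gt_eqF.
have s0 : 2 * sin (x / 2) != 0.
  have -> : x / 2 = m%:R / N%:R * pi by rewrite xE; field; rewrite gt_eqF.
  have q0 : 0 < m%:R / N%:R :> R by rewrite divr_gt0 // ltr0n.
  have q1 : m%:R / N%:R < 1 :> R by rewrite ltr_pdivrMr // mul1r ltr_nat.
  have p0 := pi_gt0 R.
  by rewrite gt_eqF // mulr_gt0 // sin_gt0_pi //; apply/andP; split; nra.
have [hc hs] := sum_cos_sin_arith x N.
move: hc hs; rewrite Nx ![_ * (2 * pi) - _]addrC sin_period cos_period sinN cosN addNr subrr.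
move=> /(canRL (mulKf s0)) -> /(canRL (mulKf s0)) ->.
by rewrite !mulr0.
Qed.

(** [dftU] and [dftV] are the real and the imaginary part of the discrete Fourier transform of
    [a k + i b k], the sum of [(a k + i b k) exp (- i k x)]. *)
Definition dftU a b N x : R := \sum_(k < N) (a k * cos (k%:R * x) + b k * sin (k%:R * x)).
Definition dftV a b N x : R := \sum_(k < N) (b k * cos (k%:R * x) - a k * sin (k%:R * x)).

(** The squares expand into a double sum over pairs of vertices; summing over the frequencies kills
    the off-diagonal pairs by the orthogonality [ort]. *)
Lemma parseval a b N (om := 2 * pi / N%:R : R) :
  \sum_(j < N) (dftU a b N (j%:R * om) ^+ 2 + dftV a b N (j%:R * om) ^+ 2) =
  N%:R * \sum_(k < N) (a k ^+ 2 + b k ^+ 2).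
Proof.
have ort (k l : 'I_N) :
   (\sum_(j < N) cos (j%:R * ((k%:R - l%:R) * om)) = N%:R *+ (k == l)) *
   (\sum_(j < N) sin (j%:R * ((k%:R - l%:R) * om)) = 0).
  have [->|kl] := eqVneq k l.
    rewrite subrr mul0r; split.
      rewrite (eq_bigr (fun=> 1)) => [|j _]; last by rewrite mulr0 cos0.
      by rewrite sumr_const card_ord mulr1n.
    by rewrite big1 // => j _; rewrite mulr0 sin0.
  have [lt_kl|lt_lk|/val_inj/eqP] := ltngtP k l; last by rewrite (negbTE kl).
    have [|hc hs] := @root_sums_vanish N (l - k)%N; first by rewrite subn_gt0 lt_kl (leq_ltn_trans (leq_subr _ _)).
    have E j : j%:R * ((k%:R - l%:R) * om) = - (j%:R * ((l - k)%N%:R * om)).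
      by rewrite natrB ?(ltnW lt_kl)//; ring.
    split; first by under eq_bigr do rewrite E cosN; rewrite hc.
    by under eq_bigr do rewrite E sinN; rewrite sumrN hs oppr0.
  have [|hc hs] := @root_sums_vanish N (k - l)%N; first by rewrite subn_gt0 lt_lk (leq_ltn_trans (leq_subr _ _)).
  by rewrite -natrB ?(ltnW lt_lk).
transitivity (\sum_(j < N) \sum_(k < N) \sum_(l < N)
   ((a k * a l + b k * b l) * cos (j%:R * ((k%:R - l%:R) * om)) +
    (b k * a l - a k * b l) * sin (j%:R * ((k%:R - l%:R) * om)))).
  apply: eq_bigr => j _; rewrite /dftU /dftV !expr2 !big_distrlr /= -big_split /=.
  apply: eq_bigr => k _; rewrite -big_split /=; apply: eq_bigr => l _.
  have -> : j%:R * ((k%:R - l%:R) * om) = k%:R * (j%:R * om) - l%:R * (j%:R * om) by ring.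
  by rewrite cosB sinB; ring.
rewrite exchange_big mulr_sumr; apply: eq_bigr => k _ /=.
rewrite exchange_big (bigD1 k) //= [X in _ + X]big1 => [|l lk].
  rewrite addr0 big_split /= -!mulr_sumr (ort k k).1 (ort k k).2 eqxx mulr1n; ring.
by rewrite big_split /= -!mulr_sumr (ort k l).1 (ort k l).2 eq_sym (negbTE lk) !mulr0 addr0.
Qed.

End Fourier.

(** * Length and area of closed planar polygons *)

Section ClosedPolygon.
Context {R : realType}.
Implicit Types (a b : nat -> R) (be r t x : R).

Lemma cos_le_cos_arc be y : 0 <= be <= pi -> be <= y <= 2 * pi - be -> cos y <= cos be.
Proof.
move=> /andP[b0 bp] /andP[by_ yb].
have mono (z w : R) : 0 <= z <= pi -> 0 <= w <= pi -> z <= w -> cos w <= cos z.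
  move=> hz hw zw; rewrite leNgt; apply/negP => h.
  have := @ltr_cos R w z; rewrite !in_itv /= => /(_ hw hz).
  by rewrite h => /esym; rewrite ltNge zw.
have p0 := pi_gt0 R.
have [yp|py] := leP y pi; first by apply: mono => //; apply/andP; split; lra.
have -> : cos y = cos (2 * pi - y).
  by rewrite -[LHS]cosN -[LHS](cos_period _ 1); congr cos; lra.
by apply: mono; try (apply/andP; split); lra.
Qed.

Lemma sum_cyclic (f : nat -> R) N : f N = f 0%N -> \sum_(k < N) f k.+1 = \sum_(k < N) f k.
Proof.
move=> fN; have := @telescope_sumr R 0 N f (leq0n N).
rewrite fN subrr big_mkord sumrB => /eqP; rewrite subr_eq0 => /eqP; exact.
Qed.

(** With [z = a + i b], the form is the sum of [|z (k+1) - exp (i be) z k|^2] minus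
    [|1 - exp (i be)|^2 |z k|^2]. Hence the Fourier mode [j] enters with the factor
    [2 cos be - 2 cos (j om - be)], which is nonnegative for [j = 0] and [j >= 2]. The mode [j = 1],
    where it is negative as soon as [r > pi], is excluded by the two hypotheses at [om]. *)
Lemma closed_polygon_area_bound a b N r (be := r / N%:R) (om := 2 * pi / N%:R) :
  (1 < N)%N -> 0 <= r <= 2 * pi -> a N = a 0%N -> b N = b 0%N ->
  dftU a b N om = 0 -> dftV a b N om = 0 ->
  0 <= cos be * \sum_(k < N) ((a k.+1 - a k) ^+ 2 + (b k.+1 - b k) ^+ 2)
       - 2 * sin be * \sum_(k < N) (a k * b k.+1 - b k * a k.+1).
Proof.
move=> N1 /andP[r0 r2] aN bN U0 V0.
have Np : 0 < N%:R :> R by rewrite ltr0n (leq_ltn_trans _ N1).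
have N2 : 2 <= N%:R :> R by rewrite ler_nat.
have p0 := pi_gt0 R.
have be0 : 0 <= be by rewrite divr_ge0 // ltW.
have bepi : be <= pi by rewrite ler_pdivrMr //; nra.
(* Real and imaginary part of [z (k+1) - exp (i be) z k]. *)
pose sa k := a k.+1 - (cos be * a k - sin be * b k).
pose sb k := b k.+1 - (sin be * a k + cos be * b k).
have cs := cos2Dsin2 be.
have cyc (f : R -> R -> R) : \sum_(k < N) f (a k.+1) (b k.+1) = \sum_(k < N) f (a k) (b k).
  by apply: (@sum_cyclic (fun k => f (a k) (b k)) N); rewrite aN bN.
set Z := \sum_(k < N) (a k ^+ 2 + b k ^+ 2).
have Z1 : \sum_(k < N) (a k.+1 ^+ 2 + b k.+1 ^+ 2) = Z by exact: (cyc (fun x y => x ^+ 2 + y ^+ 2)).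
have -> : cos be * \sum_(k < N) ((a k.+1 - a k) ^+ 2 + (b k.+1 - b k) ^+ 2)
       - 2 * sin be * \sum_(k < N) (a k * b k.+1 - b k * a k.+1) =
   \sum_(k < N) (sa k ^+ 2 + sb k ^+ 2) - (2 - 2 * cos be) * Z.
  (* Half of [Z] is shifted by one vertex, so that both sides agree term by term. *)
  have -> : (2 - 2 * cos be) * Z = (1 - cos be) * Z + (1 - cos be) * \sum_(k < N) (a k.+1 ^+ 2 + b k.+1 ^+ 2).
    by rewrite Z1; ring.
  rewrite /Z !mulr_sumr -big_split -!sumrB /=; apply: eq_bigr => k _.
  rewrite /sa /sb; have sb2 : sin be ^+ 2 = 1 - cos be ^+ 2 by lra.
  by ring: sb2.
(* A cyclic shift multiplies the mode [j] by [exp (i j om)], so passing to [sa + i sb] multiplies it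
   by [exp (i j om) - exp (i be)]. *)
have UV j : dftU sa sb N (j%:R * om) ^+ 2 + dftV sa sb N (j%:R * om) ^+ 2 =
   (2 - 2 * cos (j%:R * om - be)) * (dftU a b N (j%:R * om) ^+ 2 + dftV a b N (j%:R * om) ^+ 2).
  set x := j%:R * om; set U := dftU a b N x; set V := dftV a b N x.
  have perN : (cos (N%:R * x) = 1) * (sin (N%:R * x) = 0).
    have -> : N%:R * x = 0 + j%:R * (2 * pi) by rewrite /x /om; field; rewrite gt_eqF.
    by rewrite cos_period sin_period cos0 sin0.
  have UN : \sum_(k < N) (a k.+1 * cos (k.+1%:R * x) + b k.+1 * sin (k.+1%:R * x)) = U.
    apply: (@sum_cyclic (fun k => a k * cos (k%:R * x) + b k * sin (k%:R * x)) N).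
    by rewrite perN.1 perN.2 mul0r cos0 sin0 aN bN.
  have VN : \sum_(k < N) (b k.+1 * cos (k.+1%:R * x) - a k.+1 * sin (k.+1%:R * x)) = V.
    apply: (@sum_cyclic (fun k => b k * cos (k%:R * x) - a k * sin (k%:R * x)) N).
    by rewrite perN.1 perN.2 mul0r cos0 sin0 aN bN.
  have trig k : (cos (k.+1%:R * x) = cos (k%:R * x) * cos x - sin (k%:R * x) * sin x) *
                (sin (k.+1%:R * x) = sin (k%:R * x) * cos x + cos (k%:R * x) * sin x).
    by rewrite -natr1 mulrDl mul1r cosD sinD.
  have csx := cos2Dsin2 x.
  have E1 : dftU sa sb N x = (cos x - cos be) * U - (sin x - sin be) * V.
    have -> : (cos x - cos be) * U - (sin x - sin be) * V = cos x * U - sin x * V - (cos be * U - sin be * V) by ring.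
    rewrite -{1}UN -{1}VN /dftU /U /V /dftU /dftV !mulr_sumr -!sumrB; apply: eq_bigr => k _ /=.
    rewrite (trig k).1 (trig k).2 /sa /sb.
    set ck := cos (k%:R * x); set sk := sin (k%:R * x).
    have s2 : sin x ^+ 2 = 1 - cos x ^+ 2 by lra.
    by ring: s2.
  have E2 : dftV sa sb N x = (sin x - sin be) * U + (cos x - cos be) * V.
    have -> : (sin x - sin be) * U + (cos x - cos be) * V = sin x * U + cos x * V - (sin be * U + cos be * V) by ring.
    rewrite -{1}UN -{1}VN /dftV /U /V /dftU /dftV !mulr_sumr -!big_split -!sumrB; apply: eq_bigr => k _ /=.
    rewrite (trig k).1 (trig k).2 /sa /sb.
    set ck := cos (k%:R * x); set sk := sin (k%:R * x).
    have s2 : sin x ^+ 2 = 1 - cos x ^+ 2 by lra.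
    by ring: s2.
  rewrite E1 E2 cosB.
  have s2 : sin x ^+ 2 = 1 - cos x ^+ 2 by lra.
  have sb2 : sin be ^+ 2 = 1 - cos be ^+ 2 by lra.
  by ring: s2 sb2.
have ps := parseval sa sb N; have pz := parseval a b N.
rewrite -(pmulr_rge0 _ Np) mulrBr -ps mulrCA -pz mulr_sumr -sumrB; apply: sumr_ge0 => j _.
rewrite -/om UV -mulrBl.
have [j1|j1] := eqVneq (j : nat) 1%N; first by rewrite j1 mul1r U0 V0 expr0n addr0 mulr0.
apply: mulr_ge0; last by rewrite addr_ge0 ?sqr_ge0.
suff : cos (j%:R * om - be) <= cos be by lra.
case: (posnP j) => [->|jp]; first by rewrite mul0r add0r cosN.
have j2 : 2 <= j%:R :> R by rewrite ler_nat; case: (nat_of_ord j) jp j1 => [|[|]].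
have jN : j%:R + 1 <= N%:R :> R by rewrite natr1 ler_nat.
have eN : N%:R * be = r by rewrite /be; field; rewrite gt_eqF.
have eom : N%:R * om = 2 * pi by rewrite /om; field; rewrite gt_eqF.
(* This is [r <= 2 pi]. It places [j om - be], for [2 <= j < N], on the arc from [be] to
   [2 pi - be]. *)
have omb : be <= om by rewrite ler_pM2r ?invr_gt0.
have om0 : 0 <= om by lra.
apply: cos_le_cos_arc; apply/andP; split => //; nra.
Qed.

End ClosedPolygon.

(** * Planar polygons with fixed endpoints *)

Section PlanarPolygon.
Context {R : realType}.
Implicit Types (a b p q : nat -> R) (r t x : R).

(** [helixRe + i helixIm] runs through the vertices of a circular arc from [0] to [1], the
    projection of the helix along its axis: [(exp (i y) - exp (- i r)) / (exp (i r) - exp (- i r))]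
    with [y = 2 k r / N - r]. *)
Definition helixRe r N k : R := (sin (k%:R * (2 * (r / N%:R)) - r) + sin r) / (2 * sin r).
Definition helixIm r N k : R := (cos r - cos (k%:R * (2 * (r / N%:R)) - r)) / (2 * sin r).

(** The circle has centre [(1 + i cot r) / 2]. Each chord is orthogonal to the segment from the
    centre to its midpoint, and half the chord is [tan be] times that segment. This is the
    Euler-Lagrange equation of the form, integrated once. *)
Lemma helix_step r N k (be := r / N%:R) : sin r != 0 ->
  (cos be * (helixRe r N k.+1 - helixRe r N k) =
     - sin be * (helixIm r N k + helixIm r N k.+1 - cos r / sin r)) *
  (cos be * (helixIm r N k.+1 - helixIm r N k) =
     sin be * (helixRe r N k + helixRe r N k.+1 - 1)).
Proof.
move=> s0; rewrite /helixRe /helixIm -/be.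
set y := k%:R * (2 * be) - r + be.
have -> : k.+1%:R * (2 * be) - r = y + be by rewrite /y -natr1; ring.
have -> : k%:R * (2 * be) - r = y - be by rewrite /y; ring.
clearbody y; rewrite !(sinD, cosD) ?(sinN, cosN); split; field; exact: s0.
Qed.

(** The constant term has no component at [om], and the circular term is a geometric sum of ratio
    [exp (2 i ga)]. The value [- (1 + i cot ga) / 2] blows up as [r] tends to [pi], which is what
    drives the choice of the axis. *)
Lemma helix_mode r N (om := 2 * pi / N%:R) (ga := (r - pi) / N%:R) :
  (1 < N)%N -> sin r != 0 -> sin ga != 0 ->
  (dftU (helixRe r N) (helixIm r N) N om = - 2^-1) *
  (dftV (helixRe r N) (helixIm r N) N om = - (2^-1 * (cos ga / sin ga))).
Proof.
move=> N1 s0 g0.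
have Np : N%:R != 0 :> R by rewrite pnatr_eq0 -lt0n (leq_ltn_trans _ N1).
have [|sc ss] := @root_sums_vanish R N 1; first by rewrite N1.
have {}sc : \sum_(j < N) cos (j%:R * om) = 0 by rewrite -{}[RHS]sc; under [RHS]eq_bigr do rewrite mul1r.
have {}ss : \sum_(j < N) sin (j%:R * om) = 0 by rewrite -{}[RHS]ss; under [RHS]eq_bigr do rewrite mul1r.
have [gc gs] := sum_cos_sin_arith (2 * ga) N.
have e1 : 2 * ga / 2 = ga by field.
have e2 : N%:R * (2 * ga) - ga = (2 * r - ga) - 1%:R * (2 * pi) by rewrite /ga; field.
have sB y : sin (y - 1%:R * (2 * pi)) = sin y by rewrite -[LHS](sin_period _ 1) subrK.
have cB y : cos (y - 1%:R * (2 * pi)) = cos y by rewrite -[LHS](cos_period _ 1) subrK.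
move: gc gs; rewrite e1 e2 sB cB => gc gs.
set Sc := \sum_(j < N) cos (j%:R * (2 * ga)) in gc.
set Ss := \sum_(j < N) sin (j%:R * (2 * ga)) in gs.
have dU : 2 * sin r * dftU (helixRe r N) (helixIm r N) N om =
   cos r * Ss - sin r * Sc + sin r * (\sum_(j < N) cos (j%:R * om)) + cos r * \sum_(j < N) sin (j%:R * om).
  rewrite /dftU /Ss /Sc !mulr_sumr -!sumrB -!big_split /=; apply: eq_bigr => k _.
  have e : k%:R * (2 * ga) = k%:R * (2 * (r / N%:R)) - k%:R * om by rewrite /ga /om; field.
  by rewrite e /helixRe /helixIm !sinB !cosB; field.
have dV : 2 * sin r * dftV (helixRe r N) (helixIm r N) N om =
   - (cos r * Sc + sin r * Ss) + cos r * (\sum_(j < N) cos (j%:R * om)) - sin r * \sum_(j < N) sin (j%:R * om).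
  rewrite /dftV /Ss /Sc !mulr_sumr -!big_split -sumrN -!big_split -sumrB /=; apply: eq_bigr => k _.
  have e : k%:R * (2 * ga) = k%:R * (2 * (r / N%:R)) - k%:R * om by rewrite /ga /om; field.
  by rewrite e /helixRe /helixIm !sinB !cosB; field.
have two : 2 != 0 :> R by rewrite pnatr_eq0.
have csr := cos2Dsin2 r; have csg := cos2Dsin2 ga.
have eS : 2 * sin ga * Sc = sin (r + r - ga) + sin ga by rewrite gc; congr (sin _ + _); ring.
have eT : 2 * sin ga * Ss = cos ga - cos (r + r - ga) by rewrite gs; congr (_ - cos _); ring.
have cr2 : cos r ^+ 2 = 1 - sin r ^+ 2 by lra.
move: eS eT; rewrite sinB cosB sinD cosD => eS eT.
move: dU dV; rewrite sc ss !mulr0 !addr0 => dU dV.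
have k1 : sin ga * (cos r * Ss - sin r * Sc) = - (sin r * sin ga).
  have : 2 * (sin ga * (cos r * Ss - sin r * Sc)) = cos r * (2 * sin ga * Ss) - sin r * (2 * sin ga * Sc) by ring.
  by rewrite eS eT => h; apply: (mulfI two); rewrite h; ring: cr2.
have k2 : sin ga * (cos r * Sc + sin r * Ss) = sin r * cos ga.
  have : 2 * (sin ga * (cos r * Sc + sin r * Ss)) = cos r * (2 * sin ga * Sc) + sin r * (2 * sin ga * Ss) by ring.
  by rewrite eS eT => h; apply: (mulfI two); rewrite h; ring: cr2.
have s20 : 2 * sin r * sin ga != 0 by rewrite !mulf_neq0.
split; apply: (mulfI s20).
  by rewrite [LHS](_ : _ = sin ga * (2 * sin r * dftU (helixRe r N) (helixIm r N) N om)); [rewrite dU k1; field | ring].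
rewrite [LHS](_ : _ = sin ga * (2 * sin r * dftV (helixRe r N) (helixIm r N) N om)); last by ring.
by rewrite dV subr0 mulrN k2; field.
Qed.

(* The helix p + i q is critical for the quadratic form on polygons with fixed endpoints, so
   the form splits over the helix and the closed difference; the cross term telescopes. *)
Lemma planar_polygon_bound a b X Y N r (be := r / N%:R) (om := 2 * pi / N%:R)
    (ka := 2^-1 * (cos ((r - pi) / N%:R) / sin ((r - pi) / N%:R))) :
  (1 < N)%N -> 0 <= r <= 2 * pi -> sin r != 0 -> sin ((r - pi) / N%:R) != 0 ->
  a 0%N = 0 -> b 0%N = 0 -> a N = X -> b N = Y ->
  dftU a b N om = - (2^-1 * X) + ka * Y ->
  dftV a b N om = - (2^-1 * Y) - ka * X ->
  (X ^+ 2 + Y ^+ 2) * (sin be * (cos r / sin r)) <=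
  cos be * \sum_(k < N) ((a k.+1 - a k) ^+ 2 + (b k.+1 - b k) ^+ 2)
       - 2 * sin be * \sum_(k < N) (a k * b k.+1 - b k * a k.+1).
Proof.
move=> N1 r02 s0 g0 a0 b0 aN bN U1 V1.
have Np : N%:R != 0 :> R by rewrite pnatr_eq0 -lt0n (leq_ltn_trans _ N1).
pose c := helixRe r N; pose d := helixIm r N.
(* The unit arc multiplied by [X + i Y], so that it has the endpoints of the polygon. *)
pose p k := X * c k - Y * d k; pose q k := X * d k + Y * c k.
have c0 : c 0%N = 0 by rewrite /c /helixRe mul0r sub0r sinN addNr mul0r.
have d0 : d 0%N = 0 by rewrite /d /helixIm mul0r sub0r cosN subrr mul0r.
have eN : N%:R * (2 * (r / N%:R)) - r = r by field.
have cN : c N = 1 by rewrite /c /helixRe eN; field.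
have dN : d N = 0 by rewrite /d /helixIm eN subrr mul0r.
have p0 : p 0%N = 0 by rewrite /p c0 d0; ring.
have q0 : q 0%N = 0 by rewrite /q c0 d0; ring.
have pN : p N = X by rewrite /p cN dN; ring.
have qN : q N = Y by rewrite /q cN dN; ring.
(* [a1 + i a2] is twice the centre of the arc [p + i q]. *)
pose a1 := X - Y * (cos r / sin r); pose a2 := Y + X * (cos r / sin r).
have stp k : cos be * (p k.+1 - p k) = - sin be * (q k + q k.+1 - a2).
  rewrite (_ : cos be * _ = X * (cos be * (c k.+1 - c k)) - Y * (cos be * (d k.+1 - d k))); last by rewrite /p; ring.
  by rewrite /c /d (helix_step N k s0).1 (helix_step N k s0).2 -/c -/d -/be /q /a2; ring.
have stq k : cos be * (q k.+1 - q k) = sin be * (p k + p k.+1 - a1).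
  rewrite (_ : cos be * _ = X * (cos be * (d k.+1 - d k)) + Y * (cos be * (c k.+1 - c k))); last by rewrite /q; ring.
  by rewrite /c /d (helix_step N k s0).1 (helix_step N k s0).2 -/c -/d -/be /p /a1; ring.
pose da k := a k - p k; pose db k := b k - q k.
have [mU mV] := helix_mode N1 s0 g0.
have Up : dftU p q N om = - (2^-1 * X) + ka * Y.
  have -> : dftU p q N om = X * dftU c d N om - Y * dftV c d N om.
    by rewrite /dftU /dftV !mulr_sumr -sumrB; apply: eq_bigr => k _; rewrite /p /q; ring.
  by rewrite mU mV /ka; ring.
have Vp : dftV p q N om = - (2^-1 * Y) - ka * X.
  have -> : dftV p q N om = X * dftV c d N om + Y * dftU c d N om.
    by rewrite /dftU /dftV !mulr_sumr -big_split; apply: eq_bigr => k _; rewrite /p /q /=; ring.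
  by rewrite mU mV /ka; ring.
have U0 : dftU da db N om = 0.
  have -> : dftU da db N om = dftU a b N om - dftU p q N om.
    by rewrite /dftU -sumrB; apply: eq_bigr => k _; rewrite /da /db; ring.
  by rewrite U1 Up subrr.
have V0 : dftV da db N om = 0.
  have -> : dftV da db N om = dftV a b N om - dftV p q N om.
    by rewrite /dftV -sumrB; apply: eq_bigr => k _; rewrite /da /db; ring.
  by rewrite V1 Vp subrr.
have daN : da N = da 0%N by rewrite /da aN pN a0 p0 !subrr.
have dbN : db N = db 0%N by rewrite /db bN qN b0 q0 !subrr.
have Q0 := closed_polygon_area_bound N1 r02 daN dbN U0 V0.
rewrite -subr_ge0; apply: le_trans Q0 _; rewrite le_eqVlt; apply/orP; left; apply/eqP.
(* The increments of [G] are the density of the form on the arc plus the cross term with [da], [db].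
   Since [da] and [db] vanish at both ends, only [sin be * (a2 * X - a1 * Y)] survives. *)
pose G k := sin be * (a2 * p k - a1 * q k) +
   2 * sin be * (- (q k - a2) * da k + (p k - a1) * db k).
have -> : (X ^+ 2 + Y ^+ 2) * (sin be * (cos r / sin r)) = \sum_(k < N) (G k.+1 - G k).
  rewrite -(big_mkord xpredT (fun k => G k.+1 - G k)) telescope_sumr // /G daN dbN /da /db a0 b0 p0 q0 pN qN /a1 /a2; ring.
rewrite -/be !mulr_sumr -!sumrB; apply: eq_bigr => k _.
have ea j : a j = p j + da j by rewrite /da; ring.
have eb j : b j = q j + db j by rewrite /db; ring.
rewrite !ea !eb /G; move: (stp k) (stq k).
set pk := p k; set pk' := p k.+1; set qk := q k; set qk' := q k.+1.
set u := da k; set u' := da k.+1; set v := db k; set v' := db k.+1 => h1 h2.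
(* The identity holds modulo the two equations of [helix_step], whose residuals are [e1] and
   [e2]. *)
pose e1 : R := cos be * (pk' - pk) + sin be * (qk + qk' - a2).
pose e2 : R := cos be * (qk' - qk) - sin be * (pk + pk' - a1).
have e10 : e1 = 0 by rewrite /e1 h1; ring.
have e20 : e2 = 0 by rewrite /e2 h2; ring.
apply/eqP; rewrite -subr_eq0; apply/eqP.
rewrite [LHS](_ : _ = - (e1 * (pk' - pk + 2 * (u' - u)) + e2 * (qk' - qk + 2 * (v' - v)))); last by rewrite /e1 /e2; ring.
by rewrite e10 e20; ring.
Qed.

End PlanarPolygon.

(** * Polygons in space and a given axis *)

Section SpatialPolygon.
Context {R : realType}.
Implicit Types (r : R).

Lemma unit_orthogonal (n1 n2 n3 : R) :
  exists f1 f2 f3 : R, f1 ^+ 2 + f2 ^+ 2 + f3 ^+ 2 = 1 /\ f1 * n1 + f2 * n2 + f3 * n3 = 0.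
Proof.
have [e|e] := eqVneq (n2 ^+ 2 + n3 ^+ 2) 0.
  move: e => /eqP; rewrite paddr_eq0 ?sqr_ge0// !sqrf_eq0 => /andP[/eqP -> /eqP ->].
  by exists 0, 1, 0; split; ring.
set w := n2 ^+ 2 + n3 ^+ 2 in e *.
have w0 : 0 < w by rewrite lt_neqAle eq_sym e addr_ge0 ?sqr_ge0.
have sw : Num.sqrt w ^+ 2 = w by rewrite sqr_sqrtr ?ltW.
have s0 : Num.sqrt w != 0 by rewrite gt_eqF ?sqrtr_gt0.
exists 0, (n3 / Num.sqrt w), (- n2 / Num.sqrt w); split; last by field.
by rewrite expr0n add0r !expr_div_n sw sqrrN addrC -mulrDl divff.
Qed.

(** Cauchy-Schwarz, in the form that the increments have nonnegative variance. *)
Lemma sum_increments_sqr (f : nat -> R) N : f 0%N = 0 -> (0 < N)%N ->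
  f N ^+ 2 / N%:R <= \sum_(k < N) (f k.+1 - f k) ^+ 2.
Proof.
move=> f0 N0; have Np : 0 < N%:R :> R by rewrite ltr0n.
set c := f N / N%:R.
have : 0 <= \sum_(k < N) (f k.+1 - f k - c) ^+ 2 by apply: sumr_ge0 => k _; exact: sqr_ge0.
have -> : \sum_(k < N) (f k.+1 - f k - c) ^+ 2 =
    \sum_(k < N) (f k.+1 - f k) ^+ 2 - 2 * c * \sum_(k < N) (f k.+1 - f k) + \sum_(k < N) c ^+ 2.
  by rewrite mulr_sumr -sumrB -big_split /=; apply: eq_bigr => k _; ring.
rewrite sumr_const card_ord -(big_mkord xpredT (fun k => f k.+1 - f k)) telescope_sumr // f0 subr0.
rewrite -mulr_natl => h.
have -> : f N ^+ 2 / N%:R = 2 * c * f N - N%:R * c ^+ 2 by rewrite /c; field; rewrite gt_eqF.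
lra.
Qed.

Section Bound.
Variables (P1 P2 P3 : nat -> R) (N : nat) (r : R).
Let om : R := 2 * pi / N%:R.
Let be : R := r / N%:R.
Let C1 := \sum_(k < N) P1 k * cos (k%:R * om) + 2^-1.
Let C2 := \sum_(k < N) P2 k * cos (k%:R * om).
Let C3 := \sum_(k < N) P3 k * cos (k%:R * om).
Let S1 := \sum_(k < N) P1 k * sin (k%:R * om).
Let S2 := \sum_(k < N) P2 k * sin (k%:R * om).
Let S3 := \sum_(k < N) P3 k * sin (k%:R * om).
Let ka := 2^-1 * (cos ((r - pi) / N%:R) / sin ((r - pi) / N%:R)).

(** The three equations for [n] say that [(ka, 0, 0) - S] is [lam n] plus the cross product of [C]
    and [n]. Projected to the plane orthogonal to [n], they state that polygon and helix have the
    same Fourier coefficient at [om]; [lam] takes up the component along [n]. So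
    [planar_polygon_bound] applies across the axis, and Cauchy-Schwarz along it. *)
Lemma spatial_polygon_bound n1 n2 n3 lam :
  (1 < N)%N -> 0 <= r <= 2 * pi -> 0 <= cos be -> sin r != 0 -> sin ((r - pi) / N%:R) != 0 ->
  P1 0%N = 0 -> P2 0%N = 0 -> P3 0%N = 0 -> P1 N = 1 -> P2 N = 0 -> P3 N = 0 ->
  n1 ^+ 2 + n2 ^+ 2 + n3 ^+ 2 = 1 ->
  ka - S1 = lam * n1 + (C2 * n3 - C3 * n2) ->
  - S2 = lam * n2 + (C3 * n1 - C1 * n3) ->
  - S3 = lam * n3 + (C1 * n2 - C2 * n1) ->
  cos be * (n1 ^+ 2 / N%:R) + (1 - n1 ^+ 2) * (sin be * (cos r / sin r)) <=
  cos be * \sum_(k < N) ((P1 k.+1 - P1 k) ^+ 2 + (P2 k.+1 - P2 k) ^+ 2 + (P3 k.+1 - P3 k) ^+ 2) +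
  2 * sin be * \sum_(k < N) (n1 * (P2 k * P3 k.+1 - P3 k * P2 k.+1) +
    n2 * (P3 k * P1 k.+1 - P1 k * P3 k.+1) + n3 * (P1 k * P2 k.+1 - P2 k * P1 k.+1)).
Proof.
move=> N1 r02 cb s0 g0 P10 P20 P30 P1N P2N P3N nn e1 e2 e3.
have [f1 [f2 [f3 [ff fn]]]] := unit_orthogonal n1 n2 n3.
(* [g] is the cross product of [f] and [n], so the plane of [f], [g] is negatively oriented about
   [n]; hence the minus sign in front of the planar area below. *)
pose g1 := f2 * n3 - f3 * n2; pose g2 := f3 * n1 - f1 * n3; pose g3 := f1 * n2 - f2 * n1.
pose a k := P1 k * f1 + P2 k * f2 + P3 k * f3.
pose b k := P1 k * g1 + P2 k * g2 + P3 k * g3.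
pose h k := P1 k * n1 + P2 k * n2 + P3 k * n3.
have nn0 : n1 ^+ 2 + n2 ^+ 2 + n3 ^+ 2 - 1 = 0 by rewrite nn subrr.
have ff0 : f1 ^+ 2 + f2 ^+ 2 + f3 ^+ 2 - 1 = 0 by rewrite ff subrr.
have eU : dftU a b N om = - (2^-1 * f1) + ka * g1.
  have -> : dftU a b N om = (C1 - 2^-1) * f1 + C2 * f2 + C3 * f3 + S1 * g1 + S2 * g2 + S3 * g3.
    rewrite /dftU /C1 addrK /C2 /C3 /S1 /S2 /S3 !mulr_suml -!big_split /=.
    by apply: eq_bigr => k _; rewrite /a /b; ring.
  have -> : S1 = ka - (lam * n1 + (C2 * n3 - C3 * n2)) by rewrite -e1; ring.
  have -> : S2 = - (lam * n2 + (C3 * n1 - C1 * n3)) by rewrite -e2; ring.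
  have -> : S3 = - (lam * n3 + (C1 * n2 - C2 * n1)) by rewrite -e3; ring.
  (* Here and below, multiples of the orthonormality relations are added so that the identity
     becomes polynomial. *)
  rewrite [LHS](_ : _ = - (2^-1 * f1) + ka * g1
     - (C1 * f1 + C2 * f2 + C3 * f3) * (n1 ^+ 2 + n2 ^+ 2 + n3 ^+ 2 - 1)
     + (C1 * n1 + C2 * n2 + C3 * n3) * (f1 * n1 + f2 * n2 + f3 * n3)); last first.
    by rewrite /g1 /g2 /g3; ring.
  by rewrite nn0 fn; ring.
have eV : dftV a b N om = - (2^-1 * g1) - ka * f1.
  have -> : dftV a b N om = (C1 - 2^-1) * g1 + C2 * g2 + C3 * g3 - S1 * f1 - S2 * f2 - S3 * f3.
    rewrite /dftV /C1 addrK /C2 /C3 /S1 /S2 /S3 !mulr_suml -!big_split -!sumrB /=.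
    by apply: eq_bigr => k _; rewrite /a /b; ring.
  have -> : S1 = ka - (lam * n1 + (C2 * n3 - C3 * n2)) by rewrite -e1; ring.
  have -> : S2 = - (lam * n2 + (C3 * n1 - C1 * n3)) by rewrite -e2; ring.
  have -> : S3 = - (lam * n3 + (C1 * n2 - C2 * n1)) by rewrite -e3; ring.
  rewrite [LHS](_ : _ = - (2^-1 * g1) - ka * f1 + lam * (f1 * n1 + f2 * n2 + f3 * n3)); last first.
    by rewrite /g1 /g2 /g3; ring.
  by rewrite fn; ring.
have a0 : a 0%N = 0 by rewrite /a P10 P20 P30; ring.
have b0 : b 0%N = 0 by rewrite /b P10 P20 P30; ring.
have h0 : h 0%N = 0 by rewrite /h P10 P20 P30; ring.
have aN : a N = f1 by rewrite /a P1N P2N P3N; ring.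
have bN : b N = g1 by rewrite /b P1N P2N P3N; ring.
have hN : h N = n1 by rewrite /h P1N P2N P3N; ring.
have pl := planar_polygon_bound N1 r02 s0 g0 a0 b0 aN bN eU eV.
have sq := sum_increments_sqr h0 (ltnW N1).
(* [n1], [f1], [g1] are the coordinates of the unit vector [e1] in the orthonormal frame. *)
have fg : f1 ^+ 2 + g1 ^+ 2 = 1 - n1 ^+ 2.
  rewrite [LHS](_ : _ = 1 - n1 ^+ 2 + (1 - n1 ^+ 2) * (f1 ^+ 2 + f2 ^+ 2 + f3 ^+ 2 - 1) +
    (f2 ^+ 2 + f3 ^+ 2) * (n1 ^+ 2 + n2 ^+ 2 + n3 ^+ 2 - 1)
    - (f1 * n1 + f2 * n2 + f3 * n3) * (- f1 * n1 + f2 * n2 + f3 * n3)); last by rewrite /g1; ring.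
  by rewrite nn0 ff0 fn; ring.
have split3 (x y z : R) : x ^+ 2 + y ^+ 2 + z ^+ 2 =
    (x * n1 + y * n2 + z * n3) ^+ 2 + ((x * f1 + y * f2 + z * f3) ^+ 2 + (x * g1 + y * g2 + z * g3) ^+ 2).
  rewrite [RHS](_ : _ = x ^+ 2 + y ^+ 2 + z ^+ 2
     + (x ^+ 2 + y ^+ 2 + z ^+ 2) * (f1 ^+ 2 + f2 ^+ 2 + f3 ^+ 2 - 1)
     + (x ^+ 2 + y ^+ 2 + z ^+ 2) * (f1 ^+ 2 + f2 ^+ 2 + f3 ^+ 2) * (n1 ^+ 2 + n2 ^+ 2 + n3 ^+ 2 - 1)
     - (x * n1 + y * n2 + z * n3) ^+ 2 * (f1 ^+ 2 + f2 ^+ 2 + f3 ^+ 2 - 1)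
     - (x * f1 + y * f2 + z * f3) ^+ 2 * (n1 ^+ 2 + n2 ^+ 2 + n3 ^+ 2 - 1)
     + (f1 * n1 + f2 * n2 + f3 * n3) * (2 * (x * n1 + y * n2 + z * n3) * (x * f1 + y * f2 + z * f3)
        - (x ^+ 2 + y ^+ 2 + z ^+ 2) * (f1 * n1 + f2 * n2 + f3 * n3))); last by rewrite /g1 /g2 /g3; ring.
  by rewrite nn0 ff0 fn; ring.
have -> : \sum_(k < N) ((P1 k.+1 - P1 k) ^+ 2 + (P2 k.+1 - P2 k) ^+ 2 + (P3 k.+1 - P3 k) ^+ 2) =
    \sum_(k < N) (h k.+1 - h k) ^+ 2 + \sum_(k < N) ((a k.+1 - a k) ^+ 2 + (b k.+1 - b k) ^+ 2).
  rewrite -big_split; apply: eq_bigr => k _ /=; rewrite split3 /h /a /b.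
  by congr (_ ^+ 2 + (_ ^+ 2 + _ ^+ 2)); ring.
have -> : \sum_(k < N) (n1 * (P2 k * P3 k.+1 - P3 k * P2 k.+1) +
    n2 * (P3 k * P1 k.+1 - P1 k * P3 k.+1) + n3 * (P1 k * P2 k.+1 - P2 k * P1 k.+1)) =
    - \sum_(k < N) (a k * b k.+1 - b k * a k.+1).
  rewrite -sumrN; apply: eq_bigr => k _.
  set c := n1 * _ + _ + _; rewrite [RHS](_ : _ = c * (1 + (f1 ^+ 2 + f2 ^+ 2 + f3 ^+ 2 - 1))
    - (f1 * n1 + f2 * n2 + f3 * n3) * (f1 * (P2 k * P3 k.+1 - P3 k * P2 k.+1) +
    f2 * (P3 k * P1 k.+1 - P1 k * P3 k.+1) + f3 * (P1 k * P2 k.+1 - P2 k * P1 k.+1))).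
    by rewrite ff0 fn; ring.
  by rewrite /c /a /b /g1 /g2 /g3; ring.
move: pl; rewrite fg -/be => pl.
have := ler_wpM2l cb sq; rewrite hN => {}sq.
rewrite mulrDr mulrN; lra.
Qed.

End Bound.
End SpatialPolygon.

(** * Choice of the axis *)

Section Directions.
Context {R : realType}.

Lemma unit_coords_le1 (n1 n2 n3 : R) : n1 ^+ 2 + n2 ^+ 2 + n3 ^+ 2 = 1 ->
  [/\ `|n1| <= 1, `|n2| <= 1 & `|n3| <= 1].
Proof.
have h (x : R) : x ^+ 2 <= 1 -> `|x| <= 1.
  by move=> ?; rewrite -(ler_pXn2r (_ : (0 < 2)%N)) ?nnegrE // real_normK ?num_real // expr1n.
have [[? ?] ?] := (sqr_ge0 n1, sqr_ge0 n2, sqr_ge0 n3).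
by move=> nn; split; apply: h; lra.
Qed.

(** The linear map [n -> lam n + s x n], with the cross product by [s], is inverted explicitly:
    [n = (lam b + nu s - s x b) / den]. Here [nu] stands for [(b, s) / lam]; as a separate unknown
    it also covers [lam = 0]. The hypotheses say that [(lam + i nu)^2] is the bilinear square of
    [b + i s], and together they make [n] a unit vector. *)
Lemma rotation_resolvent (b1 b2 b3 s1 s2 s3 lam nu : R) (den := lam ^+ 2 + (s1 ^+ 2 + s2 ^+ 2 + s3 ^+ 2)) :
  lam * nu = b1 * s1 + b2 * s2 + b3 * s3 ->
  lam ^+ 2 - nu ^+ 2 = (b1 ^+ 2 + b2 ^+ 2 + b3 ^+ 2) - (s1 ^+ 2 + s2 ^+ 2 + s3 ^+ 2) ->
  den != 0 ->
  exists n1 n2 n3, [/\ n1 ^+ 2 + n2 ^+ 2 + n3 ^+ 2 = 1,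
    b1 = lam * n1 + (s2 * n3 - s3 * n2), b2 = lam * n2 + (s3 * n1 - s1 * n3),
    b3 = lam * n3 + (s1 * n2 - s2 * n1) &
    den * n1 = lam * b1 + nu * s1 - (s2 * b3 - s3 * b2)].
Proof.
move=> h1 h2 d0.
pose w1 := lam * b1 + nu * s1 - (s2 * b3 - s3 * b2).
pose w2 := lam * b2 + nu * s2 - (s3 * b1 - s1 * b3).
pose w3 := lam * b3 + nu * s3 - (s1 * b2 - s2 * b1).
have z1 : lam * nu - (b1 * s1 + b2 * s2 + b3 * s3) = 0 by rewrite h1 subrr.
have z2 : lam ^+ 2 - nu ^+ 2 - ((b1 ^+ 2 + b2 ^+ 2 + b3 ^+ 2) - (s1 ^+ 2 + s2 ^+ 2 + s3 ^+ 2)) = 0 by rewrite h2 subrr.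
have ww : w1 ^+ 2 + w2 ^+ 2 + w3 ^+ 2 = den ^+ 2.
  pose z := lam * nu - (b1 * s1 + b2 * s2 + b3 * s3).
  pose y := lam ^+ 2 - nu ^+ 2 - ((b1 ^+ 2 + b2 ^+ 2 + b3 ^+ 2) - (s1 ^+ 2 + s2 ^+ 2 + s3 ^+ 2)).
  rewrite [LHS](_ : _ = den ^+ 2 - y * den - z * (lam * nu) + z * (b1 * s1 + b2 * s2 + b3 * s3)); last first.
    by rewrite /w1 /w2 /w3 /den /y /z; ring.
  by rewrite /y /z z1 z2; ring.
have e1 : den * b1 = lam * w1 + (s2 * w3 - s3 * w2).
  rewrite [RHS](_ : _ = den * b1 + s1 * (lam * nu - (b1 * s1 + b2 * s2 + b3 * s3))); first by rewrite z1; ring.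
  by rewrite /w1 /w2 /w3 /den; ring.
have e2 : den * b2 = lam * w2 + (s3 * w1 - s1 * w3).
  rewrite [RHS](_ : _ = den * b2 + s2 * (lam * nu - (b1 * s1 + b2 * s2 + b3 * s3))); first by rewrite z1; ring.
  by rewrite /w1 /w2 /w3 /den; ring.
have e3 : den * b3 = lam * w3 + (s1 * w2 - s2 * w1).
  rewrite [RHS](_ : _ = den * b3 + s3 * (lam * nu - (b1 * s1 + b2 * s2 + b3 * s3))); first by rewrite z1; ring.
  by rewrite /w1 /w2 /w3 /den; ring.
exists (w1 / den), (w2 / den), (w3 / den); split.
- by rewrite !expr_div_n -!mulrDl ww divff // expf_neq0.
- by apply: (mulfI d0); rewrite e1; field.
- by apply: (mulfI d0); rewrite e2; field.
- by apply: (mulfI d0); rewrite e3; field.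
- by rewrite mulrC divfK.
Qed.

(* Both square roots [lam + i nu] of [|b|^2 - |s|^2 + 2 i (b, s)] give a unit solution [n].
   [Y] is [den ^+ 2 * (tau - n1) * (tau - n1')] for the two solutions, hence continuous
   although neither branch is. *)
Lemma direction_selection (k tau : R -> R) (a b c1 c2 c3 s1 s2 s3 : R)
  (K := `|c1| + `|c2| + `|c3| + `|s1| + `|s2| + `|s3|) :
  a <= b -> (forall x, a <= x <= b -> cont_at k x) ->
  (forall x, a <= x <= b -> cont_at tau x) ->
  (forall x, a <= x <= b -> 0 <= tau x <= 1) ->
  K * (1 + tau a) < k a * (1 - tau a) ->
  exists r n1 n2 n3 lam, [/\ a <= r <= b, n1 ^+ 2 + n2 ^+ 2 + n3 ^+ 2 = 1,
    [/\ k r + c1 = lam * n1 + (s2 * n3 - s3 * n2), c2 = lam * n2 + (s3 * n1 - s1 * n3) &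
     c3 = lam * n3 + (s1 * n2 - s2 * n1)] & n1 = tau r \/ (r = b /\ tau b <= n1)].
Proof.
move=> ab kc tauc tau01 ka.
pose b1 r := k r + c1.
pose bs r := b1 r * s1 + c2 * s2 + c3 * s3.
pose ss := s1 ^+ 2 + s2 ^+ 2 + s3 ^+ 2.
(* [re + 2 i bs] is the number whose square root is wanted and [w] is its modulus, so [La] and [M]
   are the squares of [lam] and [nu]. *)
pose re r := b1 r ^+ 2 + c2 ^+ 2 + c3 ^+ 2 - ss.
pose w r := Num.sqrt (re r ^+ 2 + 4 * bs r ^+ 2).
pose La r := (w r + re r) / 2.
pose M r := (w r - re r) / 2.
have w2 r : w r ^+ 2 = re r ^+ 2 + 4 * bs r ^+ 2.
  by rewrite sqr_sqrtr //; have [? ?] := (sqr_ge0 (re r), sqr_ge0 (bs r)); lra.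
have w0 r : 0 <= w r by exact: sqrtr_ge0.
have wre r : `|re r| <= w r.
  rewrite -(ler_pXn2r (_ : (0 < 2)%N)) ?nnegrE // w2 real_normK ?num_real //.
  by have := sqr_ge0 (bs r); lra.
have La0 r : 0 <= La r by have := wre r; rewrite ler_norml => /andP[h _]; rewrite /La; lra.
have M0 r : 0 <= M r by have := wre r; rewrite ler_norml => /andP[_ h]; rewrite /M; lra.
have LM r : La r * M r = bs r ^+ 2.
  have -> : La r * M r = (w r ^+ 2 - re r ^+ 2) / 4 by rewrite /La /M; field.
  by rewrite w2; field.
pose den r := La r + ss.
have ss0 : 0 <= ss by rewrite !addr_ge0 ?sqr_ge0.
pose lam r := Num.sqrt (La r).
pose nu r := if 0 <= bs r then Num.sqrt (M r) else - Num.sqrt (M r).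
have lam2 r : lam r ^+ 2 = La r by rewrite sqr_sqrtr.
have nu2 r : nu r ^+ 2 = M r by rewrite /nu; case: ifP => _; rewrite ?sqrrN sqr_sqrtr.
have ln r : lam r * nu r = bs r.
  have h : lam r * Num.sqrt (M r) = `|bs r| by rewrite -sqrtrM // LM sqrtr_sqr.
  rewrite /nu; case: ifP => b0; first by rewrite h ger0_norm.
  by rewrite mulrN h ltr0_norm ?opprK // ltNge b0.
have sol r e : (e = 1 \/ e = -1) -> den r != 0 -> exists n1 n2 n3, [/\ n1 ^+ 2 + n2 ^+ 2 + n3 ^+ 2 = 1,
    b1 r = e * lam r * n1 + (s2 * n3 - s3 * n2), c2 = e * lam r * n2 + (s3 * n1 - s1 * n3),
    c3 = e * lam r * n3 + (s1 * n2 - s2 * n1) &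
    den r * n1 = e * (lam r * b1 r + nu r * s1) - (s2 * c3 - s3 * c2)].
  move=> he d0; have e2 : e ^+ 2 = 1 by case: he => ->; rewrite ?sqrrN expr1n.
  have [||| n1 [n2 [n3 [h1 h2 h3 h4 h5]]]] := @rotation_resolvent (b1 r) c2 c3 s1 s2 s3 (e * lam r) (e * nu r).
  - by rewrite mulrACA -expr2 e2 mul1r ln.
  - by rewrite !exprMn e2 !mul1r lam2 nu2 -/ss -/(re r) /La /M; field.
  - by rewrite exprMn e2 mul1r lam2.
  exists n1, n2, n3; split => //; rewrite /den -lam2.
  by move: h5; rewrite exprMn e2 mul1r => ->; ring.
pose Y r := (den r * tau r + (s2 * c3 - s3 * c2)) ^+ 2 -
   (La r * b1 r ^+ 2 + M r * s1 ^+ 2 + 2 * bs r * (b1 r * s1)).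
have YE r : Y r = (den r * tau r + (s2 * c3 - s3 * c2)) ^+ 2 - (lam r * b1 r + nu r * s1) ^+ 2.
  by rewrite /Y -(ln r) -lam2 -nu2; ring.
have Yc x : a <= x <= b -> cont_at Y x.
  move=> xab; have ck := kc _ xab; have ct := tauc _ xab.
  by rewrite /Y /den /La /M /w /re /bs /b1; continuity.
have bd (x y : R) : `|y| <= 1 -> - `|x| <= x * y <= `|x|.
  move=> y1; rewrite -ler_norml normrM; have := normr_ge0 x; nra.
have aab : a <= a <= b by rewrite lexx.
have /andP[ta0 ta1] := tau01 _ aab.
have [[[[[k1 k2] k3] k4] k5] k6] := (normr_ge0 c1, normr_ge0 c2, normr_ge0 c3, normr_ge0 s1, normr_ge0 s2, normr_ge0 s3).
have K0 : 0 <= K by rewrite !addr_ge0.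
have kaK : K < k a by clear - K0 ka ta0 ta1; nra.
have c1n : - `|c1| <= c1 by rewrite lerNl -normrN ler_norm.
have dena : den a != 0 /\ 0 < lam a.
  have : 0 < La a.
    have : 0 < re a; last by move=> h; rewrite /La; have := w0 a; lra.
    have sK : ss <= (`|s1| + `|s2| + `|s3|) ^+ 2.
      rewrite /ss -(real_normK (num_real s1)) -(real_normK (num_real s2)) -(real_normK (num_real s3)); nra.
    have : `|s1| + `|s2| + `|s3| < b1 a by move: kaK; rewrite /b1 /K; clear - c1n k1 k2 k3 k4 k5 k6; lra.
    rewrite /re; have [? ?] := (sqr_ge0 c2, sqr_ge0 c3); nra.
  by move=> h; split; rewrite ?sqrtr_gt0 // gt_eqF // /den; lra.
case: dena => dena lama.
(* At [a] the term [k a] dominates: the solution for [lam] has first coordinate above [tau a], the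
   one for [- lam] has a negative first coordinate, and [tau a] lies between them. *)
have Ya : Y a < 0.
  have [||n1 [n2 [n3 [h1 h2 h3 h4 h5]]]] := sol a 1; [by left | by [] |].
  have [||m1 [m2 [m3 [g1 g2 g3 g4 g5]]]] := sol a (-1); [by right | by [] |].
  have [nn1 nn2 nn3] := unit_coords_le1 h1.
  have [mm1 mm2 mm3] := unit_coords_le1 g1.
  have lamK : lam a <= k a + K.
    (* Scalar product of the equation for [n] with [n] itself. *)
    have -> : lam a = b1 a * n1 + c2 * n2 + c3 * n3.
      rewrite h2 {1}h3 {1}h4.
      rewrite [RHS](_ : _ = lam a * (n1 ^+ 2 + n2 ^+ 2 + n3 ^+ 2)); first by rewrite h1 mulr1.
      by ring.
    have /andP[_ q1] := bd (b1 a) _ nn1; have /andP[_ q2] := bd c2 _ nn2; have /andP[_ q3] := bd c3 _ nn3.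
    have : `|b1 a| <= `|k a| + `|c1| by exact: ler_normD.
    rewrite (ger0_norm (le_trans K0 (ltW kaK))) => t.
    by rewrite /K; clear - q1 q2 q3 t k4 k5 k6; lra.
  have n1t : tau a < n1.
    rewrite -(ltr_pM2l lama).
    have -> : lam a * n1 = b1 a - (s2 * n3 - s3 * n2) by rewrite h2; ring.
    have /andP[_ q2] := bd s2 _ nn3; have /andP[q3 _] := bd s3 _ nn2.
    have : lam a * tau a <= (k a + K) * tau a by rewrite ler_wpM2r.
    by move=> t; move: ka t; rewrite /b1 /K; clear - c1n q2 q3 k1 k2 k3 k4 k5 k6; lra.
  have m1t : m1 < 0.
    rewrite -(pmulr_rlt0 _ lama).
    have -> : lam a * m1 = - (b1 a - (s2 * m3 - s3 * m2)) by rewrite g2; ring.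
    have /andP[_ q2] := bd s2 _ mm3; have /andP[q3 _] := bd s3 _ mm2.
    by move: kaK; rewrite /b1 /K; clear - c1n q2 q3 k1 k2 k3 k4 k5 k6; lra.
  have -> : Y a = den a ^+ 2 * ((tau a - n1) * (tau a - m1)).
    rewrite YE; have e1 : lam a * b1 a + nu a * s1 = den a * n1 + (s2 * c3 - s3 * c2) by rewrite h5; ring.
    have e2 : den a * m1 = - (den a * n1) - 2 * (s2 * c3 - s3 * c2) by rewrite g5 h5; ring.
    rewrite e1 [RHS](_ : _ = (den a * tau a - den a * n1) * (den a * tau a - den a * m1)); last by ring.
    by rewrite e2; ring.
  have d2 : 0 < den a ^+ 2 by rewrite exprn_even_gt0.
  by rewrite pmulr_rlt0 // nmulr_rlt0; clear - n1t m1t ta0; lra.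
have [Yb|Yb] := leP 0 (Y b).
  have [|r rab Yr] := @zero_between R Y a b ab Yc; first by rewrite (ltW Ya).
  have /andP[t0 t1] := tau01 _ rab.
  (* If [den r = 0], both vectors vanish, and any unit vector with first coordinate [tau r] is a
     solution with [lam = 0]. *)
  have [d0|d0] := eqVneq (den r) 0.
    have L0 : La r = 0 by move: d0 (La0 r); rewrite /den; lra.
    have S0 : ss = 0 by move: d0; rewrite /den; lra.
    have [s1z s2z s3z] : [/\ s1 = 0, s2 = 0 & s3 = 0].
      move: S0 => /eqP; rewrite /ss paddr_eq0 ?addr_ge0 ?sqr_ge0// paddr_eq0 ?sqr_ge0// !sqrf_eq0.
      by move=> /andP[/andP[/eqP -> /eqP ->] /eqP ->].
    have re0 : re r <= 0.
      by move: L0 (w0 r); rewrite /La; lra.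
    have [b1z c2z c3z] : [/\ b1 r = 0, c2 = 0 & c3 = 0].
      have /eqP : b1 r ^+ 2 + c2 ^+ 2 + c3 ^+ 2 = 0.
        by move: re0; rewrite /re S0; have [[? ?] ?] := (sqr_ge0 (b1 r), sqr_ge0 c2, sqr_ge0 c3); lra.
      rewrite paddr_eq0 ?addr_ge0 ?sqr_ge0// paddr_eq0 ?sqr_ge0// !sqrf_eq0.
      by move=> /andP[/andP[/eqP -> /eqP ->] /eqP ->].
    exists r, (tau r), (Num.sqrt (1 - tau r ^+ 2)), 0, 0; split=> //; last by left.
      by rewrite sqr_sqrtr ?expr0n ?addr0 ?subrKC //; nra.
    by rewrite -/(b1 r) b1z s1z s2z s3z c2z c3z; split; ring.
  have [e [he eE]] : exists e, (e = 1 \/ e = -1) /\ den r * tau r + (s2 * c3 - s3 * c2) = e * (lam r * b1 r + nu r * s1).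
    move: Yr => /eqP; rewrite YE subr_eq0 eqf_sqr => /orP[|] /eqP ->.
      by exists 1; split; [left | rewrite mul1r].
    by exists (-1); split; [right | rewrite mulN1r].
  have [n1 [n2 [n3 [h1 h2 h3 h4 h5]]]] := sol r e he d0.
  exists r, n1, n2, n3, (e * lam r); split => //; left.
  by apply: (mulfI d0); rewrite h5 -eE; ring.
have d0 : den b != 0.
  apply/eqP => d0; move: Yb; have L0 : La b = 0 by move: d0 (La0 b); rewrite /den; lra.
  have S0 : ss = 0 by move: d0; rewrite /den; lra.
  have s1z : s1 = 0.
    move: S0 => /eqP; rewrite /ss paddr_eq0 ?addr_ge0 ?sqr_ge0// paddr_eq0 ?sqr_ge0// !sqrf_eq0.
    by move=> /andP[/andP[/eqP -> _] _].
  by rewrite /Y L0 s1z expr0n /= !(mul0r, mulr0, addr0) subr0 ltNge sqr_ge0.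
have dp : 0 < den b by rewrite lt_neqAle eq_sym d0 addr_ge0.
pose g := s2 * c3 - s3 * c2; pose u := lam b * b1 b + nu b * s1.
have Yb' : (den b * tau b + g) ^+ 2 < u ^+ 2 by rewrite -subr_lt0 -YE.
(* The sign that yields the larger of the two first coordinates. *)
pose e : R := if 0 <= u then 1 else -1.
have eu : e * u = `|u|.
  by rewrite /e; case: ifP => h; [rewrite mul1r ger0_norm | rewrite mulN1r ltr0_norm // ltNge h].
have he : e = 1 \/ e = -1 by rewrite /e; case: ifP => _; [left | right].
have [n1 [n2 [n3 [h1 h2 h3 h4 h5]]]] := sol b e he d0.
exists b, n1, n2, n3, (e * lam b); split => //; first by rewrite lexx andbT.
right; split => //; rewrite -(ler_pM2l dp) h5 -/u -/g eu.
have : `|den b * tau b + g| <= `|u|.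
  by rewrite -(ler_pXn2r (_ : (0 < 2)%N)) ?nnegrE // !real_normK ?num_real // ltW.
have := ler_norm (den b * tau b + g); lra.
Qed.

End Directions.

(** * The function [psi] and the barrier *)

Section CotangentDefect.
Context {R : realType}.
Implicit Types (s t x e : R).

Lemma sin_le_id x : 0 <= x -> sin x <= x.
Proof.
move=> x0; have [->|xn0] := eqVneq x 0; first by rewrite sin0.
have xp : 0 < x by rewrite lt_neqAle eq_sym xn0.
have [||c] := @MVT R (fun y => sin y - y) (fun y => cos y * 1 - 1) 0 x xp.
- by move=> y _; apply: derD; [apply: der_sin; exact: der_id | apply: derN; exact: der_id].
- apply: continuous_subspaceT => y; change (cont_at (fun y => sin y - y) y); continuity.
rewrite in_itv /= => _; rewrite sin0 !subr0 mulr1 => E.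
have := cos_le1 c; nra.
Qed.

(** On [[0, 1]] the cosine is at least [cos 1] and [sin e <= e], so [d = cos 1 / (|A| + 1)]
    works. *)
Lemma cot_unbounded (A : R) : exists2 d, 0 < d <= 1 & forall e, 0 < e <= d -> A < cos e / sin e.
Proof.
have c1 := cos1_gt0 R; have cl := cos_le1 (1 : R).
have A0 := normr_ge0 A.
have dp : 0 < cos (1 : R) / (`|A| + 1) by rewrite divr_gt0 //; lra.
have dE : cos (1 : R) / (`|A| + 1) * (`|A| + 1) = cos 1 by rewrite divfK // gt_eqF //; lra.
set d := cos 1 / _ in dp dE *.
exists d; first by rewrite dp /=; nra.
move=> e /andP[e0 ed].
have d1 : d <= 1 by nra.
have p2 := pi_ge2 R.
have se : 0 < sin e by apply: sin_gt0_pi; lra.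
have sle := sin_le_id (ltW e0).
have ce : cos 1 <= cos e.
  rewrite leNgt; apply/negP => h; have := @ltr_cos R 1 e.
  rewrite !in_itv /= h => /(_ _ _)/esym.
  by move=> /(_ ltac:(lra) ltac:(lra)); lra.
rewrite ltr_pdivlMr //; have := ler_norm A; nra.
Qed.

Definition mcot s : R := s * cot s - 1.

Lemma third_quadrant s : pi < s < 3 / 2 * pi -> sin s < 0 /\ cos s < 0.
Proof.
move=> /andP[h1 h2]; have -> : s = (s - pi) + pi by ring.
rewrite sinDpi cosDpi !oppr_lt0; split.
  by apply: sin_gt0_pi; have := pi_gt0 R; lra.
by apply: cos_gt0_pihalf; have := pi_gt0 R; lra.
Qed.

(** The root is found for [s cos s - sin s], which, unlike [tan], has no pole at [3 / 2 * pi]; its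
    values [- pi] and [1] at the ends keep the root inside. *)
Lemma theta1_spec : pi < theta1 R < 3 / 2 * pi /\ sin (theta1 R) = theta1 R * cos (theta1 R).
Proof.
have p0 := pi_gt0 R.
have : [set s : R | pi < s < 3 / 2 * pi /\ tan s = s] (theta1 R).
  apply: xgetPex.
  have [|||c /andP[c1 c2]] := @zero_between R (fun s => s * cos s - sin s) pi (3 / 2 * pi).
  - lra.
  - by move=> x _; continuity.
  - have -> : 3 / 2 * pi = pi / 2 + pi :> R by field.
    by rewrite cospi sinpi cosDpi sinDpi cos_pihalf sin_pihalf; lra.
  move=> /eqP; rewrite subr_eq0 => /eqP E.
  have cpi : pi < c.
    rewrite lt_neqAle c1 andbT; apply/eqP => ce; move: E; rewrite -ce cospi sinpi; lra.
  have c3 : c < 3 / 2 * pi.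
    rewrite lt_neqAle c2 andbT; apply/eqP => ce; move: E; rewrite ce.
    have -> : 3 / 2 * pi = pi / 2 + pi :> R by field.
    rewrite cosDpi sinDpi cos_pihalf sin_pihalf; lra.
  have [|_ cc] := @third_quadrant c; first by rewrite cpi.
  by exists c; rewrite /= cpi c3; split => //; rewrite /tan -E mulfK // lt_eqF.
move=> [h E]; split => //; have [_ cc] := third_quadrant h.
have cn : cos (theta1 R) != 0 by rewrite lt_eqF.
by rewrite -[LHS](divfK cn) -/(tan _) E.
Qed.

Lemma mcot_theta1 : mcot (theta1 R) = 0.
Proof.
have [h E] := theta1_spec; have [s0 c0] := third_quadrant h.
by rewrite /mcot /cot mulrA -E divff ?subrr // lt_eqF.
Qed.

(** A Riccati equation: the derivative is rational in [s] and [mcot s], so later estimates involve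
    no trigonometry. *)
Lemma der_mcot s : pi < s < 3 / 2 * pi -> der_at mcot (- (s + (mcot s ^+ 2 + mcot s) / s)) s.
Proof.
move=> h; have [s0 c0] := third_quadrant h; have sn : sin s != 0 by rewrite lt_eqF.
have sp : s != 0 by rewrite gt_eqF //; have := pi_gt0 R; case/andP: h => ? ? ?; lra.
change (der_at (fun s : R => s * (cos s / sin s) - 1) (- (s + (mcot s ^+ 2 + mcot s) / s)) s).
eapply der_eq; first by derive_at.
rewrite /mcot /cot.
have e : cos s ^+ 2 = 1 - sin s ^+ 2 by have := cos2Dsin2 s; lra.
by field: e; rewrite sn sp.
Qed.

(** By the Riccati equation, [- x] times the derivative is
    [x^2 + m^2 + m = x^2 - 1/4 + (m + 1/2)^2], positive since [x > 2]. *)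
Lemma mcot_decreasing s t : pi < s -> s < t -> t < 3 / 2 * pi -> mcot t < mcot s.
Proof.
move=> ps st tp; apply: (der_decreasing st (df := fun s => - (s + (mcot s ^+ 2 + mcot s) / s))).
  by move=> x /andP[sx xt]; apply: der_mcot; rewrite (lt_le_trans ps sx) (le_lt_trans xt tp).
move=> x /andP[sx xt]; have p2 := pi_ge2 R; have x2 : 2 < x by lra.
rewrite oppr_lt0 -(pmulr_lgt0 _ (_ : 0 < x)); last lra.
rewrite mulrDl divfK; last by rewrite gt_eqF; lra.
have := sqr_ge0 (mcot x + 1 / 2); nra.
Qed.

Lemma mcot_unbounded (A : R) : exists2 s, pi < s < theta1 R & A < mcot s.
Proof.
have [/andP[h1 h2] _] := theta1_spec; have p2 := pi_ge2 R.
have [d /andP[d0 d1] hd] := cot_unbounded (`|A| + 1).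
pose e := Num.min d ((theta1 R - pi) / 2).
have e0 : 0 < e by rewrite lt_min d0; lra.
have ed : e <= d by rewrite ge_min lexx.
have et : e <= (theta1 R - pi) / 2 by rewrite ge_min lexx orbT.
exists (e + pi); first by apply/andP; split; lra.
have := hd e; rewrite e0 ed => /(_ isT) h.
rewrite /mcot /cot sinDpi cosDpi invrN mulrNN.
have := ler_norm A; have := normr_ge0 A; nra.
Qed.

Lemma psiE s : psi s = - mcot s / s ^+ 2.
Proof. by rewrite /psi /mcot; congr (_ / _); ring. Qed.

Lemma psi'E s : pi < s < 3 / 2 * pi ->
  derive1 (@psi R) s = (s ^+ 2 + mcot s ^+ 2 + 3 * mcot s) / s ^+ 3.
Proof.
move=> h; have sp : s != 0 by rewrite gt_eqF //; have := pi_gt0 R; case/andP: h => ? ? ?; lra.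
have -> : @psi R = (fun s => - mcot s / s ^+ 2) by apply/funext => x; exact: psiE.
have dm := der_mcot h.
rewrite derive1E; apply: derive_val; eapply der_eq; first by derive_at; exact: expf_neq0.
by rewrite /=; field.
Qed.

End CotangentDefect.

(** * Comparison of [phi] on the barrier *)

Section Barrier.
Context {R : realType}.
Implicit Types (r s t rho u : R).

(* [psi' r / r], in terms of [m = r cot r - 1]. *)
Definition psi'_over r : R := (r ^+ 2 + mcot r ^+ 2 + 3 * mcot r) / r ^+ 4.

Lemma mcot_ge0 r : pi < r <= theta1 R -> 0 <= mcot r.
Proof.
have [/andP[_ t2] _] := @theta1_spec R.
move=> /andP[pr]; rewrite le_eqVlt => /predU1P[->|rt]; first by rewrite mcot_theta1.
by rewrite -(@mcot_theta1 R) ltW // mcot_decreasing.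
Qed.

Lemma mcot_nonincreasing r t : pi < r -> r <= t -> t <= theta1 R -> mcot t <= mcot r.
Proof.
have [/andP[_ t2] _] := @theta1_spec R.
move=> pr; rewrite le_eqVlt => /predU1P[->//|rt] tt.
by rewrite ltW // mcot_decreasing // (le_lt_trans tt).
Qed.

(** In terms of [x = 1 / t^2] the square of the ratio is [x - rho^2 x^2], which increases up to
    [x = 1 / (2 rho^2)]; this is where [2 rho^2 <= r^2] enters. *)
Lemma sqrt_ratio_nonincreasing rho r t : 0 < r -> 2 * rho ^+ 2 <= r ^+ 2 -> r <= t ->
  Num.sqrt (t ^+ 2 - rho ^+ 2) / t ^+ 2 <= Num.sqrt (r ^+ 2 - rho ^+ 2) / r ^+ 2.
Proof.
move=> r0 hr rt; have t0 : 0 < t by exact: lt_le_trans rt.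
have rt2 : r ^+ 2 <= t ^+ 2 by rewrite ler_pXn2r ?nnegrE // ltW.
have r2 : 0 < r ^+ 2 by rewrite exprn_gt0. have t2 : 0 < t ^+ 2 by rewrite exprn_gt0.
have p0 := sqr_ge0 rho.
rewrite ler_pdivrMr // mulrAC ler_pdivlMr //.
rewrite -(ler_pXn2r (_ : (0 < 2)%N)) ?nnegrE ?(mulr_ge0 (sqrtr_ge0 _) (ltW _)) //.
rewrite !exprMn !sqr_sqrtr; [| lra | lra].
set a := r ^+ 2 in hr rt2 r2 *; set b := t ^+ 2 in rt2 t2 *; set c := rho ^+ 2 in hr p0 *.
rewrite -subr_ge0.
rewrite [leRHS](_ : _ = (b - a) * ((a - 2 * c) * b / 2 + (b - 2 * c) * a / 2)); last by field.
have hb : 2 * c <= b by lra.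
apply: mulr_ge0; first by rewrite subr_ge0.
by apply: addr_ge0; rewrite divr_ge0 // mulr_ge0 ?subr_ge0 // ltW.
Qed.

(** With [g] the ratio of [sqrt_ratio_nonincreasing], the product is [g + (m^2 + 3 m) g / r^2],
    built from nonnegative nonincreasing factors. *)
Lemma slope_nonincreasing rho r t : pi < r -> 2 * rho ^+ 2 <= pi ^+ 2 -> r <= t -> t <= theta1 R ->
  psi'_over t * Num.sqrt (t ^+ 2 - rho ^+ 2) <= psi'_over r * Num.sqrt (r ^+ 2 - rho ^+ 2).
Proof.
move=> pr hrho rt tt; have p2 := pi_ge2 R.
have r0 : 0 < r by lra. have t0 : 0 < t by lra.
have pr2 : pi ^+ 2 <= r ^+ 2 by nra.
have rt2 : r ^+ 2 <= t ^+ 2 by rewrite ler_pXn2r ?nnegrE //; lra.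
have mt : 0 <= mcot t by apply: mcot_ge0; rewrite tt (lt_le_trans pr).
have mr : mcot t <= mcot r by exact: mcot_nonincreasing.
have E x y : 0 < x -> psi'_over x * y = y / x ^+ 2 + (mcot x ^+ 2 + 3 * mcot x) * (y / x ^+ 2 / x ^+ 2).
  by move=> x0; rewrite /psi'_over; field; rewrite gt_eqF.
rewrite !E //; set g := Num.sqrt (t ^+ 2 - _) / _; set h := Num.sqrt (r ^+ 2 - _) / _.
have gh : g <= h by apply: sqrt_ratio_nonincreasing => //; lra.
have g0 : 0 <= g by rewrite divr_ge0 ?sqrtr_ge0 ?sqr_ge0.
have t2 : 0 < t ^+ 2 by rewrite exprn_gt0.
have r2 : 0 < r ^+ 2 by rewrite exprn_gt0.
apply: lerD => //; apply: ler_pM; [nra | by rewrite divr_ge0 // ltW | nra |].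
apply: ler_pM => //; first by rewrite invr_ge0 ltW.
by rewrite lef_pV2.
Qed.

(** Up to a constant, this is [phi] along the points [(sqrt (r^2 - rho^2), - rho, 0)]. Its
    derivative has the sign of [u1 - rho^2 psi'_over r sqrt (r^2 - rho^2)], which is nondecreasing
    and vanishes at [rs] by the hypothesis on [u1], the first component of [Lambda v = u]. *)
Lemma profile_min rho rs u1 r : pi < rs <= theta1 R -> pi < r <= theta1 R -> 2 * rho ^+ 2 <= pi ^+ 2 ->
  u1 = rho ^+ 2 * (psi'_over rs * Num.sqrt (rs ^+ 2 - rho ^+ 2)) ->
  mcot rs * (rho ^+ 2 / rs ^+ 2) + u1 * Num.sqrt (rs ^+ 2 - rho ^+ 2) <=
  mcot r * (rho ^+ 2 / r ^+ 2) + u1 * Num.sqrt (r ^+ 2 - rho ^+ 2).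
Proof.
move=> /andP[ps st] /andP[pr rt] hrho u1E; have p2 := pi_ge2 R.
have [/andP[_ t2] _] := @theta1_spec R.
pose H x := mcot x * (rho ^+ 2 / x ^+ 2) + u1 * Num.sqrt (x ^+ 2 - rho ^+ 2).
pose dH x := (x / Num.sqrt (x ^+ 2 - rho ^+ 2)) * (u1 - rho ^+ 2 * (psi'_over x * Num.sqrt (x ^+ 2 - rho ^+ 2))).
have sq x : pi < x -> 0 < Num.sqrt (x ^+ 2 - rho ^+ 2).
  by move=> px; rewrite sqrtr_gt0; have := sqr_ge0 rho; nra.
have dHP x : pi < x <= theta1 R -> der_at H (dH x) x.
  move=> /andP[px xt]; have sx := sq _ px.
  have dm := der_mcot (introT andP (conj px (le_lt_trans xt t2))).
  have x0 : x != 0 by rewrite gt_eqF //; lra.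
  rewrite /H.
  have ds : der_at (fun x => Num.sqrt (x ^+ 2 - rho ^+ 2)) (x / Num.sqrt (x ^+ 2 - rho ^+ 2)) x.
    eapply der_eq; first by apply: der_sqrt; [rewrite -sqrtr_gt0 | derive_at].
    by rewrite /=; field; rewrite gt_eqF.
  eapply der_eq; first by derive_at; exact: expf_neq0.
  rewrite /dH /psi'_over /=; field; rewrite x0 gt_eqF //.
have mono a b : pi < a -> a <= b -> b <= theta1 R ->
   psi'_over b * Num.sqrt (b ^+ 2 - rho ^+ 2) <= psi'_over a * Num.sqrt (a ^+ 2 - rho ^+ 2).
  by move=> *; exact: slope_nonincreasing.
have [rs_r|r_rs] := leP rs r.
  have : - H r <= - H rs; last by rewrite lerN2.
  apply: (der_nonincreasing rs_r (f := fun x => - H x) (df := fun x => - dH x)) => x /andP[sx xr].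
    by apply: derN; apply: dHP; lra.
  have px : pi < x by lra.
  have h := mono _ _ ps sx (le_trans xr rt).
  rewrite oppr_le0 mulr_ge0 // ?divr_ge0 ?(ltW (sq _ px)) //; first lra.
  by rewrite u1E subr_ge0 ler_wpM2l ?sqr_ge0.
apply: (der_nonincreasing (ltW r_rs) (f := H) (df := dH)) => x /andP[sx xr].
  by apply: dHP; lra.
have px : pi < x by lra.
have h := mono _ _ px xr st.
rewrite mulr_ge0_le0 // ?divr_ge0 ?(ltW (sq _ px)) //; first lra.
by rewrite u1E subr_le0 ler_wpM2l ?sqr_ge0.
Qed.

(** The two sides are [phi] at [(sqrt (rs^2 - rho^2), - rho, 0)] and at [r n]. Both alternatives
    keep [r n] within [rho] of the first axis, so [u2 (r n2) >= - u2 rho]. In the first one the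
    [mcot] term is that of the profile; in the second it vanishes, and a larger [n1] only increases
    the linear term. *)
Lemma barrier rho rs u1 u2 r n1 n2 n3 :
  0 <= rho -> 0 <= u1 -> 0 <= u2 ->
  pi < rs <= theta1 R -> pi < r <= theta1 R -> 2 * rho ^+ 2 <= pi ^+ 2 ->
  u1 = rho ^+ 2 * (psi'_over rs * Num.sqrt (rs ^+ 2 - rho ^+ 2)) ->
  n1 ^+ 2 + n2 ^+ 2 + n3 ^+ 2 = 1 ->
  n1 = Num.sqrt (1 - rho ^+ 2 / r ^+ 2) \/
    (r = theta1 R /\ Num.sqrt (1 - rho ^+ 2 / theta1 R ^+ 2) <= n1) ->
  1 + mcot rs * (rho ^+ 2 / rs ^+ 2) + u1 * Num.sqrt (rs ^+ 2 - rho ^+ 2) - u2 * rho <=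
  1 + mcot r * (1 - n1 ^+ 2) + r * (u1 * n1 + u2 * n2).
Proof.
move=> rho0 u10 u20 hs hr hrho u1E nn cases.
have pm := profile_min hs hr hrho u1E.
have p2 := pi_ge2 R; have /andP[pr rt] := hr.
have r0 : 0 < r by lra.
have r2 : 0 < r ^+ 2 by rewrite exprn_gt0.
have q0 : 0 <= 1 - rho ^+ 2 / r ^+ 2.
  by rewrite subr_ge0 ler_pdivrMr // mul1r; have := sqr_ge0 rho; nra.
have rsq : r * Num.sqrt (1 - rho ^+ 2 / r ^+ 2) = Num.sqrt (r ^+ 2 - rho ^+ 2).
  rewrite -{1}(ger0_norm (ltW r0)) -sqrtr_sqr -sqrtrM ?sqr_ge0 //.
  by congr Num.sqrt; field; rewrite gt_eqF.
have n1s : Num.sqrt (1 - rho ^+ 2 / r ^+ 2) <= n1.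
  by case: cases => [->//|[-> h]].
have n1sq : 1 - rho ^+ 2 / r ^+ 2 <= n1 ^+ 2.
  rewrite -{1}(sqr_sqrtr q0) ler_pXn2r ?nnegrE ?sqrtr_ge0 //.
  by apply: le_trans n1s; exact: sqrtr_ge0.
have rn2 : - rho <= r * n2.
  have : (r * n2) ^+ 2 <= rho ^+ 2.
    have : n2 ^+ 2 <= rho ^+ 2 / r ^+ 2 by have := sqr_ge0 n3; lra.
    by rewrite ler_pdivlMr // exprMn mulrC.
  rewrite -(real_normK (num_real (r * n2))) ler_pXn2r ?nnegrE // => /le_trans h.
  by rewrite lerNl; apply: le_trans (h _ (lexx _)); rewrite -normrN ler_norm.
have mE : mcot r * (rho ^+ 2 / r ^+ 2) = mcot r * (1 - n1 ^+ 2).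
  case: cases => [->|[-> _]]; first by rewrite sqr_sqrtr //; ring.
  by rewrite mcot_theta1 !mul0r.
have rn1 : u1 * Num.sqrt (r ^+ 2 - rho ^+ 2) <= u1 * (r * n1).
  by rewrite ler_wpM2l // -rsq ler_wpM2l // ltW.
have := ler_wpM2l u20 rn2; rewrite mulrN.
rewrite -mE mulrDr !mulrA ![r * u1]mulrC ![r * u2]mulrC -!mulrA; lra.
Qed.

End Barrier.

(** * The lower bound *)

Section PolygonLowerBound.
Context {R : realType}.

Lemma one_minus_cos_le (x : R) : 0 <= x -> 1 - cos x <= x ^+ 2 / 2.
Proof.
move=> x0; have -> : 1 - cos x = 2 * sin (x / 2) ^+ 2.
  rewrite {1}(_ : x = (x / 2) *+ 2); last by rewrite mulr2n; field.
  by rewrite cos_mulr2n sin2cos2; ring.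
have x2 : 0 <= x / 2 by rewrite divr_ge0.
have h1 := sin_le_id x2.
have : - (x / 2) <= sin (x / 2).
  have [xp|xp] := leP (x / 2) pi; first by have := @sin_ge0_pi R (x / 2); rewrite x2 xp => /(_ isT); lra.
  by have := sin_geN1 (x / 2); have := pi_ge2 R; lra.
nra.
Qed.

Lemma tan_bounds (x : R) : 0 <= x <= 1 -> (x <= tan x) * (tan x - x <= x ^+ 3).
Proof.
move=> /andP[x0 x1].
have ch := pihalf_ge1 R.
have cpos (y : R) : 0 <= y <= 1 -> y < 1 -> 0 < cos y by move=> /andP[h h1] y1; apply: cos_gt0_pihalf; lra.
have c1 := cos1_gt0 R.
have cx : 0 < cos x.
  by have [->//|xn] := eqVneq x 1; apply: cpos; [rewrite x0 | rewrite lt_neqAle xn].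
have sx := sin_le_id x0.
have oc := one_minus_cos_le x0.
have cle := cos_le1 x.
split; last first.
  rewrite lerBlDr /tan ler_pdivrMr //.
  have : 0 <= x ^+ 3 by rewrite exprn_ge0.
  have h : 1 - x ^+ 2 / 2 <= cos x by lra.
  have x2 : x ^+ 2 <= 1 by nra.
  have -> : (x ^+ 3 + x) * cos x = x * ((x ^+ 2 + 1) * cos x) by ring.
  move=> _; apply: (le_trans sx); rewrite -{1}[x]mulr1 ler_wpM2l //.
  have x20 := sqr_ge0 x; nra.
rewrite /tan ler_pdivlMr //.
have : - (sin x - x * cos x) <= - (sin 0 - 0 * cos 0); last by rewrite sin0 mul0r; lra.
apply: (der_nonincreasing x0 (f := fun y => - (sin y - y * cos y)) (df := fun y => - (y * sin y))).
  by move=> y _; eapply der_eq; [derive_at | rewrite /=; ring].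
move=> y /andP[y0 yx]; rewrite oppr_le0 mulr_ge0 // sin_ge0_pi // y0 /=.
by have := pi_ge2 R; lra.
Qed.

(** Since [r < 3 / 2 * pi < 6], the constant [216 = 6^3] bounds [r^3], and [N > 5] keeps [r / N] in
    the range of [tan_bounds]. *)
Lemma tan_step N (r : R) : (5 < N)%N -> pi < r <= theta1 R ->
  [/\ 0 < cos (r / N%:R), r <= N%:R * tan (r / N%:R) &
      N%:R * tan (r / N%:R) - r <= 216 / N%:R ^+ 2].
Proof.
move=> N5 /andP[pr rt]; have N6 : 6 <= N%:R :> R by rewrite ler_nat.
have [/andP[th1 th2] _] := @theta1_spec R.
have p2 := pi_ge2 R; have ph := pihalf_lt2 R.
have Np : 0 < N%:R :> R by lra.
have r6 : r <= 6 by lra.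
have r0 : 0 <= r by lra.
pose be := r / N%:R.
have be0 : 0 <= be by rewrite divr_ge0 // ltW.
have be1 : be <= 1 by rewrite ler_pdivrMr // mul1r; lra.
have [tb1 tb2] := @tan_bounds be (introT andP (conj be0 be1)).
split.
- by have := one_minus_cos_le be0; have h : be ^+ 2 <= 1 by [nra]; rewrite -/be; lra.
- by rewrite mulrC -ler_pdivrMr.
have -> : N%:R * tan (r / N%:R) - r = N%:R * (tan be - be).
  by rewrite mulrBr /be; congr (_ - _); field; rewrite gt_eqF.
apply: (@le_trans _ _ (N%:R * be ^+ 3)); first by rewrite ler_pM2l.
have -> : N%:R * be ^+ 3 = r ^+ 3 / N%:R ^+ 2 by rewrite /be; field; rewrite gt_eqF.
rewrite ler_pM2r ?invr_gt0 ?exprn_gt0 //.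
have -> : 216 = 6 ^+ 3 :> R by ring.
by rewrite ler_pXn2r ?nnegrE.
Qed.

(** Minus the imaginary part of the Fourier coefficient in [helix_mode]; it is the function [k] of
    [direction_selection]. *)
Definition mode_weight N (r : R) : R :=
  2^-1 * (cos ((r - pi) / N%:R) / sin ((r - pi) / N%:R)).

Lemma sin_mode_gt0 N (r : R) : (1 < N)%N -> pi < r <= theta1 R -> 0 < sin ((r - pi) / N%:R).
Proof.
move=> N1 /andP[pr rt]; have N2 : 2 <= N%:R :> R by rewrite ler_nat.
have [/andP[th1 th2] _] := @theta1_spec R; have p2 := pi_ge2 R.
have Np : 0 < N%:R :> R by lra.
apply: sin_gt0_pi; rewrite divr_gt0 ?subr_gt0 //= ltr_pdivrMr //; nra.
Qed.

Lemma axis_ratio_itv (rho r : R) : 2 * rho ^+ 2 <= pi ^+ 2 -> pi < r ->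
  0 <= 1 - rho ^+ 2 / r ^+ 2 <= 1.
Proof.
move=> rho2 pr; have p2 := pi_ge2 R; have r0 : 0 < r by lra.
have r2 : 0 < r ^+ 2 by rewrite exprn_gt0.
have q0 := sqr_ge0 rho.
rewrite subr_ge0 ler_pdivrMr // mul1r gerBl divr_ge0 ?(ltW r2) // andbT.
have : pi ^+ 2 <= r ^+ 2 by nra.
lra.
Qed.

(** As [a] decreases to [pi] the weight tends to infinity, whereas [1 - tau a] stays above
    [rho^2 / 72] because [a <= 6]. *)
Lemma near_pi_start (rho K : R) N (tau := fun r : R => Num.sqrt (1 - rho ^+ 2 / r ^+ 2)) :
  (0 < N)%N -> 0 < rho -> 2 * rho ^+ 2 <= pi ^+ 2 -> 0 <= K ->
  exists2 a, pi < a <= theta1 R & K * (1 + tau a) < mode_weight N a * (1 - tau a).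
Proof.
move=> N0 rho0 rho2 K0.
have [/andP[th1 th2] _] := @theta1_spec R; have p2 := pi_ge2 R; have ph := pihalf_lt2 R.
have Np : 0 < N%:R :> R by rewrite ltr0n.
have rr0 : 0 < rho ^+ 2 by rewrite exprn_gt0.
(* [288 = 2 * 2 * 72]: one factor 2 for [1 + tau a <= 2], one for the factor 1/2 in
   [mode_weight]. *)
have [d /andP[d0 d1] hd] := cot_unbounded (288 * K / rho ^+ 2).
pose e := Num.min d ((theta1 R - pi) / N%:R).
have e0 : 0 < e by rewrite lt_min d0 divr_gt0 // subr_gt0.
have ed : e <= d by rewrite ge_min lexx.
have et : N%:R * e <= theta1 R - pi.
  by rewrite mulrC -ler_pdivlMr // ge_min lexx orbT.
pose a := pi + N%:R * e.
have ap : pi < a by rewrite ltrDl mulr_gt0.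
have ath : a <= theta1 R by rewrite /a; lra.
exists a; first by rewrite ap.
have eE : (a - pi) / N%:R = e by rewrite /a; field; rewrite gt_eqF.
have := hd e; rewrite e0 ed => /(_ isT); rewrite ltr_pdivrMr // /mode_weight eE => hk.
have /andP[h0 h1] := axis_ratio_itv rho2 ap.
have tau0 : 0 <= tau a by exact: sqrtr_ge0.
have tau2 : tau a ^+ 2 = 1 - rho ^+ 2 / a ^+ 2 by rewrite sqr_sqrtr.
have a2 : a ^+ 2 <= 36 by nra.
have a20 : 0 < a ^+ 2 by rewrite exprn_gt0 //; lra.
have qlo : rho ^+ 2 / 36 <= rho ^+ 2 / a ^+ 2 by rewrite ler_pM2l // lef_pV2 ?posrE //; lra.
have tau1 : tau a <= 1 by nra.
have h72 : rho ^+ 2 / 72 <= 1 - tau a by nra.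
move: hk; set cc := cos _ / sin _ => hk.
have cc0 : 0 < cc by nra.
clear - hk h72 tau0 tau1 cc0 K0 rr0; nra.
Qed.

(** After division by [cos (r / N) / N], the relation [cot r = (1 + m) / r] and [r <= N tan (r / N)]
    bring the left side down to its limit value. *)
Lemma spatial_bound_tan N (r n1 S w : R) : (5 < N)%N -> pi < r <= theta1 R -> n1 ^+ 2 <= 1 ->
  cos (r / N%:R) * (n1 ^+ 2 / N%:R) + (1 - n1 ^+ 2) * (sin (r / N%:R) * (cos r / sin r)) <=
    cos (r / N%:R) * S + 2 * sin (r / N%:R) * (- 2 * w) ->
  1 + mcot r * (1 - n1 ^+ 2) + 4 * (N%:R * tan (r / N%:R)) * w <= N%:R * S.
Proof.
move=> N5 ri n12 sp; have [cb NT _] := tan_step N5 ri.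
have /andP[pr rt] := ri; have [/andP[_ th2] _] := @theta1_spec R; have p2 := pi_ge2 R.
have [s_neg _] := @third_quadrant R r (introT andP (conj pr (le_lt_trans rt th2))).
have sr0 : sin r != 0 by rewrite lt_eqF.
have r0 : 0 < r by lra.
have Np : 0 < N%:R :> R by rewrite ltr0n (ltn_trans _ N5).
have m0 := mcot_ge0 ri.
have cotE : cos r / sin r = (1 + mcot r) / r.
  by rewrite /mcot /cot; field; rewrite sr0 gt_eqF.
rewrite cotE in sp.
set T := tan _ in NT *; set m := mcot r in m0 sp *.
have sp' : n1 ^+ 2 + (1 - n1 ^+ 2) * (N%:R * T * ((1 + m) / r)) <= N%:R * S - 4 * (N%:R * T) * w.
  rewrite -(ler_pM2l (_ : 0 < cos (r / N%:R) / N%:R)); last by rewrite divr_gt0.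
  by move: sp; congr (_ <= _); rewrite /T /tan; field; rewrite ?gt_eqF.
have : (1 - n1 ^+ 2) * (1 + m) <= (1 - n1 ^+ 2) * (N%:R * T * ((1 + m) / r)).
  rewrite ler_wpM2l ?subr_ge0 // mulrCA ler_peMr //; first by rewrite addr_ge0.
  by rewrite ler_pdivlMr ?mul1r.
clear - sp'; lra.
Qed.

(** Two replacements are made: [NT] by [r], and the endpoint [t] of the polygon by [u / 4]. The
    second costs at most [4 r * 3 eta <= 72 eta]. *)
Lemma discretization_error (r NT q eta u1 u2 n1 n2 n3 t1 t2 t3 : R) :
  0 <= r <= 6 -> 0 <= u1 -> 0 <= u2 -> r <= NT -> NT - r <= q ->
  `|n1| <= 1 -> `|n2| <= 1 -> `|n3| <= 1 ->
  `|t1 - 4^-1 * u1| <= eta -> `|t2 - 4^-1 * u2| <= eta -> `|t3| <= eta ->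
  r * (u1 * n1 + u2 * n2) <=
    4 * NT * (n1 * t1 + n2 * t2 + n3 * t3) + (4 * q * (u1 + u2 + 3 * eta) + 72 * eta).
Proof.
move=> /andP[r0 r6] u10 u20 rN Nq n1b n2b n3b ht1 ht2 ht3.
have prod (x y z : R) : `|x| <= 1 -> `|y| <= z -> - z <= x * y <= z.
  move=> hx hy; rewrite -ler_norml normrM; apply: le_trans hy.
  by rewrite ler_piMl.
have eta0 : 0 <= eta by apply: le_trans ht3.
have /andP[a1 b1] := prod _ _ _ n1b ht1.
have /andP[a2 b2] := prod _ _ _ n2b ht2.
have /andP[a3 b3] := prod _ _ _ n3b ht3.
have /andP[p1 q1] : - (4^-1 * u1) <= n1 * (4^-1 * u1) <= 4^-1 * u1.
  by apply: prod => //; rewrite ger0_norm //; clear - u10; lra.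
have /andP[p2 q2] : - (4^-1 * u2) <= n2 * (4^-1 * u2) <= 4^-1 * u2.
  by apply: prod => //; rewrite ger0_norm //; clear - u20; lra.
clear prod n1b n2b n3b ht1 ht2 ht3.
have nt : - (n1 * t1 + n2 * t2 + n3 * t3) <= (u1 + u2) / 4 + 3 * eta by lra.
have D : - (n1 * (t1 - 4^-1 * u1) + n2 * (t2 - 4^-1 * u2) + n3 * t3) <= 3 * eta by lra.
have D' : r * (- (n1 * (t1 - 4^-1 * u1) + n2 * (t2 - 4^-1 * u2) + n3 * t3)) <= r * (3 * eta).
  by rewrite ler_wpM2l.
have r18 : r * (3 * eta) <= 18 * eta by clear - r6 eta0; nra.
have E : (NT - r) * (- (n1 * t1 + n2 * t2 + n3 * t3)) <= q * (u1 + u2 + 3 * eta).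
  apply: (@le_trans _ _ ((NT - r) * ((u1 + u2) / 4 + 3 * eta))).
    by rewrite ler_wpM2l ?subr_ge0.
  by apply: ler_pM => //; rewrite ?subr_ge0 //; clear - u10 u20 eta0; lra.
clear - D' r18 E; lra.
Qed.

Lemma polygon_lower_bound (rho rs u1 u2 : R) (P1 P2 P3 : nat -> R) N (L eta t1 t2 t3 : R) :
  0 < rho -> 0 <= u1 -> 0 <= u2 -> pi < rs <= theta1 R -> 2 * rho ^+ 2 <= pi ^+ 2 ->
  u1 = rho ^+ 2 * (psi'_over rs * Num.sqrt (rs ^+ 2 - rho ^+ 2)) -> (5 < N)%N ->
  P1 0%N = 0 -> P2 0%N = 0 -> P3 0%N = 0 -> P1 N = 1 -> P2 N = 0 -> P3 N = 0 ->
  t1 = - (2^-1 * \sum_(k < N) (P2 k * P3 k.+1 - P3 k * P2 k.+1)) ->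
  t2 = - (2^-1 * \sum_(k < N) (P3 k * P1 k.+1 - P1 k * P3 k.+1)) ->
  t3 = - (2^-1 * \sum_(k < N) (P1 k * P2 k.+1 - P2 k * P1 k.+1)) ->
  N%:R * \sum_(k < N) ((P1 k.+1 - P1 k) ^+ 2 + (P2 k.+1 - P2 k) ^+ 2 + (P3 k.+1 - P3 k) ^+ 2) <= L ->
  `|t1 - 4^-1 * u1| <= eta -> `|t2 - 4^-1 * u2| <= eta -> `|t3| <= eta ->
  1 + mcot rs * (rho ^+ 2 / rs ^+ 2) + u1 * Num.sqrt (rs ^+ 2 - rho ^+ 2) - u2 * rho <=
    L + (4 * (216 / N%:R ^+ 2) * (u1 + u2 + 3 * eta) + 72 * eta).
Proof.
move=> rho0 u10 u20 rsi rho2 u1E N5 P10 P20 P30 P1N P2N P3N t1E t2E t3E hL ht1 ht2 ht3.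
have N1 : (1 < N)%N by apply: ltn_trans N5.
have [/andP[th1 th2] _] := @theta1_spec R; have p2 := pi_ge2 R; have ph := pihalf_lt2 R.
have t6 : theta1 R <= 6 by lra.
set om : R := 2 * pi / N%:R.
pose C1 := \sum_(k < N) P1 k * cos (k%:R * om) + 2^-1.
pose C2 := \sum_(k < N) P2 k * cos (k%:R * om).
pose C3 := \sum_(k < N) P3 k * cos (k%:R * om).
pose S1 := \sum_(k < N) P1 k * sin (k%:R * om).
pose S2 := \sum_(k < N) P2 k * sin (k%:R * om).
pose S3 := \sum_(k < N) P3 k * sin (k%:R * om).
pose tau r : R := Num.sqrt (1 - rho ^+ 2 / r ^+ 2).
have [|a /andP[ap ath] start] := @near_pi_start rho
    (`|- S1| + `|- S2| + `|- S3| + `|C1| + `|C2| + `|C3|) N (ltnW N1) rho0 rho2.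
  by rewrite !addr_ge0.
(* The axis equation of [spatial_polygon_bound] has [- S] next to the weight and [C] in the cross
   product, so these take the places of [c] and [s]. *)
have [||| r [n1 [n2 [n3 [lam [/andP[ar rt] nn [e1 e2 e3] cases]]]]]] :=
    @direction_selection R (mode_weight N) tau a (theta1 R) (- S1) (- S2) (- S3) C1 C2 C3
      ath _ _ _ start.
- move=> r /andP[ar rt]; rewrite /mode_weight; continuity.
  by rewrite gt_eqF // sin_mode_gt0 // rt (lt_le_trans ap).
- move=> r /andP[ar rt]; rewrite /tau; continuity.
  by rewrite expf_neq0 // gt_eqF // (lt_le_trans _ ar) // (lt_trans _ ap) // pi_gt0.
- move=> r /andP[ar rt]; rewrite sqrtr_ge0 /=.
  have /andP[h0 h1] := axis_ratio_itv rho2 (lt_le_trans ap ar).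
  by rewrite -[leRHS]sqrtr1 ler_sqrt.
have ri : pi < r <= theta1 R by rewrite rt (lt_le_trans ap).
have /andP[pr _] := ri.
have r0 : 0 <= r by rewrite ltW // (lt_trans _ pr) // pi_gt0.
have [s_neg _] := @third_quadrant R r (introT andP (conj pr (le_lt_trans rt th2))).
have sr0 : sin r != 0 by rewrite lt_eqF.
have r02 : 0 <= r <= 2 * pi.
  by rewrite r0 (le_trans rt) // (le_trans (ltW th2)) // ler_wpM2r ?pi_ge0 //; clear; lra.
have [cb NT NTq] := tan_step N5 ri.
have sp := spatial_polygon_bound N1 r02 (ltW cb) sr0 (lt0r_neq0 (sin_mode_gt0 N1 ri))
  P10 P20 P30 P1N P2N P3N nn e1 e2 e3.
have bar := barrier (ltW rho0) u10 u20 rsi ri rho2 u1E nn cases.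
have [n1b n2b n3b] := unit_coords_le1 nn.
have n12 : n1 ^+ 2 <= 1 by rewrite -(real_normK (num_real n1)) exprn_ile1.
have SnE : \sum_(k < N) (n1 * (P2 k * P3 k.+1 - P3 k * P2 k.+1) +
    n2 * (P3 k * P1 k.+1 - P1 k * P3 k.+1) + n3 * (P1 k * P2 k.+1 - P2 k * P1 k.+1)) =
    - 2 * (n1 * t1 + n2 * t2 + n3 * t3).
  clear - t1E t2E t3E.
  rewrite t1E t2E t3E [RHS](_ : _ = n1 * \sum_(k < N) (P2 k * P3 k.+1 - P3 k * P2 k.+1) +
     n2 * \sum_(k < N) (P3 k * P1 k.+1 - P1 k * P3 k.+1) +
     n3 * \sum_(k < N) (P1 k * P2 k.+1 - P2 k * P1 k.+1)); last by field.
  by rewrite !mulr_sumr -!big_split; apply: eq_bigr.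
rewrite SnE in sp.
have main := le_trans (spatial_bound_tan N5 ri n12 sp) hL.
have r6 : 0 <= r <= 6 by rewrite r0 (le_trans rt).
have err := discretization_error r6 u10 u20 NT NTq n1b n2b n3b ht1 ht2 ht3.
apply: (le_trans bar); move: main err; clear.
set x := mcot r * _; set y := r * _; set z := 4 * _ * _; set E := _ + 72 * _ => main err.
clear - main err; lra.
Qed.

End PolygonLowerBound.

(** * Primitives of integrable functions on the unit interval *)

Section PrimitiveOnUnitInterval.
Context {R : realType}.
Notation mu := (@lebesgue_measure R).
Implicit Types (f g : R -> R) (s t : R).

Definition int01 f := mu.-integrable `[0, 1] (EFin \o f).
Definition prim f s : R := \int[mu]_(r in `[0, s]) f r.

Lemma int01_sub f s : int01 f -> s <= 1 -> mu.-integrable `[0, s] (EFin \o f).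
Proof.
move=> fi s1; apply: integrableS fi => //.
by apply: subset_itvl; rewrite bnd_simp.
Qed.

Lemma int01D f g : int01 f -> int01 g -> int01 (fun r => f r + g r).
Proof. by move=> fi gi; exact: (integrableD _ fi gi). Qed.

Lemma int01Z c f : int01 f -> int01 (fun r => c * f r).
Proof. by move=> fi; exact: (integrableZl _ c fi). Qed.

Lemma primD f g s : int01 f -> int01 g -> s <= 1 ->
  prim (fun r => f r + g r) s = prim f s + prim g s.
Proof. by move=> fi gi s1; rewrite /prim RintegralD //; exact: int01_sub. Qed.

Lemma primZ c f s : int01 f -> s <= 1 -> prim (fun r => c * f r) s = c * prim f s.
Proof. by move=> fi s1; rewrite /prim RintegralZl //; exact: int01_sub. Qed.

Lemma prim0 f : prim f 0 = 0.
Proof. by rewrite /prim set_itv1 Rintegral_set1. Qed.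

Lemma primB f s t : int01 f -> 0 <= s -> s <= t -> t <= 1 ->
  prim f t - prim f s = \int[mu]_(r in `]s, t]) f r.
Proof.
move=> fi s0 st t1; apply: Rintegral_itvB; rewrite ?bnd_simp //.
exact: int01_sub.
Qed.

Lemma prim_le f g s t : int01 f -> int01 g -> 0 <= s -> s <= t -> t <= 1 ->
  (forall r, s <= r <= t -> f r <= g r) -> prim f t - prim f s <= prim g t - prim g s.
Proof.
move=> fi gi s0 st t1 fg; rewrite !primB //; apply: le_Rintegral => //.
- by apply: integrableS fi => // x /=; rewrite !in_itv /= => /andP[sx xt]; rewrite (le_trans s0 (ltW sx)) (le_trans xt t1).
- by apply: integrableS gi => // x /=; rewrite !in_itv /= => /andP[sx xt]; rewrite (le_trans s0 (ltW sx)) (le_trans xt t1).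
- by move=> x /=; rewrite in_itv /= => /andP[sx xt]; apply: fg; rewrite (ltW sx).
Qed.

Lemma prim_continuous f : int01 f -> {within `[0, 1], continuous (prim f)}.
Proof. by move=> fi; apply: parameterized_integral_continuous. Qed.

(** The primitive is continuous on a compact interval, hence bounded there. *)
Lemma int01_mul_prim f g : int01 f -> int01 g -> int01 (fun r => f r * prim g r).
Proof.
move=> fi gi; have cg := prim_continuous gi.
apply: (integrableMl _ fi) => //.
  exact: subspace_continuous_measurable_fun.
have cp : compact (prim g @` `[0, 1]).
  by apply: continuous_compact => //; exact: segment_compact.
have [M [Mr hM]] := compact_bounded cp.
exists M; split => // x Mx y /= hy; apply: (hM x Mx (prim g y)); exists y => //.
Qed.

Lemma int01_norm3 (f1 f2 f3 : R -> R) : int01 f1 -> int01 f2 -> int01 f3 ->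
  int01 (fun r => Num.sqrt (f1 r ^+ 2 + f2 r ^+ 2 + f3 r ^+ 2)).
Proof.
move=> i1 i2 i3.
have m f : int01 f -> measurable_fun (`[0, 1]%classic : set R) f.
  by move=> /integrableP[mf _]; apply/measurable_EFinP.
have big : int01 (fun r => `|f1 r| + `|f2 r| + `|f3 r|).
  by apply: int01D; [apply: int01D|]; exact: integrable_norm.
apply: (le_integrable _ _ _ big) => //.
  apply/measurable_EFinP; apply: (measurableT_comp (f := @Num.sqrt R)).
    by apply: continuous_measurable_fun; exact: sqrt_continuous.
  by apply: measurable_funD; [apply: measurable_funD|]; apply: measurable_funX; exact: m.
move=> x _ /=; rewrite lee_fin ger0_norm ?sqrtr_ge0 // ger0_norm ?addr_ge0 //.
rewrite -(ler_pXn2r (_ : (0 < 2)%N)) ?nnegrE ?sqrtr_ge0 ?addr_ge0 // sqr_sqrtr ?addr_ge0 ?sqr_ge0 //.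
rewrite -(real_normK (num_real (f1 x))) -(real_normK (num_real (f2 x))) -(real_normK (num_real (f3 x))).
have [[? ?] ?] := (normr_ge0 (f1 x), normr_ge0 (f2 x), normr_ge0 (f3 x)); nra.
Qed.

End PrimitiveOnUnitInterval.

(** * Inscribed polygons with vertices at equal arc length *)

Section InscribedPolygon.
Context {R : realType}.

Definition speed (h1 h2 h3 : R -> R) r : R := Num.sqrt (h1 r ^+ 2 + h2 r ^+ 2 + h3 r ^+ 2).
(** Minus the usual signed area swept by the plane curve of velocity [(f, g)]; the sign is that of
    [U], so the components of [curve_t] are of this form. *)
Definition area (f g : R -> R) s : R := prim (fun r => 2^-1 * (f r * prim g r + - g r * prim f r)) s.

Variables (h1 h2 h3 : R -> R).
Hypotheses (i1 : int01 h1) (i2 : int01 h2) (i3 : int01 h3).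

Local Notation spd := (speed h1 h2 h3).
Local Notation len := (prim spd).

Let speed_int01 : int01 spd. Proof. exact: int01_norm3. Qed.

Lemma dot_le_speed (w1 w2 w3 r : R) :
  w1 * h1 r + w2 * h2 r + w3 * h3 r <= Num.sqrt (w1 ^+ 2 + w2 ^+ 2 + w3 ^+ 2) * spd r.
Proof.
apply: le_trans (ler_norm _) _.
have a0 (x y z : R) : 0 <= x ^+ 2 + y ^+ 2 + z ^+ 2 by rewrite !addr_ge0 ?sqr_ge0.
rewrite -(ler_pXn2r (_ : (0 < 2)%N)) ?nnegrE ?mulr_ge0 ?sqrtr_ge0 //.
rewrite real_normK ?num_real // exprMn !sqr_sqrtr ?a0 //.
rewrite -subr_ge0 [leRHS](_ : _ = (w1 * h2 r - w2 * h1 r) ^+ 2 + (w1 * h3 r - w3 * h1 r) ^+ 2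
  + (w2 * h3 r - w3 * h2 r) ^+ 2); last by ring.
exact: a0.
Qed.

(** Integrating the scalar product of the velocity with the chord itself gives
    [W <= sqrt W * (len t - len s)], where [W] is the squared chord. *)
Lemma chord_le_len s t : 0 <= s -> s <= t -> t <= 1 ->
  (prim h1 t - prim h1 s) ^+ 2 + (prim h2 t - prim h2 s) ^+ 2 + (prim h3 t - prim h3 s) ^+ 2 <=
  (len t - len s) ^+ 2.
Proof.
move=> s0 st t1; have s1 := le_trans st t1.
set w1 := prim h1 t - _; set w2 := prim h2 t - _; set w3 := prim h3 t - _.
set W := w1 ^+ 2 + _ + _; have W0 : 0 <= W by rewrite !addr_ge0 ?sqr_ge0.
have : prim (fun r => w1 * h1 r + w2 * h2 r + w3 * h3 r) t -
       prim (fun r => w1 * h1 r + w2 * h2 r + w3 * h3 r) s <=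
       prim (fun r => Num.sqrt W * spd r) t - prim (fun r => Num.sqrt W * spd r) s.
  apply: prim_le => //; last by move=> r _; exact: dot_le_speed.
    by apply: int01D; [apply: int01D|]; exact: int01Z.
  exact: int01Z.
rewrite !primD ?primZ //; try (apply: int01D); try exact: int01Z.
move=> h.
have {}h : W <= Num.sqrt W * (len t - len s) by rewrite /W !expr2 /w1 /w2 /w3 in h *; lra.
have sq : Num.sqrt W ^+ 2 = W by rewrite sqr_sqrtr.
have l0 : 0 <= len t - len s.
  have : prim (fun r => 0 * h1 r) t - prim (fun r => 0 * h1 r) s <= len t - len s.
    by apply: prim_le => // [|r _]; [exact: int01Z | rewrite mul0r sqrtr_ge0].
  by rewrite !primZ // !mul0r subrr.
have sW := sqrtr_ge0 W.
rewrite -sq ler_pXn2r ?nnegrE //.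
have [->//|Wn] := eqVneq (Num.sqrt W) 0.
by rewrite -(ler_pM2l (_ : 0 < Num.sqrt W)) ?lt_neqAle ?[0 == _]eq_sym ?Wn // -expr2 sq.
Qed.

Lemma len_nondecreasing s t : 0 <= s -> s <= t -> t <= 1 -> len s <= len t.
Proof.
move=> s0 st t1; have s1 := le_trans st t1; rewrite -subr_ge0.
have : prim (fun r => 0 * h1 r) t - prim (fun r => 0 * h1 r) s <= len t - len s.
  by apply: prim_le => // [|r _]; [exact: int01Z | rewrite mul0r sqrtr_ge0].
by rewrite !primZ // !mul0r subrr.
Qed.

Let is_component f := f = h1 \/ f = h2 \/ f = h3.

Let component_int01 f : is_component f -> int01 f.
Proof. by case=> [|[]] ->. Qed.

Let component_le f r : is_component f -> `|f r| <= spd r.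
Proof.
have [[? ?] ?] := (sqr_ge0 (h1 r), sqr_ge0 (h2 r), sqr_ge0 (h3 r)).
by move=> fc; rewrite -sqrtr_sqr ler_sqrt ?addr_ge0 //; case: fc => [|[]] ->; lra.
Qed.

Let component_chord f s t : is_component f -> 0 <= s -> s <= t -> t <= 1 ->
  `|prim f t - prim f s| <= len t - len s.
Proof.
move=> fc s0 st t1; have l0 : 0 <= len t - len s by rewrite subr_ge0 len_nondecreasing.
rewrite -(ler_pXn2r (_ : (0 < 2)%N)) ?nnegrE // real_normK ?num_real //.
apply: le_trans (chord_le_len s0 st t1).
set a := (prim h1 t - _) ^+ 2; set b := (prim h2 t - _) ^+ 2; set c := (prim h3 t - _) ^+ 2.
have [[? ?] ?] : (0 <= a) * (0 <= b) * (0 <= c) by rewrite !sqr_ge0.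
case: fc => [|[]] ->; rewrite -/a -/b -/c; lra.
Qed.

(** Freezing the primitives in the integrand at [s] gives exactly the triangle term. What remains is
    velocity times a chord from [s], and such a chord is at most [d]. *)
Lemma area_step f g s t d : is_component f -> is_component g -> 0 <= s -> s <= t -> t <= 1 ->
  len t - len s <= d ->
  `|area f g t - area f g s - 2^-1 * (prim f t * prim g s - prim g t * prim f s)| <=
     d * (len t - len s).
Proof.
move=> fc gc s0 st t1 hd; have s1 := le_trans st t1.
have fi := component_int01 fc; have gi := component_int01 gc.
have ai : int01 (fun r => 2^-1 * (f r * prim g r + - g r * prim f r)).
  apply: int01Z; apply: int01D; first exact: int01_mul_prim.
  apply: int01_mul_prim => //; have := int01Z (-1) gi.
  by congr (int01 _); apply/funext => r; rewrite mulN1r.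
pose F e r := (2^-1 * prim g s) * f r + (- (2^-1 * prim f s)) * g r + e * spd r.
have Fi e : int01 (F e) by apply: int01D; [apply: int01D|]; exact: int01Z.
have FE e : prim (F e) t - prim (F e) s =
   2^-1 * (prim f t * prim g s - prim g t * prim f s) + e * (len t - len s).
  rewrite /F !primD ?primZ //; try (apply: int01D); try exact: int01Z.
  by ring.
have key r : s <= r <= t -> `|2^-1 * (f r * prim g r + - g r * prim f r) - F 0 r| <= d * spd r.
  move=> /andP[sr rt]; have r1 := le_trans rt t1.
  have hl : len r - len s <= d.
    apply: le_trans hd; rewrite lerD2r; apply: len_nondecreasing => //; exact: le_trans sr.
  have cf := component_chord fc s0 sr r1; have cg := component_chord gc s0 sr r1.
  have lf := component_le r fc; have lg := component_le r gc.
  have -> : 2^-1 * (f r * prim g r + - g r * prim f r) - F 0 r =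
     2^-1 * (f r * (prim g r - prim g s)) - 2^-1 * (g r * (prim f r - prim f s)) by rewrite /F; ring.
  apply: le_trans (ler_normB _ _) _; rewrite !normrM gtr0_norm ?invr_gt0 //.
  have : `|f r| * `|prim g r - prim g s| <= spd r * d by apply: ler_pM => //; exact: le_trans hl.
  have : `|g r| * `|prim f r - prim f s| <= spd r * d by apply: ler_pM => //; exact: le_trans hl.
  lra.
have up := prim_le ai (Fi d) s0 st t1; have lo := prim_le (Fi (- d)) ai s0 st t1.
rewrite !FE in up lo; rewrite -/(area f g t) -/(area f g s) in up lo.
rewrite ler_norml; apply/andP; split.
  rewrite lerBrDl -[- (d * _)]mulNr; apply: lo => r /key; rewrite ler_norml => /andP[h _].
  by move: h; rewrite /F; lra.
rewrite lerBlDl; apply: up => r /key; rewrite ler_norml => /andP[_ h].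
by move: h; rewrite /F; lra.
Qed.

(** The intermediate value theorem for the arc length. The two ends are imposed separately, since
    [len] may be constant near [0] or [1]. *)
Lemma len_cut N : (0 < N)%N -> 0 < len 1 -> exists s : nat -> R,
  [/\ s 0%N = 0, s N = 1, forall k, (k <= N)%N -> 0 <= s k <= 1 &
   forall k, (k <= N)%N -> len (s k) = k%:R / N%:R * len 1].
Proof.
move=> N0 L0; have Np : 0 < N%:R :> R by rewrite ltr0n.
(* The condition [k <= N] stands under the quantifier so that [choice] returns a total sequence. *)
have ex k : exists s, (k <= N)%N -> [/\ k = 0%N -> s = 0, k = N -> s = 1, 0 <= s <= 1 &
    len s = k%:R / N%:R * len 1].
  have [kN|kN] := leqP k N; last by exists 0.
  have [k0|k0] := eqVneq k 0%N.
    exists 0 => _; split => //; rewrite ?lexx ?ler01 //.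
      by move=> kNe; move: N0; rewrite -kNe k0.
    by rewrite prim0 k0 !mul0r.
  have [kNe|kNe] := eqVneq k N.
    exists 1 => _; split => //; rewrite ?lexx ?ler01 //; first by move=> k0'; rewrite k0' in k0.
    by rewrite kNe divff ?mul1r // gt_eqF.
  have q0 : 0 <= k%:R / N%:R :> R by rewrite divr_ge0.
  have q1 : k%:R / N%:R <= 1 :> R by rewrite ler_pdivrMr // mul1r ler_nat.
  have [||s] := @IVT R len 0 1 (k%:R / N%:R * len 1) ler01.
  - exact: prim_continuous.
  - have -> : len 0 = 0 by rewrite prim0.
    by rewrite ge_min le_max; apply/andP; split; apply/orP; [left; rewrite mulr_ge0 // ltW | right; rewrite ler_piMl // ltW].
  rewrite in_itv /= => s01 ls; exists s => _; split => //.
    by move=> k0'; rewrite k0' in k0.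
  by move=> kNe'; rewrite kNe' eqxx in kNe.
have [s hs] := choice ex.
exists s; split.
- by have [] := hs 0%N (leq0n _) => -> .
- by have [_ -> ] := hs N (leqnn _).
- by move=> k kN; have [_ _] := hs k kN.
- by move=> k kN; have [_ _] := hs k kN.
Qed.

(** Each of the [N] edges has squared length at most [(L / N)^2], with [L] the length of the curve,
    and contributes at most the same amount to the area error. *)
Lemma inscribed_polygon N : (0 < N)%N -> 0 < len 1 -> exists P1 P2 P3 : nat -> R,
  [/\ [/\ P1 0%N = 0, P2 0%N = 0 & P3 0%N = 0],
      [/\ P1 N = prim h1 1, P2 N = prim h2 1 & P3 N = prim h3 1],
      N%:R * \sum_(k < N) ((P1 k.+1 - P1 k) ^+ 2 + (P2 k.+1 - P2 k) ^+ 2 + (P3 k.+1 - P3 k) ^+ 2)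
        <= len 1 ^+ 2 &
      [/\ `|- (2^-1 * \sum_(k < N) (P2 k * P3 k.+1 - P3 k * P2 k.+1)) - area h2 h3 1| <= len 1 ^+ 2 / N%:R,
          `|- (2^-1 * \sum_(k < N) (P3 k * P1 k.+1 - P1 k * P3 k.+1)) - area h3 h1 1| <= len 1 ^+ 2 / N%:R &
          `|- (2^-1 * \sum_(k < N) (P1 k * P2 k.+1 - P2 k * P1 k.+1)) - area h1 h2 1| <= len 1 ^+ 2 / N%:R]].
Proof.
move=> N0 L0; have Np : 0 < N%:R :> R by rewrite ltr0n.
have [s [s0 sN s01 sl]] := len_cut N0 L0.
have dl (k : 'I_N) : len (s k.+1) - len (s k) = len 1 / N%:R.
  rewrite !sl ?(ltnW (ltn_ord k)) // -natr1; field; rewrite gt_eqF //.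
have ss (k : 'I_N) : s k <= s k.+1.
  rewrite leNgt; apply/negP => h; have /andP[a0 a1] := s01 k (ltnW (ltn_ord k)).
  have /andP[b0 b1] := s01 k.+1 (ltn_ord k).
  have := len_nondecreasing b0 (ltW h) a1; have := dl k.
  have : 0 < len 1 / N%:R by rewrite divr_gt0.
  lra.
have b (k : 'I_N) : [/\ 0 <= s k, s k <= s k.+1 & s k.+1 <= 1].
  have /andP[a0 a1] := s01 k (ltnW (ltn_ord k)); have /andP[b0 b1] := s01 k.+1 (ltn_ord k).
  by split => //; exact: ss.
have area_bound f g : is_component f -> is_component g ->
  `|- (2^-1 * \sum_(k < N) (prim f (s k) * prim g (s k.+1) - prim g (s k) * prim f (s k.+1))) - area f g 1| <=
   len 1 ^+ 2 / N%:R.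
  move=> fc gc.
  have -> : area f g 1 = \sum_(k < N) (area f g (s k.+1) - area f g (s k)).
    rewrite -(big_mkord xpredT (fun k => area f g (s k.+1) - area f g (s k))).
    by rewrite (telescope_sumr (fun k => area f g (s k))) // sN s0 /area prim0 subr0.
  rewrite mulr_sumr -sumrN -sumrB; apply: le_trans (ler_norm_sum _ _ _) _.
  apply: (@le_trans _ _ (\sum_(k < N) (len 1 / N%:R * (len 1 / N%:R)))).
    apply: ler_sum => k _; have [k0 kk k1] := b k.
    rewrite -{2}(dl k) -normrN; apply: le_trans (area_step fc gc k0 kk k1 _); last by rewrite dl.
    by rewrite le_eqVlt; apply/orP; left; apply/eqP; congr `|_|; ring.
  by rewrite sumr_const card_ord -mulr_natl le_eqVlt; apply/orP; left; apply/eqP; field; rewrite gt_eqF.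
have [c1 c2 c3] : [/\ is_component h1, is_component h2 & is_component h3].
  by split; [left | right; left | right; right].
exists (prim h1 \o s), (prim h2 \o s), (prim h3 \o s); split => /=.
- by rewrite s0 !prim0.
- by rewrite sN.
- apply: (@le_trans _ _ (N%:R * \sum_(k < N) (len 1 / N%:R) ^+ 2)).
    rewrite ler_pM2l //; apply: ler_sum => k _; have [k0 kk k1] := b k.
    by rewrite -(dl k); exact: chord_le_len.
  by rewrite sumr_const card_ord -mulr_natl le_eqVlt; apply/orP; left; apply/eqP; field; rewrite gt_eqF.
- by split; apply: area_bound.
Qed.

End InscribedPolygon.

(** * From polygons to curves *)

Section CurveLowerBound.
Context {R : realType}.

Lemma norm3_row (f : 'I_3 -> R) :
  norm3 (\row_i f i) = Num.sqrt (f 0 ^+ 2 + f 1 ^+ 2 + f 2 ^+ 2).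
Proof.
rewrite /norm3 /dot3 !big_ord_recl big_ord0 !mxE addr0 addrA !expr2.
by congr (Num.sqrt (_ + f _ * f _ + f _ * f _)); exact/val_inj.
Qed.

Lemma UformE (x : 'rV[R]_3) (f : 'I_3 -> R) :
  [/\ Uform 0 x (\row_i f i) = f 1 * x 0 2 + - f 2 * x 0 1,
      Uform 1 x (\row_i f i) = f 2 * x 0 0 + - f 0 * x 0 2 &
      Uform 2 x (\row_i f i) = f 0 * x 0 1 + - f 1 * x 0 0].
Proof.
have e1 : lift ord0 ord0 = 1 :> 'I_3 by exact/val_inj.
have e2 : lift ord0 (lift ord0 ord0) = 2 :> 'I_3 by exact/val_inj.
by split; rewrite /Uform /dot3 !big_ord_recl !big_ord0 !mxE !big_ord_recl !big_ord0 !mxE /= ?e1 ?e2; ring.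
Qed.

Lemma vec3E (a b c : R) : [/\ vec3 a b c 0 0 = a, vec3 a b c 0 1 = b & vec3 a b c 0 2 = c].
Proof. by split; rewrite mxE. Qed.

Lemma curve_xE (h : 'I_3 -> R -> R) s i : curve_x h s 0 i = prim (h i) s.
Proof. by rewrite mxE. Qed.

Lemma curve_tE (h : 'I_3 -> R -> R) s :
  [/\ curve_t h s 0 0 = area (h 1) (h 2) s, curve_t h s 0 1 = area (h 2) (h 0) s &
      curve_t h s 0 2 = area (h 0) (h 1) s].
Proof.
split; rewrite mxE; apply: eq_Rintegral => r _; congr (_ * _).
- by have [-> _ _] := UformE (curve_x h r) (h ^~ r); rewrite !curve_xE.
- by have [_ -> _] := UformE (curve_x h r) (h ^~ r); rewrite !curve_xE.
- by have [_ _ ->] := UformE (curve_x h r) (h ^~ r); rewrite !curve_xE.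
Qed.

Lemma curve_lengthE (h : 'I_3 -> R -> R) : curve_length h = prim (speed (h 0) (h 1) (h 2)) 1.
Proof. by apply: eq_Rintegral => r _; rewrite norm3_row. Qed.

(** The limit of large [N]: since [1 / N <= 1], the error is at most [(864 (C + 3 E) + 72 E) / N],
    with [864 = 4 * 216]. *)
Lemma vanishing_error (A B C E : R) : 0 <= C -> 0 <= E ->
  (forall N, (5 < N)%N ->
     A <= B + (4 * (216 / N%:R ^+ 2) * (C + 3 * (E / N%:R)) + 72 * (E / N%:R))) ->
  A <= B.
Proof.
move=> C0 E0 H; rewrite leNgt; apply/negP => BA.
pose Q := (864 * (C + 3 * E) + 72 * E) / (A - B).
have den0 : 0 < A - B by rewrite subr_gt0.
(* Six more than the integer part, so that [N] exceeds both [Q] and [5]. *)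
pose N := (Num.Def.truncn Q).+1.+1.+4.
have QN : Q < N%:R.
  by apply: lt_le_trans (truncnS_gt Q) _; rewrite ler_nat /N; do 5 apply: leqW.
have {H} := H N isT.
have : 1 <= N%:R :> R by rewrite ler1n.
move: QN; rewrite /Q; move: (N%:R : R) => n Qn n1.
have n0 : 0 < n by lra.
rewrite ltr_pdivrMr // in Qn.
have i1 : n^-1 <= 1 by rewrite invf_le1.
have i0 : 0 < n^-1 by rewrite invr_gt0.
have ni : n * n^-1 = 1 by rewrite divff // gt_eqF.
rewrite -exprVn; set q := n^-1 in i1 i0 ni *.
have : (864 * (C + 3 * E) + 72 * E) * q < A - B.
  by rewrite -(ltr_pM2l n0) mulrCA ni mulr1.
have : 864 * q ^+ 2 * (C + 3 * (E * q)) <= 864 * q * (C + 3 * E).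
  have Eq : E * q <= E by rewrite ler_piMr.
  have Eq0 : 0 <= E * q by rewrite mulr_ge0 // ltW.
  have qq : q ^+ 2 <= q by rewrite expr2 ler_piMr // ltW.
  by apply: ler_pM; rewrite ?mulr_ge0 ?sqr_ge0 //; lra.
lra.
Qed.

(** [polygon_lower_bound] for the inscribed polygons, with [eta = L^2 / N], followed by the limit in
    [N]. *)
Lemma curve_lower_bound (rho rs u1 u2 : R) (h : 'I_3 -> R -> R) :
  0 < rho -> 0 <= u1 -> 0 <= u2 -> pi < rs <= theta1 R -> 2 * rho ^+ 2 <= pi ^+ 2 ->
  u1 = rho ^+ 2 * (psi'_over rs * Num.sqrt (rs ^+ 2 - rho ^+ 2)) ->
  (forall i, int01 (h i)) -> curve_x h 1 = e1 R -> curve_t h 1 = 4^-1 *: vec3 u1 u2 0 ->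
  1 + mcot rs * (rho ^+ 2 / rs ^+ 2) + u1 * Num.sqrt (rs ^+ 2 - rho ^+ 2) - u2 * rho <=
    curve_length h ^+ 2.
Proof.
move=> rho0 u10 u20 rsi rho2 u1E hi hx ht; rewrite curve_lengthE.
have X i : prim (h i) 1 = e1 R 0 i by rewrite -hx curve_xE.
have [v0 v1 v2] := vec3E 1 (0 : R) 0.
have X0 : prim (h 0) 1 = 1 by rewrite X v0.
have X1 : prim (h 1) 1 = 0 by rewrite X v1.
have X2 : prim (h 2) 1 = 0 by rewrite X v2.
have [w0 w1 w2] := vec3E u1 u2 0.
have [T0 T1 T2] := curve_tE h 1.
have A0 : area (h 1) (h 2) 1 = 4^-1 * u1 by rewrite -T0 ht mxE w0.
have A1 : area (h 2) (h 0) 1 = 4^-1 * u2 by rewrite -T1 ht mxE w1.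
have A2 : area (h 0) (h 1) 1 = 0 by rewrite -T2 ht mxE w2 mulr0.
set L := prim _ 1.
(* The chord from [0] to [e1] has length one; this also makes [L] positive, as the cutting by arc
   length requires. *)
have L1 : 1 <= L ^+ 2.
  have := chord_le_len (hi 0) (hi 1) (hi 2) (lexx 0) ler01 (lexx 1).
  by rewrite !prim0 !subr0 X0 X1 X2 expr1n expr0n !addr0.
have L0 : 0 < L.
  have : 0 <= L by have := len_nondecreasing (hi 0) (hi 1) (hi 2) (lexx 0) ler01 (lexx 1); rewrite prim0.
  rewrite le_eqVlt => /predU1P[Le|//].
  by move: L1; rewrite -Le expr0n /= ler10.
apply: (@vanishing_error _ _ (u1 + u2) (L ^+ 2)); rewrite ?addr_ge0 ?sqr_ge0 // => N N5.
have N0 : (0 < N)%N by apply: leq_ltn_trans N5.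
have [P1 [P2 [P3 [[p10 p20 p30] [p1N p2N p3N] E [a1 a2 a3]]]]] :=
  inscribed_polygon (hi 0) (hi 1) (hi 2) N0 L0.
rewrite X0 in p1N; rewrite X1 in p2N; rewrite X2 in p3N.
rewrite -/L in E a1 a2 a3; rewrite A0 in a1; rewrite A1 in a2; rewrite A2 subr0 in a3.
exact: (polygon_lower_bound rho0 u10 u20 rsi rho2 u1E N5 p10 p20 p30 p1N p2N p3N
  erefl erefl erefl E a1 a2 a3).
Qed.

End CurveLowerBound.

(** * The helix *)

Section Helix.
Context {R : realType}.

Lemma cont_int01 (f : R -> R) : (forall x, cont_at f x) -> int01 f.
Proof.
move=> cf; apply: continuous_compact_integrable; first exact: segment_compact.
exact: continuous_subspaceT.
Qed.

Lemma prim_der (F f : R -> R) s : 0 <= s -> (forall x, cont_at f x) ->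
  (forall x, der_at F (f x) x) -> prim f s = F s - F 0.
Proof.
rewrite le_eqVlt => /predU1P[<-|s0] cf dF; first by rewrite prim0 subrr.
have cF x : cont_at F x by exact: der_cont (dF x).
have := @continuous_FTC2 R f F 0 s s0.
rewrite /prim /Rintegral => ->.
- by [].
- exact: continuous_subspaceT.
- split; first by move=> x _; exact: (@ex_derive _ _ _ _ _ _ _ (dF x)).
    by apply: cvg_at_right_filter; exact: cF.
  by apply: cvg_at_left_filter; exact: cF.
- by move=> x _; rewrite derive1E; apply: derive_val; exact: dF.
Qed.

Variables (r c s : R).
Let a x := x * (2 * r) - r.
Let D := (2 * sin r)^-1.

(** The axis is [n = (c, - s, 0)]. The constant part is the projection [c n] of [e1] to the axis;
    the rest rotates with angular velocity [2 r] in the plane spanned by [(s, c, 0)] and the third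
    basis vector. *)
Definition helix_velocity (i : 'I_3) (x : R) : R :=
  if i == 0 :> nat then c ^+ 2 + s ^+ 2 * (2 * r / (2 * sin r) * cos (x * (2 * r) - r))
  else if i == 1 :> nat then c * s * (2 * r / (2 * sin r) * cos (x * (2 * r) - r) - 1)
  else - s * (2 * r / (2 * sin r) * sin (x * (2 * r) - r)).

Hypotheses (r0 : r != 0) (sr0 : sin r != 0) (cs : c ^+ 2 + s ^+ 2 = 1).

Let h0 x := c ^+ 2 + s ^+ 2 * (2 * r * D * cos (a x)).
Let h1 x := c * s * (2 * r * D * cos (a x) - 1).
Let h2 x := - s * (2 * r * D * sin (a x)).

Let X0 x := c ^+ 2 * x + s ^+ 2 * (D * (sin (a x) + sin r)).
Let X1 x := c * s * (D * (sin (a x) + sin r) - x).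
Let X2 x := s * (D * (cos (a x) - cos r)).

Let ch0 x : cont_at h0 x. Proof. by rewrite /h0 /a; continuity. Qed.
Let ch1 x : cont_at h1 x. Proof. by rewrite /h1 /a; continuity. Qed.
Let ch2 x : cont_at h2 x. Proof. by rewrite /h2 /a; continuity. Qed.

Let a0 : a 0 = - r. Proof. by rewrite /a mul0r sub0r. Qed.
Let a1 : a 1 = r. Proof. by rewrite /a; ring. Qed.

Let primh0 x : 0 <= x -> prim h0 x = X0 x.
Proof.
move=> x0; rewrite (@prim_der X0 h0) //; last first.
  move=> y; rewrite /X0 /a; eapply der_eq; first by derive_at.
  by rewrite /h0 /a; ring.
by rewrite /X0 a0 sinN; ring.
Qed.

Let primh1 x : 0 <= x -> prim h1 x = X1 x.
Proof.
move=> x0; rewrite (@prim_der X1 h1) //; last first.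
  move=> y; rewrite /X1 /a; eapply der_eq; first by derive_at.
  by rewrite /h1 /a; ring.
by rewrite /X1 a0 sinN; ring.
Qed.

Let primh2 x : 0 <= x -> prim h2 x = X2 x.
Proof.
move=> x0; rewrite (@prim_der X2 h2) //; last first.
  move=> y; rewrite /X2 /a; eapply der_eq; first by derive_at.
  by rewrite /h2 /a; ring.
by rewrite /X2 a0 cosN; ring.
Qed.

(** Blocks of the explicit antiderivatives below: [Iz] is a primitive of [Z], [Ix] one of
    [D * (sin (a x) + sin r)], and [J] one of the area form of the circle without the factor 1/2. *)
Let Iz x := D * (sin (a x) / (2 * r) - x * cos r).
Let Z x := D * (cos (a x) - cos r).
Let J x := 2 * r * D ^+ 2 * (x - sin (a x + r) / (2 * r)).
Let Ix x := D * (x * sin r - cos (a x) / (2 * r)).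

Let area_by (F f g Xf Xg : R -> R) : (forall x, 0 <= x -> prim f x = Xf x) -> (forall x, 0 <= x -> prim g x = Xg x) ->
  (forall x, cont_at (fun y => 2^-1 * (f y * Xg y + - g y * Xf y)) x) ->
  (forall x, der_at F (2^-1 * (f x * Xg x + - g x * Xf x)) x) -> area f g 1 = F 1 - F 0.
Proof.
move=> pf pg cF dF; rewrite /area -(prim_der ler01 cF dF).
apply: eq_Rintegral => x; rewrite inE /= in_itv /= => /andP[x0 _].
by rewrite pf ?pg.
Qed.

Let m := mcot r.
(** [cos r] is eliminated in favour of [m], so that [r^2 / sin^2 r] becomes [(m + 1)^2 + r^2]. *)
Let cotE : cos r = (m + 1) * sin r / r.
Proof. by rewrite /m /mcot /cot; field; rewrite r0. Qed.
Let trig2 : (m + 1) ^+ 2 * sin r ^+ 2 = r ^+ 2 * (1 - sin r ^+ 2).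
Proof.
have := cos2Dsin2 r; rewrite cotE => e.
have -> : 1 - sin r ^+ 2 = ((m + 1) * sin r / r) ^+ 2 by lra.
by field.
Qed.

(** In the antiderivative, [x Z - 2 Iz] comes from integrating by parts the products of the axial
    and the circular motion, and [J] from the circular motion alone. *)
Let helix_area12 : area h1 h2 1 = c * s ^+ 2 * (r ^+ 2 + m ^+ 2 + 3 * m) / (4 * r).
Proof.
rewrite (@area_by (fun x => 2^-1 * (c * s ^+ 2) * (x * Z x - 2 * Iz x + J x)) _ _ X1 X2) //.
- rewrite /J /Z /Iz a0 a1 addNr sinN cosN sin0 sinD cotE /D.
  have e : sin r ^+ 2 * ((m + 1) ^+ 2 + r ^+ 2) = r ^+ 2 by rewrite mulrDr mulrC trig2; ring.
  have -> : r ^+ 2 + m ^+ 2 + 3 * m = ((m + 1) ^+ 2 + r ^+ 2) + m - 1 by ring.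
  have -> : (m + 1) ^+ 2 + r ^+ 2 = r ^+ 2 / sin r ^+ 2.
    by apply: (mulfI (expf_neq0 2 sr0)); rewrite e; field.
  by field; rewrite r0.
- by move=> x; rewrite /h1 /h2 /X1 /X2 /a; continuity.
- move=> x; rewrite /Z /Iz /J /a; eapply der_eq; first by derive_at.
  rewrite /h1 /h2 /X1 /X2 -/(a x) /=; move: (a x) => y.
  have e := sin2cos2 y; rewrite cosD /D; field: e; rewrite r0 sr0 //.
Qed.

Let helix_area20 : area h2 h0 1 = s * (2 * m - s ^+ 2 * (r ^+ 2 + m ^+ 2 + 3 * m)) / (4 * r).
Proof.
rewrite (@area_by (fun x => 2^-1 * s * (c ^+ 2 * (x * Z x - 2 * Iz x) - s ^+ 2 * J x)) _ _ X2 X0) //.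
- rewrite /J /Z /Iz a0 a1 addNr sinN cosN sin0 sinD cotE /D.
  have e : sin r ^+ 2 * ((m + 1) ^+ 2 + r ^+ 2) = r ^+ 2 by rewrite mulrDr mulrC trig2; ring.
  have -> : r ^+ 2 + m ^+ 2 + 3 * m = ((m + 1) ^+ 2 + r ^+ 2) + m - 1 by ring.
  have -> : (m + 1) ^+ 2 + r ^+ 2 = r ^+ 2 / sin r ^+ 2.
    by apply: (mulfI (expf_neq0 2 sr0)); rewrite e; field.
  have -> : c ^+ 2 = 1 - s ^+ 2 by rewrite -cs; ring.
  by field; rewrite r0.
- by move=> x; rewrite /h0 /h2 /X0 /X2 /a; continuity.
- move=> x; rewrite /Z /Iz /J /a; eapply der_eq; first by derive_at.
  rewrite /h0 /h2 /X0 /X2 -/(a x) /=; move: (a x) => y.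
  have e := sin2cos2 y; rewrite cosD /D; field: e; rewrite r0 sr0 //.
Qed.

Let helix_area01 : area h0 h1 1 = 0.
Proof.
rewrite (@area_by (fun x => 2^-1 * (c * s) * (2 * Ix x - x * (D * (sin (a x) + sin r)))) _ _ X0 X1) //.
- by rewrite /Ix a0 a1 sinN cosN /D; field; rewrite r0 sr0.
- by move=> x; rewrite /h0 /h1 /X0 /X1 /a; continuity.
- move=> x; rewrite /Ix /a; eapply der_eq; first by derive_at.
  rewrite /h0 /h1 /X0 /X1 -/(a x) /=; move: (a x) => y.
  have -> : c ^+ 2 = 1 - s ^+ 2 by rewrite -cs; ring.
  by rewrite /D; field; rewrite r0 sr0.
Qed.

Lemma helix_velocity_int01 i : int01 (helix_velocity i).
Proof.
apply: cont_int01 => x; case: i => -[|[|[|//]]] ?; rewrite /helix_velocity /=.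
- exact: ch0.
- exact: ch1.
- exact: ch2.
Qed.

Lemma helix_endpoint : curve_x helix_velocity 1 = e1 R.
Proof.
apply/rowP => -[[|[|[|//]]] i3]; rewrite curve_xE mxE /=.
- by rewrite (primh0 ler01) /X0 a1 -[RHS]cs /D; field.
- by rewrite (primh1 ler01) /X1 a1 /D; field.
- by rewrite (primh2 ler01) /X2 a1 /D; field.
Qed.

Lemma helix_area : curve_t helix_velocity 1 = 4^-1 *: vec3
    (c * s ^+ 2 * (r ^+ 2 + mcot r ^+ 2 + 3 * mcot r) / r)
    (s * (2 * mcot r - s ^+ 2 * (r ^+ 2 + mcot r ^+ 2 + 3 * mcot r)) / r) 0.
Proof.
have [T0 T1 T2] := curve_tE helix_velocity 1.
apply/rowP => -[[|[|[|//]]] i3].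
- rewrite (_ : Ordinal i3 = 0); last exact/val_inj.
  by rewrite T0 [RHS]mxE [vec3 _ _ _ _ _]mxE /= helix_area12 /m; field.
- rewrite (_ : Ordinal i3 = 1); last exact/val_inj.
  by rewrite T1 [RHS]mxE [vec3 _ _ _ _ _]mxE /= helix_area20 /m; field.
- rewrite (_ : Ordinal i3 = 2); last exact/val_inj.
  by rewrite T2 [RHS]mxE [vec3 _ _ _ _ _]mxE /= helix_area01 mulr0.
Qed.

(** The speed is constant, with square [c^2 + s^2 (r / sin r)^2]. *)
Lemma helix_length : curve_length helix_velocity ^+ 2 =
  1 + s ^+ 2 * (r ^+ 2 + mcot r ^+ 2 + 2 * mcot r).
Proof.
pose q : R := 1 + s ^+ 2 * (r ^+ 2 + mcot r ^+ 2 + 2 * mcot r).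
have e : sin r ^+ 2 * ((m + 1) ^+ 2 + r ^+ 2) = r ^+ 2 by rewrite mulrDr mulrC trig2; ring.
have qE : q = c ^+ 2 + (r / sin r) ^+ 2 * s ^+ 2.
  have -> : (r / sin r) ^+ 2 = (m + 1) ^+ 2 + r ^+ 2.
    by apply: (mulfI (expf_neq0 2 sr0)); rewrite e; field.
  have -> : c ^+ 2 = 1 - s ^+ 2 by rewrite -cs; ring.
  by rewrite /q /m; ring.
have q0 : 0 <= q by rewrite qE addr_ge0 ?sqr_ge0 // mulr_ge0 ?sqr_ge0.
have sp x : speed (helix_velocity 0) (helix_velocity 1) (helix_velocity 2) x = Num.sqrt q * 1.
  rewrite mulr1 /speed /helix_velocity /= qE; congr Num.sqrt.
  have c2 : c ^+ 2 = 1 - s ^+ 2 by rewrite -cs; ring.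
  have := sin2cos2 (x * (2 * r) - r); move: (x * (2 * r) - r) => y s2.
  by field: s2 c2.
rewrite curve_lengthE.
have -> : speed (helix_velocity 0) (helix_velocity 1) (helix_velocity 2) = fun=> Num.sqrt q * 1.
  by apply/funext.
rewrite (@prim_der (fun x => Num.sqrt q * x)) ?ler01 //.
- by rewrite mulr1 mulr0 subr0 sqr_sqrtr.
- by move=> x; exact: cont_cst.
- by move=> x; eapply der_eq; [derive_at | rewrite mulr0 addr0].
Qed.

End Helix.

(** * Surjectivity of [Lambda] *)

Section Surjectivity.
Context {R : realType}.
Implicit Types (r q u : R).

Definition mcot_over r : R := mcot r / r.

Lemma mcot_over_decreasing r t : pi < r -> r < t -> t <= theta1 R -> mcot_over t < mcot_over r.
Proof.
move=> pr rt tt; have p2 := pi_ge2 R; have [/andP[_ th2] _] := @theta1_spec R.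
have t0 : 0 < t by lra. have r0 : 0 < r by lra.
have mt : 0 <= mcot t by rewrite mcot_ge0 // tt (lt_trans pr).
have mr : mcot t < mcot r by rewrite mcot_decreasing // (le_lt_trans tt).
rewrite /mcot_over ltr_pdivrMr // mulrAC ltr_pdivlMr //; clear - pr rt mt mr p2 r0; nra.
Qed.

Lemma cont_mcot r : pi < r <= theta1 R -> cont_at mcot r.
Proof.
move=> /andP[pr rt]; have [/andP[_ th2] _] := @theta1_spec R.
by apply: der_cont (der_mcot _); rewrite pr (le_lt_trans rt).
Qed.

(** [mcot_over] is strictly decreasing and continuous on [[a, theta1]], so its inverse is
    continuous. The segment starts at [a > pi] because of the pole at [pi]. *)
Lemma mcot_over_inverse a : pi < a < theta1 R -> exists inv : R -> R,
  (forall y, 0 < y < mcot_over a -> [/\ a <= inv y, inv y < theta1 R, mcot_over (inv y) = y & cont_at inv y]).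
Proof.
move=> /andP[pa at_]; have p2 := pi_ge2 R.
have g1 : mcot_over (theta1 R) = 0 by rewrite /mcot_over mcot_theta1 mul0r.
have cg x : a <= x <= theta1 R -> cont_at mcot_over x.
  move=> /andP[ax xt]; have cm : cont_at mcot x by apply: cont_mcot; rewrite xt (lt_le_trans pa).
  change (cont_at (fun x => mcot x / x) x); continuity => //.
  by rewrite gt_eqF //; lra.
have cgw : {within `[a, theta1 R], continuous mcot_over}.
  by apply: continuous_in_subspaceT => x; rewrite inE /= in_itv /=; exact: cg.
have inj x y : a <= x <= theta1 R -> a <= y <= theta1 R -> mcot_over x = mcot_over y -> x = y.
  move=> /andP[ax xt] /andP[ay yt] E; have [xy|yx|//] := ltgtP x y.
    by have := mcot_over_decreasing (lt_le_trans pa ax) xy yt; rewrite E ltxx.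
  by have := mcot_over_decreasing (lt_le_trans pa ay) yx xt; rewrite E ltxx.
pose inv y := xget a [set r | a <= r <= theta1 R /\ mcot_over r = y].
have invK x : a <= x <= theta1 R -> inv (mcot_over x) = x.
  move=> hx; have [|h1 h2] := @xgetPex _ a [set r | a <= r <= theta1 R /\ mcot_over r = mcot_over x].
    by exists x.
  exact: inj h2.
have ga : 0 < mcot_over a by rewrite -g1; apply: mcot_over_decreasing.
have cinv : {within `[mcot_over (theta1 R), mcot_over a], continuous inv}.
  apply: segment_can_ge_continuous cgw _; first exact: ltW.
  by move=> x; rewrite in_itv /=; exact: invK.
rewrite g1 in cinv; have [ci _ _] := (continuous_within_itvP inv ga).1 cinv.
exists inv => y y0; have /andP[yp yg] := y0.
have [x hx E] : exists2 x, a <= x <= theta1 R & mcot_over x = y.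
  have [|x] := @IVT R mcot_over a (theta1 R) y (ltW at_) cgw.
    by rewrite g1 ge_min le_max (ltW yp) (ltW yg) orbT.
  by rewrite in_itv /=; exists x.
have iE : inv y = x by rewrite -E invK.
have /andP[ax xt] := hx; rewrite iE; split => //.
  rewrite lt_neqAle xt andbT; apply/eqP => xe; move: yp; rewrite -E xe g1 ltxx //.
by apply: ci; rewrite in_itv.
Qed.

(** For [v = (r sqrt (1 - q^2), - r q)], the components of [Lambda v = u] combine to [2 mcot r / r =
    u2 / q + u1 / sqrt (1 - q^2)]; this is half of the right side, and it determines [r] from
    [q]. *)
Definition axial_excess u1 u2 q : R := (u2 / q + u1 / Num.sqrt (1 - q ^+ 2)) / 2.

(** With [y = axial_excess u1 u2 q = mcot r / r], the last factor [(r^2 + m^2 + 3 m) / r] is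
    [r + r y^2 + 3 y]. As [q] tends to [0], [r] tends to [pi] and [r y^2 q^2] to [pi u2^2 / 4 < u1];
    at [q^2 = 2/3] the term [3 y] alone suffices to reach [u1]. *)
Lemma parameters_exist u1 u2 : 0 < u1 -> 0 < u2 -> pi * u2 ^+ 2 < 4 * u1 ->
  exists r q, [/\ pi < r < theta1 R, 0 < q < 1, mcot_over r = axial_excess u1 u2 q &
    u1 = (r ^+ 2 + mcot r ^+ 2 + 3 * mcot r) / r * (q ^+ 2 * Num.sqrt (1 - q ^+ 2))].
Proof.
move=> u10 u20 hu; have p2 := pi_ge2 R; have [/andP[th1 th2] _] := @theta1_spec R.
have [r1 /andP[pr1 r1t] hr1] : exists2 r1, pi < r1 < theta1 R & r1 * u2 ^+ 2 < 4 * u1.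
  have u22 : 0 < u2 ^+ 2 by rewrite exprn_gt0.
  have e0 : 0 < (4 * u1 - pi * u2 ^+ 2) / u2 ^+ 2 / 2 by rewrite !divr_gt0 // subr_gt0.
  have eE : (4 * u1 - pi * u2 ^+ 2) / u2 ^+ 2 / 2 * u2 ^+ 2 = (4 * u1 - pi * u2 ^+ 2) / 2 by field; rewrite gt_eqF.
  set e := _ / _ / 2 in e0 eE.
  pose d := Num.min e ((theta1 R - pi) / 2).
  have d0 : 0 < d by rewrite lt_min e0 divr_gt0 // subr_gt0.
  have de : d <= e by rewrite ge_min lexx.
  have dt : d <= (theta1 R - pi) / 2 by rewrite ge_min lexx orbT.
  have du : d * u2 ^+ 2 <= (4 * u1 - pi * u2 ^+ 2) / 2 by rewrite -eE ler_pM2r.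
  exists (pi + d); last by clear - du hu; lra.
  by apply/andP; split; clear - d0 dt th1; lra.
(* [Kc * q0] bounds everything beyond [r1 * u2 ^+ 2 / 4] in the value at [q0]. *)
pose Kc := r1 + r1 * (u1 * u2) + r1 * u1 ^+ 2 + 3 / 2 * u2 + 3 * u1.
have r10 : 0 < r1 by clear - p2 pr1; lra.
have Kc0 : 0 < Kc by rewrite /Kc !addr_gt0 ?mulr_gt0 ?exprn_gt0 //; clear; lra.
have g1 : 0 < mcot_over r1.
  by rewrite -(mul0r (theta1 R)^-1) -[X in X / _](@mcot_theta1 R) mcot_over_decreasing.
(* The three bounds give [q0^2 <= q0] and [q0 <= q1], an error within half of the slack, and
   [mcot_over r1 <= axial_excess u1 u2 q0], that is, [r <= r1]. *)
pose q0 := Num.min (2^-1) (Num.min ((4 * u1 - r1 * u2 ^+ 2) / 4 / Kc / 2) (u2 / mcot_over r1 / 2)).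
have q00 : 0 < q0.
  have d1 : 0 < (4 * u1 - r1 * u2 ^+ 2) / 4 / Kc / 2 by rewrite !divr_gt0 // subr_gt0.
  have d2 : 0 < u2 / mcot_over r1 / 2 by rewrite divr_gt0 // divr_gt0.
  by rewrite /q0 !lt_min d1 d2 !andbT invr_gt0.
have q0h : q0 <= 2^-1 by rewrite /q0 ge_min lexx.
have q0K : q0 * Kc <= (4 * u1 - r1 * u2 ^+ 2) / 8.
  rewrite -ler_pdivlMr // /q0 !ge_min; apply/orP; right; apply/orP; left.
  by rewrite le_eqVlt; apply/orP; left; apply/eqP; field; rewrite gt_eqF.
have q0g : q0 * (2 * mcot_over r1) <= u2.
  have gg : 0 < 2 * mcot_over r1 by exact: mulr_gt0.
  rewrite -ler_pdivlMr // /q0 !ge_min; apply/orP; right; apply/orP; right.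
  by rewrite le_eqVlt; apply/orP; left; apply/eqP; field; rewrite gt_eqF.
(* Chosen so that [3 y q1^2 = 2 y], to be compared with [u1 <= 2 y sqrt (1 - q1^2)]. *)
pose q1 : R := Num.sqrt (2 / 3).
have q12 : q1 ^+ 2 = 2 / 3 by rewrite sqr_sqrtr //; clear; lra.
have q10 : 0 <= q1 by exact: sqrtr_ge0.
have q01 : q0 <= q1 by clear - q12 q10 q0h q00; nra.
have wlo q : q0 <= q <= q1 -> 1 / 3 <= 1 - q ^+ 2.
  by move=> /andP[h1 h2]; clear - q12 h1 h2 q00; nra.
have w0 q : q0 <= q <= q1 -> 2^-1 <= Num.sqrt (1 - q ^+ 2).
  move=> /wlo h; have -> : 2^-1 = Num.sqrt (4^-1) :> R.
    by rewrite -[LHS]ger0_norm ?invr_ge0 // -sqrtr_sqr; congr Num.sqrt; field.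
  rewrite ler_sqrt; clear - h; lra.
have inv_le2 (w : R) : 2^-1 <= w -> w^-1 <= 2.
  move=> h; have h0 : 0 < w by apply: lt_le_trans h; rewrite invr_gt0.
  by rewrite -[leRHS]invrK lef_pV2 // posrE invr_gt0.
have Ybd q : q0 <= q <= q1 -> 0 < axial_excess u1 u2 q <= (u2 / q0 + u1 * 2) / 2.
  move=> hq; have /andP[h1 h2] := hq; have h := w0 _ hq.
  have qp : 0 < q by exact: lt_le_trans h1.
  have wp : 0 < Num.sqrt (1 - q ^+ 2) by apply: lt_le_trans h; rewrite invr_gt0.
  apply/andP; split; first by rewrite /axial_excess divr_gt0 // addr_gt0 // divr_gt0.
  have e1 : u2 / q <= u2 / q0 by rewrite ler_pM2l // lef_pV2.
  have e2 : u1 / Num.sqrt (1 - q ^+ 2) <= u1 * 2.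
    by rewrite ler_pM2l // inv_le2.
  by rewrite /axial_excess; clear - e1 e2; lra.
(* [a] is so close to [pi] that [mcot_over a] exceeds all values of [axial_excess] on [[q0, q1]]. *)
have [a /andP[pa at_] ha] := mcot_unbounded (theta1 R * ((u2 / q0 + u1 * 2) / 2)).
have hga : (u2 / q0 + u1 * 2) / 2 < mcot_over a.
  rewrite /mcot_over ltr_pdivlMr; last by clear - pa p2; lra.
  apply: le_lt_trans ha; rewrite mulrC ler_wpM2r ?(ltW at_) //.
  by rewrite ltW // divr_gt0 // addr_gt0 ?divr_gt0 ?mulr_gt0.
have [inv hinv] := @mcot_over_inverse a (introT andP (conj pa at_)).
have {}hinv q : q0 <= q <= q1 -> [/\ pi < inv (axial_excess u1 u2 q),
    inv (axial_excess u1 u2 q) < theta1 R,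
    mcot_over (inv (axial_excess u1 u2 q)) = axial_excess u1 u2 q &
    cont_at inv (axial_excess u1 u2 q)].
  move=> /Ybd /andP[y0 y1]; have [|ia it iE ic] := hinv (axial_excess u1 u2 q).
    by rewrite y0 (le_lt_trans y1).
  by split => //; exact: lt_le_trans ia.
pose rq q := inv (axial_excess u1 u2 q).
pose G q := (rq q ^+ 2 + mcot (rq q) ^+ 2 + 3 * mcot (rq q)) / rq q * (q ^+ 2 * Num.sqrt (1 - q ^+ 2)) - u1.
have BE r : 0 < r -> (r ^+ 2 + mcot r ^+ 2 + 3 * mcot r) / r = r + r * mcot_over r ^+ 2 + 3 * mcot_over r.
  by move=> rp; rewrite /mcot_over; field; rewrite gt_eqF.
have [|| q hq Gq] := @zero_between R G q0 q1 q01.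
- move=> q hq; have [ip it iE ic] := hinv q hq.
  have /andP[h1 h2] := hq; have qp : 0 < q by exact: lt_le_trans h1.
  have wp : 0 < Num.sqrt (1 - q ^+ 2) by apply: lt_le_trans (w0 _ hq); rewrite invr_gt0.
  have cr : cont_at rq q.
    rewrite /rq; apply: (cont_comp (g := inv)) => //.
    by rewrite /axial_excess; continuity; rewrite gt_eqF.
  have cm : cont_at (fun q => mcot (rq q)) q.
    by apply: (cont_comp (g := mcot)) => //; apply: cont_mcot; rewrite ip ltW.
  rewrite /G; continuity => //.
  by rewrite gt_eqF // (lt_trans _ ip) // pi_gt0.
- apply/andP; split.
    have hq0 : q0 <= q0 <= q1 by rewrite lexx.
    have [ip it iE _] := hinv q0 hq0; have hw := w0 _ hq0.
    have rp : 0 < rq q0 by exact: lt_trans (pi_gt0 R) ip.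
    rewrite /G BE // subr_le0 /rq iE -/(rq q0).
    have w1 : Num.sqrt (1 - q0 ^+ 2) <= 1 by rewrite -[leRHS]sqrtr1 ler_sqrt // gerBl sqr_ge0.
    have rr1 : rq q0 <= r1.
      rewrite leNgt; apply/negP => h; have := mcot_over_decreasing pr1 h (ltW it).
      rewrite /rq iE -/(rq q0) ltNge => /negP; apply.
      have e1 : 2 * mcot_over r1 <= u2 / q0 by rewrite ler_pdivlMr // mulrC.
      have e2 : 0 <= u1 / Num.sqrt (1 - q0 ^+ 2) by rewrite divr_ge0 ?sqrtr_ge0 // ltW.
      by rewrite /axial_excess; clear - e1 e2; lra.
    have wp : 0 < Num.sqrt (1 - q0 ^+ 2) by apply: lt_le_trans hw; rewrite invr_gt0.
    have z1 : axial_excess u1 u2 q0 * q0 <= (u2 + 2 * u1 * q0) / 2.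
      have -> : axial_excess u1 u2 q0 * q0 = (u2 + (Num.sqrt (1 - q0 ^+ 2))^-1 * (u1 * q0)) / 2.
        by rewrite /axial_excess; field; rewrite !gt_eqF.
      have : (Num.sqrt (1 - q0 ^+ 2))^-1 * (u1 * q0) <= 2 * (u1 * q0).
        by rewrite ler_pM2r ?mulr_gt0 // inv_le2.
      by clear; lra.
    have /andP[y0 _] := Ybd _ hq0.
    set y := axial_excess _ _ _ in z1 y0 *; set r := rq q0 in rp rr1 *.
    rewrite mulrA; apply: (@le_trans _ _ ((r + r * y ^+ 2 + 3 * y) * q0 ^+ 2)).
      have ry := mulr_ge0 (ltW rp) (sqr_ge0 y).
      have b0 : 0 <= r + r * y ^+ 2 + 3 * y by clear - ry rp y0; lra.
      by rewrite ler_piMr // (mulr_ge0 b0) // sqr_ge0.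
    have -> : (r + r * y ^+ 2 + 3 * y) * q0 ^+ 2 = r * q0 ^+ 2 + r * (y * q0) ^+ 2 + 3 * (y * q0) * q0 by ring.
    have z0 : 0 <= y * q0 by rewrite ltW // mulr_gt0.
    have zz : (y * q0) ^+ 2 <= ((u2 + 2 * u1 * q0) / 2) ^+ 2.
      by rewrite ler_pXn2r ?nnegrE // (le_trans z0).
    have t1 : r * q0 ^+ 2 <= r1 * q0 ^+ 2 by rewrite ler_wpM2r ?sqr_ge0.
    have t2 : r * (y * q0) ^+ 2 <= r1 * ((u2 + 2 * u1 * q0) / 2) ^+ 2.
      by apply: ler_pM => //; rewrite ?sqr_ge0 // ltW.
    have t3 : 3 * (y * q0) * q0 <= 3 * ((u2 + 2 * u1 * q0) / 2) * q0.
      by rewrite ler_wpM2r ?(ltW q00) // ler_wpM2l.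
    have qq : q0 ^+ 2 <= q0 by clear - q0h q00; nra.
    have s1 : r1 * q0 ^+ 2 <= r1 * q0 by rewrite ler_pM2l.
    have s2 : r1 * u1 ^+ 2 * q0 ^+ 2 <= r1 * u1 ^+ 2 * q0.
      exact: ler_wpM2l (mulr_ge0 (ltW r10) (sqr_ge0 u1)) _ _ qq.
    have s3 : u1 * q0 ^+ 2 <= u1 * q0 by rewrite ler_pM2l.
    have s4 : r1 * u1 * u2 * q0 ^+ 2 <= r1 * u1 * u2 * q0 by rewrite ler_pM2l // !mulr_gt0.
    move: q0K; rewrite /Kc; clear - t1 t2 t3 s1 s2 s3 s4 hr1; lra.
  have hq1 : q0 <= q1 <= q1 by rewrite lexx q01.
  have [ip it iE _] := hinv q1 hq1.
  have rp : 0 < rq q1 by exact: lt_trans (pi_gt0 R) ip.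
  rewrite /G BE // subr_ge0 /rq iE -/(rq q1).
  have /andP[y0 _] := Ybd _ hq1.
  have wp : 0 < Num.sqrt (1 - q1 ^+ 2) by apply: lt_le_trans (w0 _ hq1); rewrite invr_gt0.
  have yw : u1 <= 2 * axial_excess u1 u2 q1 * Num.sqrt (1 - q1 ^+ 2).
    have -> : 2 * axial_excess u1 u2 q1 * Num.sqrt (1 - q1 ^+ 2) = u2 / q1 * Num.sqrt (1 - q1 ^+ 2) + u1.
      by rewrite /axial_excess; field; rewrite !gt_eqF //; exact: lt_le_trans q01.
    by rewrite lerDr mulr_ge0 ?sqrtr_ge0 // divr_ge0 // ltW.
  set y := axial_excess _ _ _ in yw y0 *; set w := Num.sqrt _ in wp yw *.
  apply: (le_trans yw); rewrite mulrA ler_pM2r // q12.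
  have ry : 0 <= rq q1 * y ^+ 2 by rewrite mulr_ge0 ?sqr_ge0 // ltW.
  by clear - ry rp y0; lra.
have [ip it iE _] := hinv q hq; have /andP[h1 h2] := hq.
exists (rq q), q; split.
- by rewrite ip.
- by rewrite (lt_le_trans q00 h1) /=; clear - h2 q12 h1 q00; nra.
- by [].
- by move: Gq; rewrite /G => /eqP; rewrite subr_eq0 => /eqP ->.
Qed.

End Surjectivity.

(** * Membership in [Omega_m4] *)

Section OmegaMembership.
Context {R : realType}.

(** The hypothesis expresses [0 < u.2] and the conclusion [pi < v.1]. It suffices that
    [2 m r^2 < (r^2 - pi^2) Q], which is checked in the variable [e = r - pi], where
    [m sin e = r cos e - sin e]. *)
Lemma axial_gt_pi (r q : R) : pi < r < theta1 R ->
  q ^+ 2 * (r ^+ 2 + mcot r ^+ 2 + 3 * mcot r) < 2 * mcot r ->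
  pi ^+ 2 < r ^+ 2 * (1 - q ^+ 2).
Proof.
move=> /andP[pr rt] hq; have p2 := pi_ge2 R; have [/andP[_ th2] _] := @theta1_spec R.
pose e := r - pi; have e0 : 0 < e by rewrite subr_gt0.
have r0 : 0 < r by lra.
have m0 : 0 < mcot r by rewrite -(@mcot_theta1 R) mcot_decreasing.
have s0 : 0 < sin e by apply: sin_gt0_pi; rewrite /e; lra.
have c0 : 0 < cos e by apply: cos_gt0_pihalf; rewrite /e; lra.
have mE : mcot r * sin e = r * cos e - sin e.
  rewrite /mcot /cot (_ : r = e + pi); last by rewrite /e; ring.
  by rewrite sinDpi cosDpi; field; rewrite gt_eqF.
have cs := cos2Dsin2 e.
have sc : sin e * cos e <= e.
  have := @sin_le_id R (e *+ 2); rewrite sin_mulr2n !mulr2n => h.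
  have : cos e * sin e + cos e * sin e <= e + e by apply: h; lra.
  lra.
have re : r = pi + e by rewrite /e; ring.
set s := sin e in s0 mE cs sc; set c := cos e in c0 mE cs sc.
clearbody s c e.
set m := mcot r in hq m0 mE; clearbody m.
pose Q := r ^+ 2 + m ^+ 2 + 3 * m.
have Q0 : 0 < Q by rewrite /Q; clear - r0 m0; nra.
have sQ : s ^+ 2 * Q = r ^+ 2 + r * (s * c) - 2 * s ^+ 2.
  have -> : s ^+ 2 * Q = r ^+ 2 * s ^+ 2 + (m * s) ^+ 2 + 3 * s * (m * s) by rewrite /Q; ring.
  have s2 : s ^+ 2 = 1 - c ^+ 2 by rewrite -cs; ring.
  by rewrite mE; ring: s2.
have s20 : 0 < s ^+ 2 by rewrite exprn_gt0.
have r20 : 0 < r ^+ 2 by rewrite exprn_gt0.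
have key : 2 * m * r ^+ 2 < (r ^+ 2 - pi ^+ 2) * Q.
  rewrite -(ltr_pM2l s20).
  have -> : s ^+ 2 * (2 * m * r ^+ 2) = 2 * r ^+ 2 * (s * (m * s)) by ring.
  have -> : s ^+ 2 * ((r ^+ 2 - pi ^+ 2) * Q) = (r ^+ 2 - pi ^+ 2) * (s ^+ 2 * Q) by ring.
  rewrite sQ mE.
  pose k := 1 - pi ^+ 2 / r ^+ 2.
  have k1 : k <= 1 by rewrite gerBl divr_ge0 ?sqr_ge0.
  have k0 : 0 <= k by rewrite subr_ge0 ler_pdivrMr // mul1r; clear - pr p2; nra.
  have kE : r ^+ 2 - pi ^+ 2 = r ^+ 2 * k by rewrite /k; field; rewrite gt_eqF.
  have kl : - s ^+ 2 <= k * (r * (s * c) - 2 * s ^+ 2).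
    have h : - s ^+ 2 <= r * (s * c) - 2 * s ^+ 2.
      have : 0 < s * (m * s) by rewrite !mulr_gt0.
      by rewrite mE; clear; lra.
    by clear - h k0 k1 s20; nra.
  rewrite kE -mulrA mulrCA -mulrA ltr_pM2l //.
  have -> : k * (r ^+ 2 + r * (s * c) - 2 * s ^+ 2) = (r ^+ 2 - pi ^+ 2) + k * (r * (s * c) - 2 * s ^+ 2).
    by rewrite kE; ring.
  (* The remaining inequality is [r^2 - pi^2 - 2 r s c + s^2 > 0], and its left side equals [2 pi (e
     - s c) + (e - s c)^2 + s^2 (1 - c^2)]. *)
  have P1 : 0 <= pi * (e - s * c) by rewrite mulr_ge0 ?subr_ge0 // pi_ge0.
  have P2 : 0 <= (e - s * c) ^+ 2 by exact: sqr_ge0.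
  have P3 : 0 < s ^+ 2 * (1 - c ^+ 2).
    by have -> : 1 - c ^+ 2 = s ^+ 2 by [rewrite -cs; ring]; rewrite mulr_gt0.
  rewrite re; clear - kl P1 P2 P3 re; rewrite re in kl; lra.
have h : q ^+ 2 * r ^+ 2 * Q < 2 * m * r ^+ 2 by rewrite mulrAC ltr_pM2r.
have : q ^+ 2 * r ^+ 2 * Q < (r ^+ 2 - pi ^+ 2) * Q by exact: lt_trans key.
by rewrite ltr_pM2r // => ?; lra.
Qed.

Lemma Omega_psi (v : R * R) (r := norm2 v) : Omega_m4 v ->
  [/\ pi < r < theta1 R, r ^+ 2 = v.1 ^+ 2 + v.2 ^+ 2,
   v.2 ^+ 2 * (r ^+ 2 + mcot r ^+ 2 + 3 * mcot r) < 2 * mcot r * r ^+ 2 &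
   Lambda v = (psi'_over r * v.2 ^+ 2 * v.1, v.2 * (psi'_over r * v.2 ^+ 2 - 2 * mcot r / r ^+ 2))].
Proof.
move=> [v20 [/andP[pv vr] [rt hneg]]]; rewrite -/r in vr rt hneg.
have p0 := pi_gt0 R; have [/andP[_ th2] _] := @theta1_spec R.
have pr : pi < r by exact: lt_trans vr.
have r0 : 0 < r by exact: lt_trans pr.
have r2 : r ^+ 2 = v.1 ^+ 2 + v.2 ^+ 2 by rewrite sqr_sqrtr // addr_ge0 ?sqr_ge0.
have pE : derive1 (@psi R) r / r = psi'_over r.
  by rewrite psi'E ?pr ?(lt_trans rt) // /psi'_over; field; rewrite gt_eqF.
have qE : 2 * psi r = - (2 * mcot r / r ^+ 2) by rewrite psiE; field; rewrite gt_eqF.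
rewrite pE qE in hneg.
split => //; first by rewrite pr.
  have r40 : 0 < r ^+ 4 by rewrite exprn_gt0.
  move: hneg; rewrite -(pmulr_rlt0 _ r40) /psi'_over.
  have -> : r ^+ 4 * (- (2 * mcot r / r ^+ 2) + (r ^+ 2 + mcot r ^+ 2 + 3 * mcot r) / r ^+ 4 * v.2 ^+ 2) =
     v.2 ^+ 2 * (r ^+ 2 + mcot r ^+ 2 + 3 * mcot r) - 2 * mcot r * r ^+ 2 by field; rewrite gt_eqF.
  by rewrite subr_lt0.
by rewrite /Lambda -/r pE qE; congr pair; ring.
Qed.

Lemma Lambda_surjective (u : R * R) : R2_lt_plus u -> exists v, Omega_m4 v /\ Lambda v = u.
Proof.
case: u => u1 u2 [/= u10 /andP[u20 hu]].
have p0 := pi_gt0 R; have [/andP[_ th2] _] := @theta1_spec R.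
have hu2 : pi * u2 ^+ 2 < 4 * u1.
  have spi : 0 < Num.sqrt pi :> R by rewrite sqrtr_gt0.
  have : u2 ^+ 2 < (2 / Num.sqrt pi * Num.sqrt u1) ^+ 2 by rewrite ltr_pXn2r ?nnegrE ?ltW // (lt_trans u20).
  rewrite !exprMn exprVn !sqr_sqrtr ?ltW // => h.
  have := ltr_pM2l p0 (u2 ^+ 2) (2 ^+ 2 / pi * u1); rewrite h.
  have -> : pi * (2 ^+ 2 / pi * u1) = 4 * u1.
    by move: p0; move: (pi : R) => x x0; field; rewrite gt_eqF.
  by [].
have [r [q [/andP[pr rt] /andP[q0 q1] E1 E2]]] := parameters_exist u10 u20 hu2.
have r0 : 0 < r by exact: lt_trans pr.
pose w := Num.sqrt (1 - q ^+ 2).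
have q2 : 0 < 1 - q ^+ 2 by clear - q0 q1; nra.
have w2 : w ^+ 2 = 1 - q ^+ 2 by rewrite sqr_sqrtr // ltW.
have w0 : 0 < w by rewrite sqrtr_gt0.
pose m := mcot r; pose Q := r ^+ 2 + m ^+ 2 + 3 * m.
have u2E : u2 = q * (2 * m - q ^+ 2 * Q) / r.
  have : u2 = q * (2 * axial_excess u1 u2 q - u1 / w) by rewrite /axial_excess -/w; field; rewrite !gt_eqF.
  by rewrite -E1 {1}E2 /mcot_over -/w => ->; rewrite /Q /m; field; rewrite !gt_eqF.
have hq : q ^+ 2 * Q < 2 * m.
  by move: u20; rewrite u2E pmulr_lgt0 ?invr_gt0 // pmulr_rgt0 // subr_gt0.
(* [q] is the sine of the angle between [v] and the first axis. *)
pose v : R * R := (r * w, - (r * q)).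
have nv : norm2 v = r.
  by rewrite /norm2 /v /= sqrrN !exprMn w2 -mulrDr subrK mulr1 sqrtr_sqr ger0_norm // ltW.
have pw : pi < r * w.
  have := axial_gt_pi (introT andP (conj pr rt)) hq; rewrite -w2 -exprMn.
  by rewrite ltr_pXn2r ?nnegrE ?ltW // mulr_gt0.
have w1 : w < 1.
  have : w ^+ 2 < 1 ^+ 2 by rewrite expr1n w2 gtrBl exprn_gt0.
  by rewrite ltr_pXn2r ?nnegrE ?ltW.
have pE : derive1 (@psi R) r / r = Q / r ^+ 4.
  by rewrite psi'E ?pr ?(lt_trans rt) // /Q /m; field; rewrite gt_eqF.
have Om : Omega_m4 v.
  rewrite /Omega_m4 /= nv; split; first by rewrite oppr_lt0 mulr_gt0.
  split; first by rewrite pw /= gtr_pMr.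
  split => //; rewrite pE psiE -/m.
  have -> : 2 * (- m / r ^+ 2) + Q / r ^+ 4 * (- (r * q)) ^+ 2 = (q ^+ 2 * Q - 2 * m) / r ^+ 2.
    by field; rewrite gt_eqF.
  by rewrite pmulr_llt0 ?invr_gt0 ?exprn_gt0 // subr_lt0.
exists v; split => //.
have [_ _ _ ->] := Omega_psi Om; rewrite nv /v /= /psi'_over -/m -/Q; congr pair.
  by rewrite E2 -/w -/m -/Q; field; rewrite gt_eqF.
by rewrite [RHS]u2E; field; rewrite gt_eqF.
Qed.

End OmegaMembership.

(** * The distance *)

Lemma curve_length_ge0 (R : realType) (h : 'I_3 -> R -> R) : 0 <= curve_length h.
Proof. by apply: Rintegral_ge0 => x _; exact: sqrtr_ge0. Qed.

(** The terms [r cot r = mcot r + 1] and [psi r * v.1 ^ 2 = - mcot r * v.1 ^ 2 / r ^ 2] combine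
    through [r^2 - v.1^2 = v.2^2]. *)
Lemma phi_in_plane (R : realType) (u v : R * R) (r := norm2 v) :
  r != 0 -> r ^+ 2 = v.1 ^+ 2 + v.2 ^+ 2 ->
  phi (e1 R, 4^-1 *: vec3 u.1 u.2 0) (vec3 v.1 v.2 0) =
  1 + mcot r * (v.2 ^+ 2 / r ^+ 2) + u.1 * v.1 + u.2 * v.2.
Proof.
move=> r0 r2.
have d3 (x y : 'rV[R]_3) : dot3 x y = x 0 0 * y 0 0 + x 0 1 * y 0 1 + x 0 2 * y 0 2.
  rewrite /dot3 !big_ord_recl big_ord0 addr0 addrA.
  by congr (_ + x _ _ * y _ _ + x _ _ * y _ _); exact/val_inj.
have [v0 v1 v2] := vec3E v.1 v.2 0; have [w0 w1 w2] := vec3E u.1 u.2 0.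
have [z0 z1 z2] := vec3E 1 (0 : R) 0.
have n1 : norm3 (e1 R) = 1.
  by rewrite /norm3 d3 z0 z1 z2 !mul0r !addr0 mul1r sqrtr1.
have nv : norm3 (vec3 v.1 v.2 0) = r.
  by rewrite /norm3 d3 v0 v1 v2 mul0r addr0 -!expr2.
rewrite /phi /= nv n1 !d3 v0 v1 v2 z0 z1 z2 !mxE /= psiE.
rewrite [_ * r * cot r](_ : _ = mcot r + 1); last by rewrite /mcot; ring.
have -> : v.2 ^+ 2 = r ^+ 2 - v.1 ^+ 2 by rewrite r2; ring.
by field.
Qed.

Lemma ccdist_Lambda (R : realType) (v : R * R) (u := Lambda v) : Omega_m4 v -> 0 < u.1 -> 0 < u.2 ->
  ccdist (e1 R, 4^-1 *: vec3 u.1 u.2 0) ^+ 2 =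
  phi (e1 R, 4^-1 *: vec3 u.1 u.2 0) (vec3 v.1 v.2 0).
Proof.
move=> Om u10 u20; have [v20 [/andP[pv _] _]] := Om.
have [/andP[pr rt] r2 hneg LE] := Omega_psi Om.
set r := norm2 v in pr rt r2 hneg LE.
have p0 := pi_gt0 R; have p2 := pi_ge2 R; have [/andP[_ th2] _] := @theta1_spec R.
have r0 : 0 < r by exact: lt_trans pr.
have rn0 : r != 0 by rewrite gt_eqF.
have ri : pi < r <= theta1 R by rewrite pr ltW.
have m0 : 0 < mcot r by rewrite -(@mcot_theta1 R) mcot_decreasing.
have [s_neg _] := @third_quadrant R r (introT andP (conj pr (lt_trans rt th2))).
have sr0 : sin r != 0 by rewrite lt_eqF.
pose rho := - v.2; have rho0 : 0 < rho by rewrite oppr_gt0.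
have rv2 : v.2 ^+ 2 = rho ^+ 2 by rewrite sqrrN.
have w1 : Num.sqrt (r ^+ 2 - rho ^+ 2) = v.1.
  by rewrite r2 rv2 addrK sqrtr_sqr ger0_norm // ltW // (lt_trans p0).
have U1 : u.1 = rho ^+ 2 * (psi'_over r * Num.sqrt (r ^+ 2 - rho ^+ 2)).
  by rewrite w1 /u LE /= rv2; ring.
have U2 : u.2 = rho * (2 * mcot r / r ^+ 2 - psi'_over r * rho ^+ 2).
  by rewrite /u LE /= rv2 /rho; ring.
(* The bound [r^2 + m^2 >= 2 r m] turns the last condition of [Omega_m4] into
   [rho^2 (2 r + 3) < 2 r^2]. As [2 r^2 / (2 r + 3)] increases, [r] may be replaced by [3 / 2 * pi],
   and [pi >= 2] concludes. *)
have rho2 : 2 * rho ^+ 2 <= pi ^+ 2.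
  rewrite rv2 in hneg.
  have rr : 0 < rho ^+ 2 by rewrite exprn_gt0.
  have am : mcot r * (2 * r + 3) <= r ^+ 2 + mcot r ^+ 2 + 3 * mcot r.
    by have := sqr_ge0 (r - mcot r); clear; lra.
  have h1 : rho ^+ 2 * (2 * r + 3) < 2 * r ^+ 2.
    rewrite -(ltr_pM2l m0).
    have -> : mcot r * (2 * r ^+ 2) = 2 * mcot r * r ^+ 2 by ring.
    by apply: le_lt_trans hneg; rewrite mulrCA ler_wpM2l // ltW.
  have rb : r < 3 / 2 * pi by exact: lt_trans th2.
  clear - h1 rb r0 p2 rr; move: (pi : R) p2 rb => p p2 rb.
  have h2 : 2 * r ^+ 2 * (3 * p + 3) <= 2 * (9 / 4 * p ^+ 2) * (2 * r + 3).
    rewrite -subr_ge0 [leRHS](_ : _ = (3 / 2 * p - r) * (6 * p * r + 6 * r + 9 * p)); last by field.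
    by rewrite mulr_ge0 ?subr_ge0 ?(ltW rb) // !addr_ge0 // ?mulr_ge0 //; lra.
  have h3 : rho ^+ 2 * (3 * p + 3) < 9 / 2 * p ^+ 2.
    have rp : 0 < 2 * r + 3 by lra.
    rewrite -(ltr_pM2r rp).
    have -> : rho ^+ 2 * (3 * p + 3) * (2 * r + 3) = rho ^+ 2 * (2 * r + 3) * (3 * p + 3) by ring.
    apply: (@lt_le_trans _ _ (2 * r ^+ 2 * (3 * p + 3))); first by rewrite ltr_pM2r //; lra.
    by apply: le_trans h2 _; rewrite le_eqVlt; apply/orP; left; apply/eqP; field.
  nra.
pose c := v.1 / r; pose s := rho / r.
have cs : c ^+ 2 + s ^+ 2 = 1.
  by rewrite /c /s !expr_div_n -mulrDl -rv2 -r2 divff // expf_neq0.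
pose h := helix_velocity r c s.
have hx : curve_x h 1 = e1 R by exact: helix_endpoint.
have ht : curve_t h 1 = 4^-1 *: vec3 u.1 u.2 0.
  rewrite (helix_area rn0 sr0 cs); congr (_ *: vec3 _ _ _).
    by rewrite U1 w1 /c /s /psi'_over; field.
  by rewrite U2 /s /psi'_over; field.
have hint i : int01 (h i) by exact: helix_velocity_int01.
have hL : curve_length h ^+ 2 = phi (e1 R, 4^-1 *: vec3 u.1 u.2 0) (vec3 v.1 v.2 0).
  rewrite (helix_length rn0 sr0 cs) phi_in_plane // -/r rv2 U1 U2 w1 /s /psi'_over.
  have -> : v.2 = - rho by rewrite /rho opprK.
  have v12 : v.1 ^+ 2 = r ^+ 2 - rho ^+ 2 by rewrite r2 rv2 addrK.
  by field: v12.
(* The lower bound is the value of [phi] at [v], which the helix attains; so the infimum is a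
   minimum. *)
have lower (g : 'I_3 -> R -> R) : (forall i, int01 (g i)) -> curve_x g 1 = e1 R ->
    curve_t g 1 = 4^-1 *: vec3 u.1 u.2 0 -> curve_length h <= curve_length g.
  move=> gi gx gt.
  have := curve_lower_bound rho0 (ltW u10) (ltW u20) ri rho2 U1 gi gx gt.
  rewrite w1 -rv2 -mulrN (_ : - rho = v.2); last by rewrite /rho opprK.
  by rewrite -phi_in_plane // -hL ler_pXn2r ?nnegrE ?curve_length_ge0.
rewrite -hL /ccdist; congr (_ ^+ 2); apply/eqP; rewrite eq_le; apply/andP; split.
  apply: ge_inf; last by exists h.
  by exists 0 => _ [g [_ [_ [_ ->]]]]; exact: curve_length_ge0.
apply: lb_le_inf; first by exists (curve_length h), h.
by move=> _ [g [gi [gx [gt ->]]]]; exact: lower.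
Qed.

Theorem theorem11p6 (R : realType) (u : R * R) :
  R2_lt_plus u ->
  ccdist (e1 R, 4^-1 *: vec3 u.1 u.2 0) ^+ 2 =
  phi (e1 R, 4^-1 *: vec3 u.1 u.2 0) (vec3 (Lambda_inv u).1 (Lambda_inv u).2 0).
Proof.
move=> hu.
(* Surjectivity excludes the default value [(0, 0)] of [xget], and [ccdist_Lambda] holds at every
   preimage in [Omega_m4], whichever is chosen. *)
have [Om LE] : Omega_m4 (Lambda_inv u) /\ Lambda (Lambda_inv u) = u.
  by have := @xgetPex _ (0, 0) [set v | Omega_m4 v /\ Lambda v = u] (Lambda_surjective hu).
have [u1 /andP[u2 _]] := hu.
by have := ccdist_Lambda Om; rewrite LE; apply.
Qed.
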